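(* There exists a separable real Banach space $X$ such that $E_1$ is Borel reducible to linear isomorphism between complex structures on $X$, i.e. to $(\mathcal C(X),\simeq)$. In particular, linear isomorphism between complex structures on $X$ is not Borel reducible to the orbit equivalence relation induced by a Polish group action on a Polish space.
   Context: For a separable real Banach space $X$, $\mathcal B(X)$ (bounded real-linear operators on $X$) is a standard Borel space for the Borel structure generated by the strong operator topology, and $\mathcal C(X)=\{T\in\mathcal B(X): T^2=-\mathrm{Id}\}$ is a Borel subset, called the standard Borel space of complex structures on $X$. For $J,K\in\mathcal C(X)$, $J\simeq K$ iff there is an automorphism (bounded, boundedly invertible, real-linear) $A$ of $X$ with $AJA^{-1}=K$; equivalently the complex Banach spaces induced on $X$ by $J$ and $K$ are $\mathbb C$-linearly isomorphic. An equivalence relation $R$ on a standard Borel space $E$ is Borel reducible to $S$ on a standard Borel space $F$ if there is a Borel map $f:E\to F$ with $xRy\Leftrightarrow f(x)Sf(y)$ for all $x,y\in E$. $E_1$ is the relation on $\mathbb R^{\mathbb N}$ given by $xE_1y$ iff there is $n$ with $x_m=y_m$ for all $m\ge n$. The orbit equivalence relation induced by a continuous action of a Polish group $H$ on a Polish space $Z$ is $xE_Hy\Leftrightarrow\exists h\in H:\ y=hx$. *)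

(* Defs.v *)
From HB Require Import structures.
From mathcomp Require Import all_boot all_order all_algebra.
From mathcomp Require Import all_classical all_reals all_analysis.

Set Implicit Arguments.
Unset Strict Implicit.
Unset Printing Implicit Defensive.

Import Order.TTheory GRing.Theory Num.Theory.
Import numFieldNormedType.Exports.

Local Open Scope classical_set_scope.
Local Open Scope ring_scope.

Definition separable (T : topologicalType) : Prop :=
  exists D : set T, countable D /\ dense D.

Definition borel (T : topologicalType) : set (set T) := <<s (@open T) >>.
Arguments borel : clear implicits.

(* The spaces are given by bare sigma-algebras SE and SF rather than as
   measurableTypes, which are always pointed: a Polish space may be empty. *)
Definition borel_reducible (E F : Type) (SE : set (set E)) (SF : set (set F))
    (r : E -> E -> Prop) (s : F -> F -> Prop) : Prop :=
  exists f : E -> F,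
    (forall B, SF B -> SE (f @^-1` B)) /\
    (forall x y, r x y <-> s (f x) (f y)).

Definition E1 (R : realType) (x y : {ptws nat -> R}) : Prop :=
  exists n, forall m, (n <= m)%N -> x m = y m.

Definition bounded_linear (R : realType) (X : normedModType R) :
    set {ptws X -> X} :=
  [set T | linear (T : X -> X) /\ exists M : R, forall x, `|T x| <= M * `|x|].
Arguments bounded_linear {R} X.

(* As a subspace of {ptws X -> X}, this type carries the strong operator
   topology. *)
Definition bounded_op (R : realType) (X : normedModType R) : Type :=
  set_type (bounded_linear X).

HB.instance Definition _ (R : realType) (X : normedModType R) :=
  Topological.copy (bounded_op X) (set_type (bounded_linear X)).

Section ComplexStructures.
Variables (R : realType) (X : normedModType R).

Definition apply_op (T : bounded_op X) : X -> X := set_val T.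

Coercion apply_op : bounded_op >-> Funclass.

Definition complex_structures : set (bounded_op X) :=
  [set T : bounded_op X | forall x, T (T x) = - x].

Definition complex_structure : Type := set_type complex_structures.

Definition op_of_cs (J : complex_structure) : bounded_op X := set_val J.

Coercion op_of_cs : complex_structure >-> bounded_op.

(* Trace on the complex structures of the Borel sigma-algebra of the strong
   operator topology. *)
Definition borel_cs : set (set complex_structure) :=
  [set op_of_cs @^-1` B | B in borel (bounded_op X)].

Definition cs_iso (J K : complex_structure) : Prop :=
  exists A A' : bounded_op X,
    [/\ cancel A A', cancel A' A & forall x, A (J (A' x)) = K x].

End ComplexStructures.

Arguments borel_cs {R} X.
Arguments cs_iso {R} X.

#[short(type="preTopologicalGroupType")]
HB.structure Definition PreTopologicalGroup := {G of Topological G & Group G}.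

HB.mixin Record PreTopologicalGroup_isTopologicalGroup G
    & PreTopologicalGroup G := {
  mulg_continuous : continuous (fun x : G * G => (x.1 * x.2)%g) ;
  invg_continuous : continuous (fun x : G => (x^-1)%g)
}.

#[short(type="topologicalGroupType")]
HB.structure Definition TopologicalGroup :=
  {G of PreTopologicalGroup G & PreTopologicalGroup_isTopologicalGroup G}.

Section Polish.
Variable R : realType.

Definition is_metric (T : Type) (d : T -> T -> R) : Prop :=
  [/\ forall x y, d x y = 0 <-> x = y,
      forall x y, d x y = d y x &
      forall x y z, d x z <= d x y + d y z].

Definition compatible_metric (T : topologicalType) (d : T -> T -> R) : Prop :=
  forall (x : T) (A : set T),
    nbhs x A <-> exists2 e : R, 0 < e & [set y | d x y < e] `<=` A.

Definition complete_metric (T : topologicalType) (d : T -> T -> R) : Prop :=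
  forall u : nat -> T,
    (forall e : R, 0 < e -> exists N, forall m n,
       (N <= m)%N -> (N <= n)%N -> d (u m) (u n) < e) ->
    exists l : T, u @ \oo --> l.

Definition polish (T : topologicalType) : Prop :=
  separable T /\
  exists d : T -> T -> R,
    [/\ is_metric d, compatible_metric d & complete_metric d].

End Polish.

Definition continuous_action (G : topologicalGroupType) (Z : topologicalType)
    (act : G -> Z -> Z) : Prop :=
  [/\ forall z, act 1%g z = z,
      forall g h z, act (g * h)%g z = act g (act h z) &
      continuous (fun p : G * Z => act p.1 p.2)].

Definition orbit_rel (G Z : Type) (act : G -> Z -> Z) (x y : Z) : Prop :=
  exists h : G, y = act h x.

(* Main.v *)
(* Non-reducibility of E_1 (direct category argument). If f reduces E_1 to the
   orbit relation of a Polish group G acting on Z, then f is continuous on a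
   comeagre set. For generic q, points that differ in finitely many coordinates
   have f-images in one orbit, and Baire category allows one to change these
   coordinates one at a time by group elements close to the previous ones. The
   products converge, so two sequences that differ in every coordinate are sent
   to the same orbit.

   Reducibility of E_1 to complex structures. X is the c_0-sum of
   finite-dimensional complex spaces C^2 x .. x C^2, all viewed as real spaces.
   The norm of block j is invariant under the complex structure, but its distance
   to the conjugate norm grows with a parameter b j, which takes each value
   infinitely often. A sequence of signs e gives the complex structure J_e that is
   multiplication by i or -i on block j according to e j. If e and e' differ only
   where b is bounded, conjugating the blocks on which they differ is an
   isomorphism between J_e and J_e'. Conversely, let A and its inverse B intertwine
   J_e and J_e', where e j <> e' j, so that the diagonal entry of A at block j is
   antilinear. The trace of the identity of block j is the trace of BA on it; the
   part that passes through the earlier blocks is small since their dimensions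
   are, the part that passes through block j is small since antilinear maps
   distort the norm, and the part that passes through the later blocks is small
   since their norms hardly distinguish a vector from a maximum of few vectors.
   Hence b j is bounded in terms of the norms of A and B. Coding the n-th
   coordinate of a real sequence by its Dedekind cut, on the blocks with b j = n,
   reduces E_1. *)

From HB Require Import structures.
Require Import Defs.
From mathcomp Require Import all_boot all_order all_algebra.
From mathcomp Require Import all_classical all_reals all_analysis.
From mathcomp Require Import ring lra zify.
Import numFieldNormedType.Exports.

Set Implicit Arguments.
Unset Strict Implicit.
Unset Printing Implicit Defensive.

Import Order.TTheory GRing.Theory Num.Theory.

Local Open Scope ring_scope.

(** * The four functionals on a pair of complex numbers *)

(** The weights are built so that the norm remembers four complex lines. A vector supported on
    [toprung j r] indices of block [j], with [|psi r|] equal to 1 there, has norm at least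
    [2 ^ ((r + 1) b)]; if it lies in the kernel of [psi r] and has coordinates at most 1, its norm
    is at most [2 ^ (r b + 1)]. An operator whose norm is small against [2 ^ b] therefore nearly
    preserves each of the four kernels at most indices, and an antilinear one that does so has small
    entries there. The weight [2 ^ ((r + 1) b)] is reached through many rungs rather than in one
    jump: a jump would separate a vector from a maximum of few vectors by the full distortion, and
    the contribution of the infinitely many later blocks could no longer be controlled. In the other
    half the obstacle is that the set of points whose two images are related by an element of a
    given open set is only analytic, and that the complete metric of the group need not be
    invariant. Hence the elements are kept in shrinking balls of that metric, and each new product
    is kept inside the current open set. *)

Section Psi.
Variable R : realType.
Implicit Types (x y : nat -> R).

(* The coordinates [4 i, .., 4 i + 3] of [x] encode the two complex numbers
   [v = x_(4i) + i x_(4i+1)] and [w = x_(4i+2) + i x_(4i+3)], and [psi r 0],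
   [psi r 1] are the real and imaginary parts of [v], [w], [v - w], [w - i v].
   These four complex lines have a non-real cross ratio, so no antilinear map
   other than 0 preserves all of their kernels. *)
Definition psi (r e : nat) x (i : nat) : R :=
  match r, e with
  | 0, 0 => x (4 * i + 0)%N
  | 0, _ => x (4 * i + 1)%N
  | 1, 0 => x (4 * i + 2)%N
  | 1, _ => x (4 * i + 3)%N
  | 2, 0 => x (4 * i + 0)%N - x (4 * i + 2)%N
  | 2, _ => x (4 * i + 1)%N - x (4 * i + 3)%N
  | _, 0 => x (4 * i + 2)%N + x (4 * i + 1)%N
  | _, _ => x (4 * i + 3)%N - x (4 * i + 0)%N
  end.

Lemma psi_sum (T : Type) (s : seq T) (P : pred T) (a : T -> R)
    (X : T -> nat -> R) r e i :
  psi r e (fun n => \sum_(t <- s | P t) a t * X t n) i =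
  \sum_(t <- s | P t) a t * psi r e (X t) i.
Proof.
by case: r => [|[|[|r]]]; case: e => [|e] //=;
  rewrite -?sumrB -?big_split /=; apply: eq_bigr => t _; ring.
Qed.

Lemma eq_psi x y r e i :
  (forall c, (c < 4)%N -> x (4 * i + c)%N = y (4 * i + c)%N) ->
  psi r e x i = psi r e y i.
Proof.
by move=> h; case: r => [|[|[|r]]]; case: e => [|e] /=; rewrite !h.
Qed.

Lemma psiD x y r e i : psi r e (fun n => x n + y n) i = psi r e x i + psi r e y i.
Proof. by case: r => [|[|[|r]]]; case: e => [|e] //=; ring. Qed.

Lemma psiZ a x r e i : psi r e (fun n => a * x n) i = a * psi r e x i.
Proof. by case: r => [|[|[|r]]]; case: e => [|e] //=; ring. Qed.

Lemma psi_bound x t r e i :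
  (forall c, (c < 4)%N -> `|x (4 * i + c)%N| <= t) -> `|psi r e x i| <= 2 * t.
Proof.
move=> h; have := h 0%N isT; have := h 1%N isT.
have := h 2%N isT; have := h 3%N isT; rewrite !ler_norml.
by case: r => [|[|[|r]]]; case: e => [|e] /=; lra.
Qed.

Lemma psi_coord x i c : (c < 4)%N -> x (4 * i + c)%N = psi c./2 (odd c) x i.
Proof. by case: c => [|[|[|[|]]]]. Qed.

End Psi.

(** * Signs that prevent cancellation *)

Section Signs.
Variable R : realType.

Definition is_sign (t : R) := t = 1 \/ t = - 1.

Lemma sign_norm (t : R) : is_sign t -> `|t| = 1.
Proof. by case=> ->; rewrite ?normrN normr1. Qed.

Lemma norm_avg (a b : R) :
  2 * `|a| <= `|a + 1 * b| + `|a + (-1) * b| /\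
  2 * `|b| <= `|a + 1 * b| + `|a + (-1) * b|.
Proof.
split; rewrite -[X in X * _]ger0_norm // -normrM.
  apply: le_trans (ler_normD _ _); rewrite le_eqVlt; apply/orP; left.
  by apply/eqP; congr `|_|; ring.
apply: le_trans (ler_normB _ _); rewrite le_eqVlt; apply/orP; left.
by apply/eqP; congr `|_|; ring.
Qed.

(* Averaging over the signs chosen so far never decreases the diagonal terms. *)
Lemma sign_choice (T : eqType) (Q P : seq T) (M : T -> T -> R) (c : T -> R) :
  uniq P ->
  exists h : T -> R, (forall i, is_sign (h i)) /\
    \sum_(i <- Q) (if i \in P then `|M i i| else `|c i|) <=
    \sum_(i <- Q) `|c i + \sum_(k <- P) h k * M i k|.
Proof.
elim: P c => [|p P IH] c /=.
  move=> _; exists (fun=> 1); split=> [i|]; first by left.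
  by rewrite ler_sum // => i _; rewrite big_nil addr0.
case/andP => pP uP.
pose S (s : R) := \sum_(i <- Q) (if i \in P then `|M i i| else `|c i + s * M i p|).
have [s [s1 hs]] : exists s, is_sign s /\
    \sum_(i <- Q) (if i \in p :: P then `|M i i| else `|c i|) <= S s.
  have : 2 * (\sum_(i <- Q) (if i \in p :: P then `|M i i| else `|c i|)) <=
         S 1 + S (-1).
    rewrite /S -big_split /= mulr_sumr; apply: ler_sum => i _.
    have [n1 n2] := norm_avg (c i) (M i p).
    rewrite inE; case: eqVneq => [e|_] /=.
      by move: n2; rewrite e (negbTE pP).
    by case: ifP => _ //; lra.
  case: (leP (\sum_(i <- Q) (if i \in p :: P then `|M i i| else `|c i|)) (S 1)).
    by move=> h _; exists 1; split=> //; left.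
  by move=> h h'; exists (-1); split; [right|lra].
have [h [h1 hh]] := IH (fun i => c i + s * M i p) uP.
exists (fun k => if k == p then s else h k); split.
  by move=> i; case: ifP.
apply: (le_trans hs); apply: (le_trans hh).
apply: ler_sum => i _; rewrite big_cons eqxx addrA.
rewrite [X in _ <= `|_ + X|](eq_big_seq (fun k => h k * M i k)) // => k kP.
by case: eqVneq => // kp; rewrite -kp kP in pP.
Qed.

(** This is the deterministic form of averaging over random signs. It bounds a sum of diagonal
    entries by the size of a single image vector, that of a signed sum, to which a norm bound
    applies. *)
Lemma sign_diag (T : eqType) (Q : seq T) (M : T -> T -> R) :
  uniq Q ->
  exists h : T -> R, (forall i, is_sign (h i)) /\
    \sum_(i <- Q) `|M i i| <= \sum_(i <- Q) `|\sum_(k <- Q) h k * M i k|.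
Proof.
move=> uQ; have [h [h1 hh]] := sign_choice Q M (fun=> 0) uQ.
exists h; split=> //; move: hh; rewrite (eq_big_seq (fun i => `|M i i|)).
  by under [in X in _ <= X -> _]eq_bigr do rewrite add0r.
by move=> i ->.
Qed.

End Signs.

(** * Factoring finitely many functionals through a finite net *)

Section RankDecomposition.
Variables (R : realType) (T : finType) (t0 : T) (I : seq nat).
Variables (z : T -> nat -> R) (Bl : (nat -> R) -> Prop).

Definition dot (g x : nat -> R) : R := \sum_(n <- I) g n * x n.

Definition comb (l : T -> R) : nat -> R := fun n => \sum_t l t * z t n.

Hypothesis net : forall g m, (forall t, `|dot g (z t)| <= m) ->
  forall x, Bl x -> `|dot g x| <= 2 * m.

Lemma dot_comb g l : dot g (comb l) = \sum_t l t * dot g (z t).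
Proof.
rewrite /dot /comb (eq_bigr (fun n => \sum_t l t * (g n * z t n))).
  by rewrite exchange_big; apply: eq_bigr => t _; rewrite mulr_sumr.
by move=> n _; rewrite mulr_sumr; apply: eq_bigr => t _; ring.
Qed.

Lemma dotDl g h a x : dot (fun n => g n + a * h n) x = dot g x + a * dot h x.
Proof.
by rewrite /dot mulr_sumr -big_split /=; apply: eq_bigr => n _; ring.
Qed.

Lemma exists_argmax (F : T -> R) : exists t, forall t', F t' <= F t.
Proof.
exists [arg max_(t > t0) F t]%O; case: arg_maxP => // t _ h t'; exact: h.
Qed.

(** The point [z t] is one where [g] is largest on the net, and [f] is [g] divided by its value
    there; by [net] this value controls [g] on [Bl] up to the factor 2. If the value is 0, then [g]
    vanishes on [Bl] and [f] is 0. *)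
Lemma dot_step g : exists (f : nat -> R) (t : T),
  [/\ forall x, Bl x -> dot g x = dot f x * dot g (z t),
      forall l, dot g (comb l) = dot f (comb l) * dot g (z t),
      forall x, Bl x -> `|dot f x| <= 2 &
      forall t', `|dot f (z t')| <= 1].
Proof.
have [t ht] := exists_argmax (fun t => `|dot g (z t)|).
have [g0|g0] := eqVneq (dot g (z t)) 0.
  exists (fun=> 0), t; rewrite g0.
  have d0 x : dot (fun=> 0) x = 0.
    by rewrite /dot big1 // => n _; rewrite mul0r.
  split=> [x Bx|l|x Bx|t'].
  - apply/eqP; rewrite mulr0 -normr_le0 -(mulr0 2); apply: net => // t'.
    by have := ht t'; rewrite g0 normr0.
  - rewrite mulr0 dot_comb big1 // => t' _; apply/eqP.
    by rewrite mulf_eq0 -[dot _ _ == 0]normr_le0; have := ht t';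
       rewrite g0 normr0 => ->; rewrite orbT.
  - by rewrite d0 normr0.
  - by rewrite d0 normr0.
exists (fun n => (dot g (z t))^-1 * g n), t.
have dE x : dot (fun n => (dot g (z t))^-1 * g n) x = (dot g (z t))^-1 * dot g x.
  by rewrite /dot mulr_sumr; apply: eq_bigr => n _; rewrite mulrA.
split=> [x _|l|x Bx|t'].
- by rewrite dE mulrAC mulVf // mul1r.
- by rewrite dE mulrAC mulVf // mul1r.
- rewrite dE normrM normfV ler_pdivrMl ?normr_gt0 // mulrC.
  exact: net.
- by rewrite dE normrM normfV ler_pdivrMl ?normr_gt0 // mulr1.
Qed.

(* Gaussian elimination with pivots chosen in the net [z]. *)
Lemma rank_decomposition d (g : nat -> nat -> R) :
  exists (f : nat -> nat -> R) (l : nat -> T -> R),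
  [/\ forall k, (k < d)%N -> \sum_t `|l k t| <= 2 ^+ k,
      forall k x, (k < d)%N -> Bl x -> `|dot (f k) x| <= 2 &
      forall c x, (c < d)%N -> Bl x ->
        dot (g c) x = \sum_(k < d) dot (f k) x * dot (g c) (comb (l k))].
Proof.
elim: d g => [|d IH] g.
  by exists (fun _ _ => 0), (fun _ _ => 0).
have [f0 [t [h1 h2 h3 h4]]] := dot_step (g 0%N).
pose g' c n := g c.+1 n + (- dot (g c.+1) (z t)) * f0 n.
have [f [l [l1 f1 e1]]] := IH g'.
pose v k := dot f0 (comb (l k)).
have vb k : `|v k| <= \sum_t `|l k t|.
  rewrite /v dot_comb; apply: (le_trans (ler_norm_sum _ _ _)).
  by apply: ler_sum => t' _; rewrite normrM ler_piMr.
(* The correction along [t] makes [g 0] vanish on the later combinations, so that only its own pivot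
   term remains. Since [f0] is at most 1 on the net, the sum of the coefficients at most doubles,
   whence [2 ^+ k]. *)
pose l' k t' := l k t' - (if t' == t then v k else 0).
have dl' h k : dot h (comb (l' k)) = dot h (comb (l k)) - v k * dot h (z t).
  rewrite !dot_comb /l'.
  under eq_bigr do rewrite mulrBl.
  rewrite sumrB; congr (_ - _); rewrite (bigD1 t) //= eqxx big1 ?addr0 //.
  by move=> t' /negbTE ->; rewrite mul0r.
exists (fun k => if k is k'.+1 then f k' else f0).
exists (fun k => if k is k'.+1 then l' k' else fun t' => (t' == t)%:R).
have combz h : dot h (comb (fun t' => (t' == t)%:R)) = dot h (z t).
  rewrite dot_comb (bigD1 t) //= eqxx mul1r big1 ?addr0 // => t' /negbTE ->.
  by rewrite mul0r.
split.
- case=> [_|k kd].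
    rewrite (bigD1 t) //= eqxx normr1 big1 ?addr0 // => t' /negbTE ->.
    by rewrite normr0.
  rewrite exprS mulr_natl mulr2n.
  apply: (@le_trans _ _ (\sum_t' `|l k t'| + `|v k|)).
    rewrite (bigD1 t) //= [X in _ <= X + _](bigD1 t) //= /l' eqxx addrAC.
    apply: lerD; first by rewrite (le_trans (ler_normB _ _)).
    by apply: ler_sum => t' /negbTE ->; rewrite subr0.
  by apply: lerD; [|apply: (le_trans (vb k))]; apply: l1.
- by case=> [x _|k x kd] Bx; [apply: h3|apply: f1].
case=> [x _ Bx|c x cd Bx].
  rewrite big_ord_recl /= combz -h1 // big1 ?addr0 // => k _.
  by rewrite dl' h2 -/(v k) subrr mulr0.
rewrite big_ord_recl /= combz.
have -> : dot (g c.+1) x = dot (g' c) x + dot f0 x * dot (g c.+1) (z t).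
  by rewrite dotDl; ring.
rewrite addrC e1 //; congr (_ + _); apply: eq_bigr => k _; congr (_ * _).
by rewrite dl' dotDl -/(v k); ring.
Qed.

End RankDecomposition.

(** * Blocks *)

Section SeqSums.
Variable R : realType.

Lemma sum_seq_le (T : eqType) (Q : seq T) (F : T -> R) c :
  (forall i, i \in Q -> F i <= c) -> \sum_(i <- Q) F i <= (size Q)%:R * c.
Proof.
elim: Q => [|q Q IH] h; first by rewrite big_nil mul0r.
rewrite big_cons /= -natr1 mulrDl mul1r addrC lerD ?h ?mem_head //.
by apply: IH => i iQ; apply: h; rewrite inE iQ orbT.
Qed.

Lemma sum_seq_ge (T : eqType) (Q : seq T) (F : T -> R) c :
  (forall i, i \in Q -> c <= F i) -> (size Q)%:R * c <= \sum_(i <- Q) F i.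
Proof.
move=> h; rewrite -lerN2 -sumrN -mulrN; apply: sum_seq_le => i iQ.
by rewrite lerN2 h.
Qed.

(** [Q] is cut into pieces of size [k], each with sum at most [c]; the summand [k%:R] on the right
    pays for the last, incomplete piece. *)
Lemma sum_seq_chop (p : pred nat) (h : nat -> R) (k : nat) c :
  (0 < k)%N -> 0 <= c ->
  (forall Q, uniq Q -> all p Q -> (size Q <= k)%N -> \sum_(i <- Q) h i <= c) ->
  forall Q, uniq Q -> all p Q ->
    k%:R * \sum_(i <- Q) h i <= c * ((size Q)%:R + k%:R).
Proof.
move=> k0 c0 hc Q; have [n] := ubnP (size Q).
elim: n Q => // n IH Q szQ uQ aQ.
have [le|lt] := leqP (size Q) k.
  rewrite mulrC (@le_trans _ _ (c * k%:R)) ?ler_wpM2r ?hc //.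
  by rewrite ler_wpM2l // lerDr.
rewrite -(cat_take_drop k Q) big_cat /= mulrDr size_cat natrD.
have st : size (take k Q) = k by rewrite size_takel // ltnW.
have := IH (drop k Q); rewrite size_drop st drop_uniq // => /(_ _ isT).
have -> : all p (drop k Q).
  by apply/allP => i /mem_drop; exact: (allP aQ).
have /[swap] /[apply] : (size Q - k < n)%N by lia.
move=> /(_ isT) IHd.
have : \sum_(i <- take k Q) h i <= c.
  apply: hc; rewrite ?take_uniq ?st //.
  by apply/allP => i /mem_take; exact: (allP aQ).
move=> /(ler_wpM2l (ler0n R k)) h1.
by move: IHd h1; lra.
Qed.

End SeqSums.

Section Blocks.
Variables (R : realType) (b L st : nat -> nat).
Hypothesis L_big : forall j, (2 ^ (100 * (b j).+1) * (st j).+1 <= L j)%N.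
Implicit Types (x : nat -> R).

(* Block [j] consists of the indices [i] with [st j <= i < st j.+1]. Besides the
   sup norm, its unit ball restricts the sum of [`|psi r e x i|] over sets of at
   most [kap j r s] indices. As [r] grows the weights [2 ^ s] become larger, up
   to [2 ^ ((r + 1) b j)], and only matter for much larger sets, so the four
   directions [r] are normed on very different scales. *)
Definition inb j i := (st j <= i < st j.+1)%N.
Definition kap j r s := (L j ^ (4 * b j * r + s))%N.
Definition rung j r s := [&& (r < 4)%N, (0 < s)%N & (s <= r.+1 * b j)%N].
Definition toprung j r := kap j r (r.+1 * b j).

Definition blk_le x j (M : R) :=
  (forall i c, inb j i -> (c < 4)%N -> `|x (4 * i + c)%N| <= M) /\
  (forall r e s Q, rung j r s -> uniq Q -> all (inb j) Q ->
     (size Q <= kap j r s)%N ->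
     2 ^+ s * \sum_(i <- Q) `|psi r e x i| <= M * (kap j r s)%:R).

Lemma L_gt0 j : (0 < L j)%N.
Proof. by apply: leq_trans (L_big j); rewrite muln_gt0 expn_gt0. Qed.

Lemma kap_gt0 j r s : (0 < kap j r s)%N.
Proof. by rewrite expn_gt0 L_gt0. Qed.

Lemma L_ge j n : (n <= 100 * (b j).+1)%N -> (2 ^ n <= L j)%N.
Proof.
move=> h; apply: leq_trans (L_big j); apply: leq_trans (leq_pmulr _ _) => //.
by rewrite leq_exp2l.
Qed.

Lemma eq_blk_le x y j M :
  (forall i c, inb j i -> (c < 4)%N -> x (4 * i + c)%N = y (4 * i + c)%N) ->
  blk_le x j M -> blk_le y j M.
Proof.
move=> e [h1 h2]; split=> [i c ij c4|r k s Q rs uQ aQ sQ]; first by rewrite -e // h1.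
rewrite (eq_big_seq (fun i => `|psi r k x i|)) ?h2 // => i iQ.
by congr `|_|; apply: eq_psi => c c4; rewrite e // (allP aQ).
Qed.

Lemma blk_leW x j M M' : M <= M' -> blk_le x j M -> blk_le x j M'.
Proof.
move=> MM' [h1 h2]; split=> [i c ij c4|r e s Q rs uQ aQ sQ].
  exact: le_trans (h1 _ _ ij c4) MM'.
by apply: le_trans (h2 _ _ _ _ rs uQ aQ sQ) _; rewrite ler_wpM2r.
Qed.

Lemma blk_leD x y j M M' : blk_le x j M -> blk_le y j M' ->
  blk_le (fun n => x n + y n) j (M + M').
Proof.
move=> [h1 h2] [g1 g2]; split=> [i c ij c4|r e s Q rs uQ aQ sQ].
  by rewrite (le_trans (ler_normD _ _)) // lerD ?h1 ?g1.
rewrite mulrDl (le_trans _ (lerD (h2 r e s Q rs uQ aQ sQ) (g2 r e s Q rs uQ aQ sQ))) //.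
rewrite -mulrDr -big_split /= ler_wpM2l // ?exprn_ge0 //.
by apply: ler_sum => i _; rewrite psiD ler_normD.
Qed.

Lemma blk_leZ a x j M : blk_le x j M -> blk_le (fun n => a * x n) j (`|a| * M).
Proof.
move=> [h1 h2]; split=> [i c ij c4|r e s Q rs uQ aQ sQ].
  by rewrite normrM ler_wpM2l // h1.
under eq_bigr do rewrite psiZ normrM.
rewrite -mulr_sumr mulrCA -[leRHS]mulrA ler_wpM2l //; exact: h2.
Qed.

Lemma blk_le_psi x j M r e i : inb j i -> blk_le x j M -> `|psi r e x i| <= 2 * M.
Proof. by move=> ij [h _]; apply: psi_bound => c c4; exact: h. Qed.

Lemma blk_le_top x j M r e Q : (r < 4)%N -> (0 < b j)%N -> uniq Q ->
  all (inb j) Q -> (size Q <= toprung j r)%N -> blk_le x j M ->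
  2 ^+ (r.+1 * b j) * \sum_(i <- Q) `|psi r e x i| <= M * (toprung j r)%:R.
Proof.
move=> r4 b0 uQ aQ sQ [_ h]; apply: h => //.
by rewrite /rung r4 leqnn muln_gt0 b0.
Qed.

Lemma kap_top j r r' s : (r < r')%N -> (0 < s)%N -> (r' < 4)%N ->
  (L j * toprung j r <= kap j r' s)%N.
Proof.
move=> rr' s0 r4; rewrite /toprung /kap -expnS.
case: (leqP (L j) 1) => [L1|L1].
  have -> : L j = 1%N by have := L_gt0 j; lia.
  by rewrite !exp1n.
by rewrite leq_exp2l //; nia.
Qed.

(** Levels below [r] carry weights of at most [2 ^ (r b)], level [r] sees only the values of
    [psi r], and the sets of the levels above are so much larger than the support that even the
    largest weight is absorbed. *)
Lemma blk_le_supp x j r t t' (P : seq nat) : (r < 4)%N -> 0 <= t -> 0 <= t' ->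
  (forall i c, inb j i -> (c < 4)%N -> `|x (4 * i + c)%N| <= t) ->
  (forall i e, inb j i -> `|psi r e x i| <= t') ->
  (forall i c, inb j i -> i \notin P -> (c < 4)%N -> x (4 * i + c)%N = 0) ->
  (2 ^ (4 * b j).+1 * size P <= L j * toprung j r)%N ->
  blk_le x j (2 ^+ (r * b j).+1 * t + 2 ^+ (r.+1 * b j) * t').
Proof.
move=> r4 t0 t'0 hx hp hP sP.
have p2 n : 1 <= 2 ^+ n :> R by rewrite exprn_ege1 // ler1n.
have p20 n : 0 <= 2 ^+ n :> R by rewrite exprn_ge0.
have tle : t <= 2 ^+ (r * b j).+1 * t + 2 ^+ (r.+1 * b j) * t'.
  rewrite (@le_trans _ _ (2 ^+ (r * b j).+1 * t)) ?ler_peMl //.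
  by rewrite lerDl mulr_ge0.
split=> [i c ij c4|r' e s Q rs uQ aQ sQ].
  exact: le_trans (hx _ _ ij c4) tle.
have [r'4 s0 sr'] := and3P rs.
have k0 : 0 <= (kap j r' s)%:R :> R by [].
have sQR : (size Q)%:R <= (kap j r' s)%:R :> R by rewrite ler_nat.
have [lt|gt|eq] := ltngtP r' r.
- apply: (@le_trans _ _ (2 ^+ (r * b j) * ((kap j r' s)%:R * (2 * t)))).
    apply: ler_pM => //; first by rewrite sumr_ge0.
      by rewrite ler_weXn2l ?ler1n //; nia.
    apply: (@le_trans _ _ ((size Q)%:R * (2 * t))).
      apply: sum_seq_le => i iQ; apply: psi_bound => c c4; apply: hx => //.
      exact: (allP aQ).
    by rewrite ler_wpM2r // mulr_ge0.
  rewrite mulrCA [leLHS]mulrC ler_wpM2r // mulrA -exprSr lerDl.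
  by rewrite mulr_ge0.
- pose Q' := [seq i <- Q | i \in P].
  have -> : \sum_(i <- Q) `|psi r' e x i| = \sum_(i <- Q') `|psi r' e x i|.
    rewrite big_filter [RHS]big_mkcond /=; apply: eq_big_seq => i iQ.
    case: ifPn => // iP; rewrite (@eq_psi _ x (fun=> 0)) => [|c c4].
      by case: r' {rs sr' sQ k0 sQR r'4 gt} => [|[|[|r']]]; case: e => [|e] /=;
        rewrite ?subr0 ?addr0 normr0.
    by apply: hP => //; exact: (allP aQ).
  have sQ' : (size Q' <= size P)%N.
    apply: uniq_leq_size; first by rewrite filter_uniq.
    by move=> i; rewrite mem_filter => /andP[].
  apply: (@le_trans _ _ (2 ^+ (4 * b j) * ((size P)%:R * (2 * t)))).
    apply: ler_pM => //; first by rewrite sumr_ge0.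
      by rewrite ler_weXn2l ?ler1n //; nia.
    apply: (@le_trans _ _ ((size Q')%:R * (2 * t))).
      apply: sum_seq_le => i; rewrite mem_filter => /andP[_ iQ].
      apply: psi_bound => c c4; apply: hx => //; exact: (allP aQ).
    by rewrite ler_wpM2r ?ler_nat // mulr_ge0.
  apply: (@le_trans _ _ (t * (kap j r' s)%:R)); last by rewrite ler_wpM2r.
  have : (2 ^ (4 * b j).+1 * size P <= kap j r' s)%N.
    by apply: leq_trans sP _; apply: kap_top.
  rewrite -(ler_nat R) natrM natrX exprSr => h.
  rewrite [leRHS]mulrC.
  have -> : 2 ^+ (4 * b j) * ((size P)%:R * (2 * t)) =
    2 ^+ (4 * b j) * 2 * (size P)%:R * t :> R by ring.
  by rewrite ler_wpM2r.
- apply: (@le_trans _ _ (2 ^+ (r.+1 * b j) * ((kap j r' s)%:R * t'))).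
    apply: ler_pM => //; first by rewrite sumr_ge0.
      by rewrite ler_weXn2l ?ler1n -?eq.
    apply: (@le_trans _ _ ((size Q)%:R * t')).
      apply: sum_seq_le => i iQ; rewrite eq; apply: hp.
      exact: (allP aQ).
    by rewrite ler_wpM2r.
  rewrite mulrCA [leLHS]mulrC ler_wpM2r // lerDr.
  by rewrite mulr_ge0.
Qed.

(** The support is so small that already the smallest [kap] outweighs it by more than the largest
    weight, so only the sup norm counts. *)
Lemma blk_le_small x j t (P : seq nat) : 0 <= t ->
  (forall i c, inb j i -> (c < 4)%N -> `|x (4 * i + c)%N| <= t) ->
  (forall i c, inb j i -> i \notin P -> (c < 4)%N -> x (4 * i + c)%N = 0) ->
  (2 ^ (4 * b j).+1 * size P <= L j)%N ->
  blk_le x j t.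
Proof.
move=> t0 hx hP sP; split=> // r e s Q rs uQ aQ sQ.
have [r4 s0 sr] := and3P rs.
pose Q' := [seq i <- Q | i \in P].
have -> : \sum_(i <- Q) `|psi r e x i| = \sum_(i <- Q') `|psi r e x i|.
  rewrite big_filter [RHS]big_mkcond /=; apply: eq_big_seq => i iQ.
  case: ifPn => // iP; rewrite (@eq_psi _ x (fun=> 0)) => [|c c4].
    by case: r {rs sr sQ r4} => [|[|[|r]]]; case: e => [|e] /=;
      rewrite ?subr0 ?addr0 normr0.
  by apply: hP => //; exact: (allP aQ).
have sQ' : (size Q' <= size P)%N.
  apply: uniq_leq_size; first by rewrite filter_uniq.
  by move=> i; rewrite mem_filter => /andP[].
apply: (@le_trans _ _ (2 ^+ (4 * b j) * ((size P)%:R * (2 * t)))).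
  apply: ler_pM.
  - by rewrite exprn_ge0.
  - by rewrite sumr_ge0.
  - by rewrite ler_weXn2l ?ler1n //; nia.
  apply: (@le_trans _ _ ((size Q')%:R * (2 * t))).
    apply: sum_seq_le => i; rewrite mem_filter => /andP[_ iQ].
    apply: psi_bound => c c4; apply: hx => //; exact: (allP aQ).
  by rewrite ler_wpM2r ?ler_nat // mulr_ge0.
have : (2 ^ (4 * b j).+1 * size P <= kap j r s)%N.
  apply: (leq_trans sP); rewrite /kap; case: s s0 {rs sr sQ} => // s _.
  by rewrite addnS expnS leq_pmulr // expn_gt0 L_gt0.
rewrite -(ler_nat R) natrM natrX exprSr => h.
rewrite [leRHS]mulrC.
have -> : 2 ^+ (4 * b j) * ((size P)%:R * (2 * t)) =
  2 ^+ (4 * b j) * 2 * (size P)%:R * t :> R by ring.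
by rewrite ler_wpM2r.
Qed.

Lemma blk_le_sup x j t : 0 <= t ->
  (forall i c, inb j i -> (c < 4)%N -> `|x (4 * i + c)%N| <= t) ->
  blk_le x j (2 ^+ (4 * b j).+1 * t).
Proof.
move=> t0 hx.
have p2 n : 1 <= 2 ^+ n :> R by rewrite exprn_ege1 // ler1n.
split=> [i c ij c4|r e s Q rs uQ aQ sQ].
  by apply: (le_trans (hx _ _ ij c4)); rewrite ler_peMl.
have [r4 s0 sr] := and3P rs.
apply: (@le_trans _ _ (2 ^+ (4 * b j) * ((kap j r s)%:R * (2 * t)))).
  apply: ler_pM.
  - by rewrite exprn_ge0.
  - by rewrite sumr_ge0.
  - by rewrite ler_weXn2l ?ler1n //; nia.
  apply: (@le_trans _ _ ((size Q)%:R * (2 * t))).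
    apply: sum_seq_le => i iQ; apply: psi_bound => c c4; apply: hx => //.
    exact: (allP aQ).
  by rewrite ler_wpM2r ?ler_nat // mulr_ge0.
rewrite exprSr le_eqVlt; apply/orP; left; apply/eqP; ring.
Qed.

Lemma psi_comb (T : finType) (u : nat -> R) (l : T -> R) (z : T -> nat -> R) r e i :
  (forall c, (c < 4)%N -> u (4 * i + c)%N = \sum_t l t * z t (4 * i + c)%N) ->
  psi r e u i = \sum_t l t * psi r e (z t) i.
Proof.
move=> h; rewrite -psi_sum; apply: eq_psi => c c4; exact: h.
Qed.

(* The rungs grow by factors larger than [#|T|] while the weights only double:
   up to a constant the block norm cannot distinguish a vector from the
   pointwise maximum of [#|T|] vectors. *)
Lemma blk_le_tsup j (T : finType) (t0 : T) (z : T -> nat -> R) (u : nat -> R)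
    (l : nat -> T -> R) M La :
  (#|T| <= L j)%N -> 0 <= M -> 0 <= La ->
  (forall t, blk_le (z t) j M) ->
  (forall i c, inb j i -> (c < 4)%N ->
     u (4 * i + c)%N = \sum_t l i t * z t (4 * i + c)%N) ->
  (forall i, inb j i -> \sum_t `|l i t| <= La) ->
  blk_le u j (6 * La * M).
Proof.
move=> TL M0 La0 hz hu hl.
have LaM : 0 <= La * M by rewrite mulr_ge0.
split=> [i c ij c4|r e s Q rs uQ aQ sQ].
  rewrite hu //; apply: (@le_trans _ _ (\sum_t `|l i t| * M)).
    apply: (le_trans (ler_norm_sum _ _ _)); apply: ler_sum => t _.
    by rewrite normrM ler_wpM2l //; have [h _] := hz t; exact: h.
  rewrite -mulr_suml (@le_trans _ _ (La * M)) ?ler_wpM2r ?hl //.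
  by lra.
have /choice[tm htm] : forall i, exists t, forall t',
    `|psi r e (z t') i| <= `|psi r e (z t) i|.
  by move=> i; apply: (exists_argmax t0 (fun t => `|psi r e (z t) i|)).
have [r4 s0 sr] := and3P rs.
set k := (kap j r s)%:R.
pose k' : R := (kap j r s.-1)%:R.
have kk' : (#|T|)%:R * k' <= k.
  rewrite -natrM ler_nat /kap; case: s s0 {rs sQ sr k k'} => // s _.
  by rewrite addnS expnS leq_mul2r TL orbT.
(* A single [z t] is estimated on pieces of the size of the previous rung, which costs a factor 2 in
   the weight; on the first rung the sup norm takes its place. Each of the [#|T|] index sets leaves
   one incomplete piece, and by [kk'] these fit together under the current rung. *)
have claim t Q' : uniq Q' -> all (inb j) Q' ->
    2 ^+ s * \sum_(i <- Q') `|psi r e (z t) i| <= 2 * M * (2 * (size Q')%:R + k').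
  move=> uQ' aQ'.
  have [s1|s1] := leqP s 1.
    have -> : s = 1%N by lia.
    apply: (@le_trans _ _ (2 * ((size Q')%:R * (2 * M)))).
      rewrite expr1 ler_wpM2l //; apply: sum_seq_le => i iQ.
      by apply: blk_le_psi (hz t); exact: (allP aQ').
    have : 0 <= M * k' by rewrite mulr_ge0 // /k'.
    by lra.
  have rs' : rung j r s.-1 by rewrite /rung r4 /=; lia.
  have k'0 : 0 < k' by rewrite ltr0n kap_gt0.
  have c0 : 0 <= M * k' / 2 ^+ s.-1.
    by rewrite divr_ge0 ?exprn_ge0 // mulr_ge0 // ltW.
  have hc Q1 : uniq Q1 -> all (inb j) Q1 -> (size Q1 <= kap j r s.-1)%N ->
      \sum_(i <- Q1) `|psi r e (z t) i| <= M * k' / 2 ^+ s.-1.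
    move=> uQ1 aQ1 sQ1; rewrite ler_pdivlMr ?exprn_gt0 // mulrC.
    by have [_ h] := hz t; apply: h.
  have := sum_seq_chop (kap_gt0 j r s.-1) c0 hc uQ' aQ'.
  rewrite -/k' => h.
  have -> : 2 ^+ s = 2 * 2 ^+ s.-1 :> R by rewrite -exprS prednK.
  have p : 0 < 2 ^+ s.-1 :> R by rewrite exprn_gt0.
  have : 2 ^+ s.-1 * \sum_(i <- Q') `|psi r e (z t) i| <= M * ((size Q')%:R + k').
    rewrite -(ler_pM2l k'0) mulrCA.
    apply: (le_trans (ler_wpM2l (ltW p) h)).
    rewrite le_eqVlt; apply/orP; left; apply/eqP; field.
    by rewrite lt0r_neq0.
  have : 0 <= M * (size Q')%:R by rewrite mulr_ge0.
  by lra.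
apply: (@le_trans _ _ (2 ^+ s * \sum_(i <- Q) (La * `|psi r e (z (tm i)) i|))).
  rewrite ler_wpM2l ?exprn_ge0 // big_seq [leRHS]big_seq.
  apply: ler_sum => i iQ; have ij : inb j i by exact: (allP aQ).
  rewrite (psi_comb r e (fun c => hu i c ij)).
  apply: (le_trans (ler_norm_sum _ _ _)).
  apply: (@le_trans _ _ (\sum_t `|l i t| * `|psi r e (z (tm i)) i|)).
    by apply: ler_sum => t _; rewrite normrM ler_wpM2l.
  by rewrite -mulr_suml ler_wpM2r // hl.
rewrite -mulr_sumr mulrCA.
have -> : \sum_(i <- Q) `|psi r e (z (tm i)) i| =
    \sum_t \sum_(i <- [seq i <- Q | tm i == t]) `|psi r e (z t) i|.
  under [RHS]eq_bigr do rewrite big_filter.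
  rewrite [RHS](exchange_big_dep xpredT) //=; apply: eq_bigr => i _.
  by rewrite (big_pred1 (tm i)) // => t; rewrite eq_sym.
rewrite mulr_sumr.
apply: (@le_trans _ _ (La * (\sum_t 2 * M *
    (2 * (size [seq i <- Q | tm i == t])%:R + k')))).
  rewrite ler_wpM2l //; apply: ler_sum => t _; apply: claim.
    by rewrite filter_uniq.
  by apply/allP => i; rewrite mem_filter => /andP[_]; exact: (allP aQ).
rewrite -mulr_sumr big_split /= -mulr_sumr sumr_const -[k' *+ _]mulr_natl -natr_sum.
have -> : (\sum_t size [seq i <- Q | tm i == t] = size Q)%N.
  under eq_bigr do rewrite size_filter -sum1_count.
  rewrite (exchange_big_dep xpredT) //= -sum1_size; apply: eq_bigr => i _.
  by rewrite (big_pred1 (tm i)) // => t; rewrite eq_sym.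
have -> : 6 * La * M * k = La * (2 * M * (2 * k + k)) by ring.
rewrite ler_wpM2l // ler_wpM2l ?mulr_ge0 // lerD // ler_wpM2l //.
by rewrite ler_nat.
Qed.

End Blocks.

(** * Summing norms over hitting sets *)

Section SeqSumConst.
Variable R : realType.

Lemma sumr_const_seq (T : Type) (r : seq T) (c : R) :
  \sum_(i <- r) c = (size r)%:R * c.
Proof.
by elim: r => [|x r IH]; rewrite ?big_nil ?mul0r // big_cons IH -natr1 mulrDl mul1r addrC.
Qed.

End SeqSumConst.

Section Maximum.
Variables (R : realType) (T : eqType).

Lemma seq_argmax (U : seq T) (F : T -> R) i : i \in U ->
  exists2 k, k \in U & forall l, l \in U -> F l <= F k.
Proof.
elim: U i => // u [|v U] IH i iU.
  by exists u; rewrite ?mem_head // => l; rewrite inE => /eqP ->.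
have [k kU hk] := IH v (mem_head _ _).
case: (leP (F k) (F u)) => h.
  exists u; rewrite ?mem_head // => l; rewrite inE => /orP[/eqP -> //|lU].
  by apply: le_trans h; apply: hk.
exists k; first by rewrite inE kU orbT.
move=> l; rewrite inE => /orP[/eqP ->|lU]; [exact: ltW|exact: hk].
Qed.

Lemma exists_ge_average (U : seq T) (F : T -> R) a : 0 < a ->
  a <= \sum_(i <- U) F i -> exists2 i, i \in U & a <= (size U)%:R * F i.
Proof.
case: U => [|u U] a0 aF; first by move: a0; rewrite big_nil in aF; rewrite ltNge aF.
have [k kU hk] := seq_argmax F (mem_head u U).
exists k => //; apply: (le_trans aF); exact: sum_seq_le.
Qed.

End Maximum.

Section Hitting.
Variables (R : realType) (G : eqType) (Gs : seq G) (D : G -> seq nat) (U : seq nat).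
Variables (S m : G -> R) (a : R).
Hypothesis a0 : 0 <= a.
Hypothesis S0 : forall g, 0 <= S g.
Hypothesis m0 : forall g, 0 <= m g.
Hypothesis uD : forall g, g \in Gs -> uniq (D g) /\ {subset D g <= U}.
Hypothesis aS : forall g, g \in Gs -> a * S g <= (size (D g))%:R * m g.

Definition hit (Q : seq nat) g := has (mem Q) (D g).

Let total := \sum_(g <- Gs) S g.

Lemma greedy_hitting (k : nat) :
  exists Q : seq nat, [/\ uniq Q, {subset Q <= U}, (size Q <= k)%N &
    total <= 2 * \sum_(g <- Gs | hit Q g) S g \/
    k%:R * (a * (total / 2)) <= (size U)%:R * \sum_(g <- Gs | hit Q g) m g].
Proof.
elim: k => [|k [Q [uQ QU sQ hQ]]].
  exists [::]; split=> //; right; rewrite mul0r mulr_ge0 // sumr_ge0 //.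
case: hQ => [h|h].
  by exists Q; split=> //; [exact: leqW|left].
have splitS : total = \sum_(g <- Gs | hit Q g) S g + \sum_(g <- Gs | ~~ hit Q g) S g.
  by rewrite /total (bigID (hit Q)).
case: (lerP total (2 * \sum_(g <- Gs | hit Q g) S g)) => ht.
  by exists Q; split=> //; [exact: leqW|left].
pose un := \sum_(g <- Gs | ~~ hit Q g) S g.
have un2 : total / 2 <= un by rewrite /un; lra.
pose F i := \sum_(g <- Gs | ~~ hit Q g && (i \in D g)) m g.
have F0 i : 0 <= F i by rewrite sumr_ge0.
have : a * (total / 2) <= \sum_(i <- U) F i.
  apply: (@le_trans _ _ (a * un)); first by rewrite ler_wpM2l.
  rewrite /un mulr_sumr /F.
  rewrite (exchange_big_dep (fun g => ~~ hit Q g)) /=; last by move=> i g _ /andP[].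
  rewrite big_seq_cond [leRHS]big_seq_cond; apply: ler_sum => g /andP[gG gQ].
  apply: (le_trans (aS gG)); rewrite gQ /=.
  have [ug sg] := uD gG.
  rewrite -big_filter sumr_const_seq ler_wpM2r // ler_nat.
  apply: uniq_leq_size => // i iD; rewrite mem_filter iD.
  exact: sg.
move=> hF; have c0 : 0 <= a * (total / 2).
  by rewrite mulr_ge0 // divr_ge0 // sumr_ge0.
have [c1|c1] := leP (a * (total / 2)) 0.
  have -> : a * (total / 2) = 0 by apply/eqP; rewrite eq_le c0 c1.
  by exists Q; split=> //; [exact: leqW|right; rewrite mulr0 mulr_ge0 // sumr_ge0].
have [i iU hi] := exists_ge_average c1 hF.
have iQ : i \notin Q.
  apply/negP => iQ; move: (lt_le_trans c1 hi).
  rewrite /F big1 ?mulr0 ?ltxx // => g /andP[/hasPn h1 h2].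
  by have := h1 _ h2; rewrite /= iQ.
exists (i :: Q); split=> /=.
- by rewrite iQ.
- by move=> l; rewrite inE => /orP[/eqP ->|/QU].
- by [].
right.
have -> : \sum_(g <- Gs | hit (i :: Q) g) m g = \sum_(g <- Gs | hit Q g) m g + F i.
  have hitE g : hit (i :: Q) g = hit Q g || (i \in D g).
    rewrite /hit; apply/hasP/orP => [[l lD]|[/hasP[l lD lQ]|iD]].
    - rewrite /= inE => /orP[/eqP <-|lQ]; first by right.
      by left; apply/hasP; exists l.
    - by exists l => //=; rewrite inE; move: lQ => /= ->; rewrite orbT.
    - by exists i => //=; rewrite inE eqxx.
  rewrite (bigID (hit Q)) /=; congr (_ + _); apply: eq_bigl => g; rewrite hitE.
    by case: (hit Q g); rewrite ?andbF.
  by case: (hit Q g); rewrite ?andbF //= andbT.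
by rewrite mulrDr -natr1 mulrDl mul1r lerD.
Qed.

End Hitting.

Section Summing.
Variables (R : realType) (b L st : nat -> nat).
Hypothesis L_big : forall j, (2 ^ (100 * (b j).+1) * (st j).+1 <= L j)%N.
Implicit Types (x w : nat -> R).

Local Notation blk_le := (blk_le b L st).
Local Notation inb := (inb st).
Local Notation kap := (kap b L).
Local Notation rung := (rung b).
Local Notation top := (toprung b L).

Lemma blk_le_closed x j M : (forall e, 0 < e -> blk_le x j (M + e)) -> blk_le x j M.
Proof.
move=> h; split=> [i c ij c4|r e s Q rs uQ aQ sQ].
  by apply/ler_addgt0Pr => e /h[h1 _]; exact: h1.
have k0 : 0 < (kap j r s)%:R :> R by rewrite ltr0n (kap_gt0 L_big).
apply/ler_addgt0Pr => d d0.
have [_ h2] := h (d / (kap j r s)%:R) (divr_gt0 d0 k0).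
apply: (le_trans (h2 _ _ _ _ rs uQ aQ sQ)).
by rewrite mulrDl divfK // gt_eqF.
Qed.

Lemma psi_bool r e x i : psi r e x i = psi r (e != 0%N) x i.
Proof. by case: r => [|[|[|r]]]; case: e. Qed.

(** Either a coordinate exceeds [S / 2], or some [Q] nearly saturates a rung. In the latter case [D]
    collects the indices where the functional is at least [S / (4 * 2 ^ s)]: the others cannot
    saturate the rung, and [kap] is so large compared with [2 ^ s] that [D] has at least [2 ^ s / 8]
    elements. *)
Lemma psi_witness w j S : 0 < S -> blk_le w j S -> ~ blk_le w j (S / 2) ->
  exists (r : 'I_4) (e : bool) (D : seq nat) (m : R),
  [/\ uniq D /\ all (inb j) D, 0 <= m, forall i, i \in D -> m <= `|psi r e w i|,
      S <= 4 * 2 ^+ (r.+1 * b j) * m &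
      S <= 32 * 2 ^+ (r * b j) * ((size D)%:R * m)].
Proof.
move=> S0 hS /not_andP[|]; move=> nh.
  have {}nh : exists i c, [/\ inb j i, (c < 4)%N & S / 2 < `|w (4 * i + c)%N|].
    apply: contrapT => h; apply: nh => i c ij c4; rewrite leNgt; apply/negP => h'.
    by apply: h; exists i, c.
  have [i [c [ij c4 h]]] := nh.
  have c2 : (c./2 < 4)%N by lia.
  exists (Ordinal c2), (odd c), [:: i], (S / 2); split => //.
  - by rewrite /= ij.
  - by rewrite divr_ge0 // ltW.
  - by move=> k; rewrite inE => /eqP -> /=; rewrite -psi_coord // ltW.
  - have : 1 <= 2 ^+ (c./2.+1 * b j) :> R by rewrite exprn_ege1 // ler1n.
    move=> /(ler_wpM2r (ltW S0)); rewrite /=; lra.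
  - have : 1 <= 2 ^+ (c./2 * b j) :> R by rewrite exprn_ege1 // ler1n.
    move=> /(ler_wpM2r (ltW S0)); rewrite /=; lra.
have {}nh : exists r e s Q, [/\ rung j r s, uniq Q, all (inb j) Q,
    (size Q <= kap j r s)%N &
    S / 2 * (kap j r s)%:R < 2 ^+ s * \sum_(i <- Q) `|psi r e w i|].
  apply: contrapT => h; apply: nh => r e s Q h1 h2 h3 h4; rewrite leNgt.
  by apply/negP => h'; apply: h; exists r, e, s, Q.
have [r [e [s [Q [rs uQ aQ sQ h]]]]] := nh.
have [r4 s0 sr] := and3P rs.
pose m := S / (4 * 2 ^+ s).
have p0 : 0 < 2 ^+ s :> R by rewrite exprn_gt0.
have k0 : 0 < (kap j r s)%:R :> R by rewrite ltr0n (kap_gt0 L_big).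
have m0 : 0 < m by rewrite divr_gt0 // mulr_gt0.
have mE : 4 * 2 ^+ s * m = S by rewrite /m mulrC divfK // gt_eqF // mulr_gt0.
pose D := [seq i <- Q | m <= `|psi r e w i|].
exists (Ordinal r4), (e != 0%N), D, m; split=> //.
- rewrite filter_uniq //; split=> //; apply/allP => i.
  by rewrite mem_filter => /andP[_]; apply: (allP aQ).
- exact: ltW.
- by move=> i; rewrite mem_filter -psi_bool => /andP[].
- by rewrite -mE /= ler_wpM2r ?(ltW m0) // ler_pM2l // ler_weXn2l // ler1n.
have : \sum_(i <- Q) `|psi r e w i| <= (size D)%:R * (2 * S) + (kap j r s)%:R * m.
  rewrite (bigID (fun i => m <= `|psi r e w i|)) /= lerD //.
    rewrite -big_filter; apply: sum_seq_le => i; rewrite mem_filter => /andP[_ iQ].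
    by apply: blk_le_psi hS; exact: (allP aQ).
  rewrite -big_filter (@le_trans _ _ ((size [seq i <- Q | ~~ (m <= `|psi r e w i|)])%:R * m)) //.
    by apply: sum_seq_le => i; rewrite mem_filter -ltNge => /andP[/ltW].
  rewrite ler_wpM2r ?(ltW m0) // ler_nat size_filter.
  by apply: leq_trans (count_size _ _) _.
move=> /(ler_wpM2l (ltW p0)) h1.
have {h1} h2 := lt_le_trans h h1.
have h3 : (kap j r s)%:R * S <= 8 * (2 ^+ s * (size D)%:R * S).
  suff : S / 2 * (kap j r s)%:R < 2 ^+ s * (size D)%:R * (2 * S) + (kap j r s)%:R * S / 4.
    by lra.
  have e4 : S / 4 = 2 ^+ s * m by rewrite -mE; field.
  apply: (lt_le_trans h2); rewrite -[_ * S / 4]mulrA e4 le_eqVlt.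
  by apply/orP; left; apply/eqP; ring.
have h4 : (kap j r s)%:R <= 8 * (2 ^+ s * (size D)%:R) :> R.
  by rewrite -(ler_pM2r S0); apply: (le_trans h3); lra.
have h5 : 2 ^+ s * 2 ^+ s <= (kap j r s)%:R :> R.
  rewrite -exprD -natrX ler_nat.
  apply: (@leq_trans (L j)).
    by apply: (L_ge L_big); nia.
  rewrite /kap; case: s s0 {rs sr sQ h m p0 k0 m0 mE D h2 h3 h4} => // s _.
  by rewrite addnS expnS leq_pmulr // expn_gt0 (L_gt0 L_big).
have h6 : 2 ^+ s <= 8 * (size D)%:R :> R.
  by rewrite -(ler_pM2l p0); apply: (le_trans h5); apply: (le_trans h4); lra.
have h7 : 1 <= 2 ^+ (r * b j) :> R by rewrite exprn_ege1 // ler1n.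
rewrite -[leLHS]mE; apply: (@le_trans _ _ (32 * ((size D)%:R * m))).
  by have := ler_wpM2r (ltW m0) h6; lra.
have : 0 <= (size D)%:R * m by rewrite mulr_ge0 // ltW.
by move=> /(ler_wpM2r)/(_ _ _ h7) /=; lra.
Qed.

Section Class.
Variables (G : eqType) (Gs : seq G) (w : G -> nat -> R) (W : R) (j : nat).
Hypothesis b0 : (0 < b j)%N.
Hypothesis hW : forall th : G -> R, (forall g, `|th g| <= 1) ->
  blk_le (fun n => \sum_(g <- Gs) th g * w g n) j W.

(** Each [g] that is hit is assigned to one index [ig g] of [Q] in [D g], with the sign of its
    functional there. Vectors assigned to the same index do not cancel at that index, [sign_diag]
    handles the other indices, and the one vector obtained is tested on the top rung of level
    [r]. *)
Lemma hit_sum (D : G -> seq nat) (m : G -> R) (r e : nat) (Q : seq nat) (P : pred G) :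
  (r < 4)%N -> uniq Q -> all (inb j) Q -> (size Q <= top j r)%N ->
  (forall g i, P g -> i \in D g -> m g <= `|psi r e (w g) i|) ->
  2 ^+ (r.+1 * b j) * \sum_(g <- Gs | P g && hit D Q g) m g <= W * (top j r)%:R.
Proof.
move=> r4 uQ aQ sQ hm.
pose ig g := head 0%N [seq i <- D g | i \in Q].
have igP g : hit D Q g -> ig g \in Q /\ ig g \in D g.
  move=> /hasP[i iD iQ]; rewrite /ig.
  have : i \in [seq i <- D g | i \in Q] by rewrite mem_filter iD andbT.
  case E : [seq i <- D g | i \in Q] => [//|k s] _ /=.
  have : k \in [seq i <- D g | i \in Q] by rewrite E mem_head.
  by rewrite mem_filter => /andP[].
pose sg g := Num.sg (psi r e (w g) (ig g)).
pose M i k := \sum_(g <- Gs | (P g && hit D Q g) && (ig g == k)) sg g * psi r e (w g) i.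
have [h [h1 h2]] := sign_diag M uQ.
pose th g := if P g && hit D Q g then h (ig g) * sg g else 0.
have th1 g : `|th g| <= 1.
  rewrite /th; case: ifP => _; last by rewrite normr0.
  rewrite normrM (sign_norm (h1 _)) mul1r /sg normr_sg; by case: eqP.
have := blk_le_top e r4 b0 uQ aQ sQ (hW th1).
apply: le_trans; rewrite ler_wpM2l ?exprn_ge0 //.
have partQ (F : G -> R) : \sum_(g <- Gs | P g && hit D Q g) F g =
    \sum_(k <- Q) \sum_(g <- Gs | (P g && hit D Q g) && (ig g == k)) F g.
  rewrite (exchange_big_dep (fun g => P g && hit D Q g)) /=; last by move=> k g _ /andP[].
  apply: eq_bigr => g /andP[Pg hg].
  rewrite (eq_bigl (fun k => k == ig g)) => [|k]; last by rewrite Pg hg eq_sym.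
  rewrite -big_filter filter_pred1_uniq ?big_seq1 //.
  by have [] := igP _ hg.
have -> : \sum_(i <- Q) `|psi r e (fun n => \sum_(g <- Gs) th g * w g n) i| =
   \sum_(i <- Q) `|\sum_(k <- Q) h k * M i k|.
  apply: eq_bigr => i _; congr `|_|.
  rewrite psi_sum (bigID (fun g => P g && hit D Q g)) /= [X in _ + X]big1 ?addr0.
    rewrite partQ; apply: eq_bigr => k _; rewrite /M mulr_sumr.
    by apply: eq_bigr => g /andP[hg /eqP <-]; rewrite /th hg mulrA.
  by move=> g /negbTE hg; rewrite /th hg mul0r.
apply: le_trans h2; rewrite partQ big_seq [leRHS]big_seq; apply: ler_sum => i iQ.
apply: le_trans (ler_norm _); apply: ler_sum => g /andP[/andP[Pg hg] /eqP <-].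
rewrite /sg -normrEsg; apply: hm => //.
by have [] := igP _ hg.
Qed.

Variable S : G -> R.
Hypothesis W0 : 0 <= W.
Hypothesis S0 : forall g, 0 <= S g.
Hypothesis hS : forall g, blk_le (w g) j (S g).
Hypothesis hS2 : forall g, 0 < S g -> ~ blk_le (w g) j (S g / 2).

(* In each class of witnesses, a greedily chosen set of indices that meets the
   supports of half of the mass yields one vector of the hypothesis [hW] whose
   norm dominates the sum. *)
Lemma one_summing : \sum_(g <- Gs) S g <=
  64 * W * (8 * (st j.+1 - st j)%:R / 2 ^+ b j + (top j 3)%:R).
Proof.
have /choice[v hv] : forall g, exists v : 'I_4 * bool * seq nat * R, 0 < S g ->
  let: (r, e, D, m) := v in
  [/\ uniq D /\ all (inb j) D, 0 <= m, forall i, i \in D -> m <= `|psi r e (w g) i|,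
      S g <= 4 * 2 ^+ (r.+1 * b j) * m &
      S g <= 32 * 2 ^+ (r * b j) * ((size D)%:R * m)].
  move=> g; case: (ltP 0 (S g)) => [h|_]; last by exists (ord0, true, [::], 0).
  have [r [e [D [m hh]]]] := psi_witness h (hS g) (hS2 h).
  by exists (r, e, D, m).
pose cl g := (v g).1.1; pose D g := (v g).1.2; pose m g := (v g).2.
have {}hv g : 0 < S g -> [/\ uniq (D g) /\ all (inb j) (D g), 0 <= m g,
      forall i, i \in D g -> m g <= `|psi (cl g).1 (cl g).2 (w g) i|,
      S g <= 4 * 2 ^+ ((cl g).1.+1 * b j) * m g &
      S g <= 32 * 2 ^+ ((cl g).1 * b j) * ((size (D g))%:R * m g)].
  by move=> /hv; rewrite /cl /D /m; case: (v g) => [[[r e] D'] m'].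
rewrite (bigID (fun g => 0 < S g)) /= [X in _ + X]big1 ?addr0; last first.
  by move=> g; rewrite -leNgt => h; apply/eqP; rewrite eq_le h S0.
rewrite (partition_big cl xpredT) //=.
have top3 (r : 'I_4) : (top j r <= top j 3)%N.
  rewrite /top /kap; apply: leq_pexp2l; first exact: (L_gt0 L_big).
  by have := ltn_ord r; nia.
have P0 n : 0 < 2 ^+ n :> R by rewrite exprn_gt0.
pose N : R := (st j.+1 - st j)%:R.
(* The bound for one of the eight classes, given by four values of [r] and two of [e]; its two terms
   come from the two outcomes of [greedy_hitting]. *)
pose B := 8 * W * (top j 3)%:R + 64 * N * W / 2 ^+ b j.
apply: (@le_trans _ _ (\sum_(c : 'I_4 * bool) B)); last first.
  rewrite sumr_const card_prod card_ord card_bool -mulr_natl /B.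
  by rewrite le_eqVlt; apply/orP; left; apply/eqP; rewrite -/N; ring.
apply: ler_sum => c _.
pose P g := (0 < S g) && (cl g == c).
pose Gc := [seq g <- Gs | P g].
rewrite -big_filter -/Gc.
pose U := index_iota (st j) (st j.+1).
have sU : size U = (st j.+1 - st j)%N by rewrite size_iota.
pose a : R := (32 * 2 ^+ (c.1 * b j))^-1.
have a0 : 0 <= a by rewrite invr_ge0 mulr_ge0 // ltW.
pose m' g := if P g then m g else 0.
have m0 g : 0 <= m' g.
  by rewrite /m'; case: ifP => // /andP[/hv[]].
have hD g : g \in Gc -> uniq (D g) /\ {subset D g <= U}.
  rewrite mem_filter => /andP[/andP[/hv[[uD aD] _ _ _ _] _] _]; split=> //.
  by move=> i /(allP aD); rewrite mem_index_iota.
have aS g : g \in Gc -> a * S g <= (size (D g))%:R * m' g.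
  rewrite mem_filter => /andP[Pg _]; rewrite /m' Pg.
  have /andP[/hv[_ _ _ _ h] /eqP e] := Pg.
  by rewrite /a ler_pdivrMl ?mulr_gt0 // -e.
have [Q [uQ QU sQ hQ]] := greedy_hitting a0 S0 m0 hD aS (top j c.1).
have aQ : all (inb j) Q.
  by apply/allP => i /QU; rewrite mem_index_iota.
have hs := @hit_sum D m' c.1 c.2 Q P (ltn_ord _) uQ aQ sQ.
have {}hs : 2 ^+ (c.1.+1 * b j) * \sum_(g <- Gc | hit D Q g) m' g <= W * (top j c.1)%:R.
  rewrite big_filter_cond; apply: hs => g i Pg iD; rewrite /m' Pg.
  have /andP[/hv[_ _ h _ _] /eqP e] := Pg.
  by rewrite -e; apply: h.
have tR : (top j c.1)%:R <= (top j 3)%:R :> R by rewrite ler_nat top3.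
have WT : W * (top j c.1)%:R <= W * (top j 3)%:R by rewrite ler_wpM2l.
have N0 : 0 <= N * W / 2 ^+ b j by rewrite divr_ge0 ?(ltW (P0 _)) // mulr_ge0 // /N.
have T0 : 0 < (top j c.1)%:R :> R by rewrite ltr0n (kap_gt0 L_big).
set A := \sum_(g <- Gc | hit D Q g) m' g in hs hQ.
set tot := \sum_(g <- Gc) S g in hQ *.
case: hQ => hQ.
  have : \sum_(g <- Gc | hit D Q g) S g <= 4 * (2 ^+ (c.1.+1 * b j) * A).
    rewrite mulrA /A mulr_sumr big_seq_cond [leRHS]big_seq_cond.
    apply: ler_sum => g /andP[]; rewrite mem_filter => /andP[Pg _] _.
    by rewrite /m' Pg; have /andP[/hv[_ _ _ h _] /eqP e] := Pg; rewrite -e.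
  by rewrite /B; lra.
(* Here the factor [2 ^ b] is gained: the witnesses lose at most [2 ^ (r b)], while the top rung of
   level [r] has weight [2 ^ ((r + 1) b)]. *)
have {}hQ : (top j c.1)%:R * (tot / 64) <= (top j c.1)%:R * (N * W / 2 ^+ b j).
  rewrite sU -/N in hQ.
  have := ler_wpM2l (ltW (P0 (c.1.+1 * b j)%N)) hQ.
  have -> : 2 ^+ (c.1.+1 * b j) * ((top j c.1)%:R * (a * (tot / 2))) =
     2 ^+ b j * ((top j c.1)%:R * (tot / 64)).
    rewrite /a mulSn exprD; field.
    by rewrite gt_eqF.
  have h0 : 0 <= N by rewrite /N.
  have := ler_wpM2l h0 hs => h1 h2.
  rewrite -(ler_pM2l (P0 (b j))).
  apply: (le_trans h2); rewrite mulrCA; apply: (le_trans h1).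
  rewrite le_eqVlt; apply/orP; left; apply/eqP; field.
  by rewrite gt_eqF.
have := hQ; rewrite ler_pM2l // => h.
have : 0 <= W * (top j 3)%:R by rewrite mulr_ge0.
by rewrite /B; lra.
Qed.

End Class.
End Summing.

(** * Nets in the unit ball of a block *)

Lemma sum_quad (V : nmodType) (m n : nat) (F : nat -> V) : (m <= n)%N ->
  \sum_(4 * m <= k < 4 * n) F k = \sum_(m <= i < n) \sum_(c < 4) F (4 * i + c)%N.
Proof.
elim: n => [|n IH]; first by rewrite leqn0 => /eqP ->; rewrite !big_geq.
rewrite leq_eqVlt => /orP[/eqP ->|]; first by rewrite !big_geq.
rewrite ltnS => mn; have -> : (4 * n.+1 = (4 * n).+4)%N by lia.
rewrite (@big_cat_nat _ _ _ (4 * n)); [|lia|lia].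
rewrite IH // [RHS]big_nat_recr //; congr (_ + _).
rewrite 4?big_nat_recr ?big_geq ?add0r; try lia.
rewrite !big_ord_recr big_ord0 /= add0r.
by rewrite addn0 addn1 addn2 addn3 add0r.
Qed.

Section Net.
Variables (R : realType) (b L st : nat -> nat).
Hypothesis L_big : forall j, (2 ^ (100 * (b j).+1) * (st j).+1 <= L j)%N.
Hypothesis st_mono : {homo st : i j / (i <= j)%N}.
Implicit Types (x w : nat -> R).

Local Notation blk_le := (blk_le b L st).
Local Notation inb := (inb st).

Definition coords j := index_iota (4 * st j) (4 * st j.+1).

Lemma mem_coords j n : (n \in coords j) = inb j (n %/ 4).
Proof. by rewrite mem_index_iota /inb; apply/idP/idP; lia. Qed.

Lemma divq i c : (c < 4)%N -> ((4 * i + c) %/ 4 = i)%N.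
Proof. lia. Qed.

Lemma exists_blk_norm w j : exists S, [/\ 0 <= S, blk_le w j S &
  0 < S -> ~ blk_le w j (S / 2)].
Proof.
pose A := [set M | 0 <= M /\ blk_le w j M]%classic.
have A0 : (A !=set0)%classic.
  pose t := \sum_(n <- coords j) `|w n|.
  have t0 : 0 <= t by rewrite sumr_ge0.
  exists (2 ^+ (4 * b j).+1 * t); split; first by rewrite mulr_ge0 ?exprn_ge0.
  apply: blk_le_sup => // i c ij c4.
  have ic : (4 * i + c)%N \in coords j by rewrite mem_coords divq.
  by rewrite /t (big_rem _ ic) /= lerDl sumr_ge0.
have hA : has_inf A by split=> //; exists 0 => M [].
have h0 : 0 <= inf A by apply: lb_le_inf => // M [].
exists (inf A); split=> // [|S0 h].
  apply: (blk_le_closed L_big) => e e0.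
  have [M [_ hM] lt] := inf_adherent e0 hA.
  by apply: blk_leW hM; apply: ltW.
have : inf A <= inf A / 2.
  by apply: ge_inf; [exists 0 => M []|split=> //; rewrite divr_ge0].
by lra.
Qed.

(** With this mesh, rounding changes the block norm by at most
    [2 ^ (4 b + 1) / 2 ^ (4 b + 3) = 1 / 4], by [blk_le_sup]. *)
Definition gridn j := (2 ^ (4 * b j).+3)%N.
Definition gridT j := {ffun 'I_(4 * (st j.+1 - st j)).+1 -> 'I_(4 * gridn j).+1}.

Definition gridv j (t : gridT j) (n : nat) : R :=
  if n \in coords j then (t (inord (n - 4 * st j)))%:R / (gridn j)%:R - 2 else 0.

(** Vectors outside twice the unit ball are replaced by 0, so that the net is indexed by the whole
    finite type [gridT j]. *)
Definition grid j (t : gridT j) : nat -> R :=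
  if `[< blk_le (gridv t) j 2 >] then gridv t else fun=> 0.

Lemma blk_le0 j M : 0 <= M -> blk_le (fun=> 0 : R) j M.
Proof.
move=> M0; apply: (@blk_le_small _ _ _ _ L_big _ _ _ [::]) => //.
  by move=> *; rewrite normr0.
by rewrite muln0.
Qed.

Lemma blk_le_grid j (t : gridT j) : blk_le (grid t) j 2.
Proof. by rewrite /grid; case: asboolP => // _; apply: blk_le0. Qed.

Lemma blk_leB x y j M M' : blk_le x j M -> blk_le y j M' ->
  blk_le (fun n => x n - y n) j (M + M').
Proof.
move=> hx /(blk_leZ (-1)); rewrite normrN1 mul1r => hy.
apply: eq_blk_le (blk_leD hx hy) => i c _ _; by rewrite mulN1r.
Qed.

Lemma dotE (I : seq nat) (g x y : nat -> R) a :
  dot I g (fun n => x n + a * y n) = dot I g x + a * dot I g y.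
Proof.
by rewrite /dot mulr_sumr -big_split /=; apply: eq_bigr => n _; ring.
Qed.

Lemma eq_dot j (g x y : nat -> R) :
  (forall i c, inb j i -> (c < 4)%N -> x (4 * i + c)%N = y (4 * i + c)%N) ->
  dot (coords j) g x = dot (coords j) g y.
Proof.
move=> h; apply: eq_big_seq => n; rewrite mem_coords => nj.
have -> : n = (4 * (n %/ 4) + n %% 4)%N by lia.
by rewrite h // ltn_mod.
Qed.

Lemma grid_round x j : blk_le x j 1 ->
  exists t : gridT j, blk_le (fun n => x n - grid t n) j (1 / 4).
Proof.
move=> hx; pose G : R := (gridn j)%:R.
have G0 : 0 < G by rewrite ltr0n expn_gt0.
have bx i c : inb j i -> (c < 4)%N -> `|x (4 * i + c)%N| <= 1 by have [h _] := hx; exact: h.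
pose q n := Num.truncn ((x n + 2) * G).
pose t : gridT j := [ffun k : 'I_(4 * (st j.+1 - st j)).+1 => inord (q (4 * st j + k)%N)].
have ht i c : inb j i -> (c < 4)%N ->
    `|x (4 * i + c)%N - gridv t (4 * i + c)%N| <= 1 / G.
  move=> ij c4; rewrite /gridv mem_coords divq // ij ffunE.
  have /andP[i1 i2] := ij.
  rewrite [X in q (_ + X)%N]inordK; last by lia.
  have -> : (4 * st j + (4 * i + c - 4 * st j))%N = (4 * i + c)%N by lia.
  have := bx i c ij c4; set v := x (4 * i + c)%N; rewrite ler_norml => /andP[v1 v2].
  have v0 : 0 <= (v + 2) * G by rewrite mulr_ge0 ?(ltW G0) //; lra.
  have /andP[q1 q2] := truncn_itv v0; rewrite -/(q (4 * i + c)%N) in q1 q2.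
  have qb : (q (4 * i + c) < (4 * gridn j).+1)%N.
    rewrite ltnS -(ler_nat R) (le_trans q1) // natrM ler_wpM2r ?(ltW G0) //.
    by lra.
  rewrite inordK // -/G.
  have -> : v - ((q (4 * i + c)%N)%:R / G - 2) =
      ((v + 2) * G - (q (4 * i + c)%N)%:R) / G by field; rewrite gt_eqF.
  rewrite normrM normfV.
  rewrite [`|G|]gtr0_norm // ler_pM2r ?invr_gt0 // ger0_norm; first by lra.
  by rewrite subr_ge0.
have hB : blk_le (fun n => x n - gridv t n) j (1 / 4).
  have h := @blk_le_sup R b L st (fun n => x n - gridv t n) j (1 / G) _ ht.
  apply: blk_leW (h _); last by rewrite divr_ge0 // ltW.
  rewrite /G /gridn natrX mulrA mulr1 !exprS.
  have p : 0 < 2 ^+ (4 * b j) :> R by rewrite exprn_gt0.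
  rewrite le_eqVlt; apply/orP; left; apply/eqP; field.
  by rewrite gt_eqF.
have h2 : blk_le (gridv t) j 2.
  have : blk_le (gridv t) j (1 + 1 / 4).
    by apply: eq_blk_le (blk_leB hx hB) => i c _ _; ring.
  by apply: blk_leW; lra.
by exists t; rewrite /grid; case: asboolP.
Qed.

(** If [s] is the supremum over the unit ball, rounding leaves a remainder in a quarter of that
    ball, so [s <= m + s / 4]. *)
Lemma net_grid j g m :
  (forall t : gridT j, `|dot (coords j) g (grid t)| <= m) ->
  forall x, blk_le x j 1 -> `|dot (coords j) g x| <= 2 * m.
Proof.
move=> hm.
pose A := [set v | exists x, blk_le x j 1 /\ v = `|dot (coords j) g x|]%classic.
have hA : has_sup A.
  split; first by exists `|dot (coords j) g (fun=> 0)|, (fun=> 0); split=> //; apply: blk_le0.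
  exists (\sum_(n <- coords j) `|g n|) => v [x [[hx _] ->]].
  apply: (le_trans (ler_norm_sum _ _ _)).
  rewrite big_seq [leRHS]big_seq; apply: ler_sum => n; rewrite mem_coords => nj.
  rewrite normrM ler_piMr //.
  have -> : n = (4 * (n %/ 4) + n %% 4)%N by lia.
  by apply: hx => //; rewrite ltn_mod.
have m0 : 0 <= m by apply: le_trans (normr_ge0 _) (hm [ffun=> ord0]).
have hs : sup A <= m + sup A / 4.
  apply: ge_sup; first by have [] := hA.
  move=> v [x [hx ->]]; have [t ht] := grid_round hx.
  have -> : dot (coords j) g x = dot (coords j) g (grid t) +
      1 / 4 * dot (coords j) g (fun n => 4 * (x n - grid t n)).
    by rewrite -dotE; apply: eq_bigr => n _; congr (_ * _); field.
  have hd : `|dot (coords j) g (fun n => 4 * (x n - grid t n))| <= sup A.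
    apply: sup_ubound; first by have [] := hA.
    exists (fun n => 4 * (x n - grid t n)); split=> //.
    have := blk_leZ 4 ht; rewrite ger0_norm //.
    by have -> : 4 * (1 / 4) = 1 :> R by field.
  have h4 : 0 <= 1 / 4 :> R by rewrite divr_ge0.
  apply: (le_trans (ler_normD _ _)); rewrite normrM (ger0_norm h4).
  by have := hm t; lra.
move=> x hx; have : `|dot (coords j) g x| <= sup A.
  by apply: sup_ubound; [have [] := hA|exists x].
by lra.
Qed.

Lemma dotZ I (g x : nat -> R) a : dot I g (fun n => a * x n) = a * dot I g x.
Proof. by rewrite /dot mulr_sumr; apply: eq_bigr => n _; ring. Qed.

Lemma dot_le j f w S M : (forall x, blk_le x j 1 -> `|dot (coords j) f x| <= M) ->
  0 <= S -> blk_le w j S -> `|dot (coords j) f w| <= M * S.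
Proof.
move=> hf; rewrite le_eqVlt => /orP[/eqP <-|S0] hw.
  rewrite mulr0 normr_le0 (eq_dot f (y := fun=> 0)); last first.
    by move=> i c ij c4; apply/eqP; rewrite -normr_le0; have [h _] := hw; exact: h.
  by rewrite /dot big1 // => n _; rewrite mulr0.
have := hf (fun n => S^-1 * w n); rewrite dotZ normrM.
rewrite gtr0_norm ?invr_gt0 // mulrC ler_pdivrMr //; apply.
by have := blk_leZ S^-1 hw; rewrite gtr0_norm ?invr_gt0 // mulVf // gt_eqF.
Qed.

End Net.

(** * The trace through the later blocks *)

Section Upper.
Variables (R : realType) (b L st : nat -> nat).
Hypothesis L_big : forall j, (2 ^ (100 * (b j).+1) * (st j).+1 <= L j)%N.
Hypothesis st_mono : {homo st : i j / (i <= j)%N}.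
Hypothesis L_net : forall i j, (i < j)%N -> (#|gridT b st i| <= L j)%N.

Local Notation blk_le := (blk_le b L st).
Local Notation inb := (inb st).
Local Notation top := (toprung b L).
Local Notation coords := (coords st).

Variables (j J : nat) (al be : nat -> nat -> R) (C : R).
Hypothesis b0 : (0 < b j)%N.
Hypothesis C0 : 0 <= C.
Hypothesis jJ : (j < J)%N.

Definition opA (x : nat -> R) m := dot (coords j) (al m) x.
Definition opB (y : nat -> R) n := \sum_(0 <= m < 4 * st J) be n m * y m.

Hypothesis hA : forall x t, 0 <= t -> blk_le x j t ->
  forall k, (k < J)%N -> blk_le (opA x) k (C * t).
Hypothesis hB : forall y t, 0 <= t -> (forall k, (k < J)%N -> blk_le y k t) ->
  blk_le (opB y) j (C * t).

(** At each later index [i] the four rows of [al] factor through four combinations of net vectors of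
    block [j]. The trace becomes a sum of values of [f i k] at [w i k], the image under [opB] of the
    part at [i] of the image under [opA] of such a combination. A signed sum of the [w i k] over [i]
    is the image of a vector that is, index by index, a combination of the finitely many images of
    net vectors. So [blk_le_tsup] bounds it, and [one_summing] bounds the sum of the norms. *)
Lemma upper_trace :
  `|\sum_(n <- coords j) \sum_(4 * st j.+1 <= m < 4 * st J) be n m * al m n| <=
  2 ^+ 16 * C ^+ 2 * (8 * (st j.+1 - st j)%:R / 2 ^+ b j + (top j 3)%:R).
Proof.
set X := 8 * _ / _ + _.
pose z : gridT b st j -> nat -> R := @grid R b L st j.
have net := @net_grid R b L st L_big j.
have /choice[F hF] : forall i, exists v : (nat -> nat -> R) * (nat -> gridT b st j -> R),
  [/\ forall k, (k < 4)%N -> \sum_t `|v.2 k t| <= 2 ^+ k,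
      forall k x, (k < 4)%N -> blk_le x j 1 -> `|dot (coords j) (v.1 k) x| <= 2 &
      forall c x, (c < 4)%N -> blk_le x j 1 ->
        dot (coords j) (al (4 * i + c)%N) x =
        \sum_(k < 4) dot (coords j) (v.1 k) x *
          dot (coords j) (al (4 * i + c)%N) (comb z (v.2 k))].
  move=> i; have [f [l [h1 h2 h3]]] :=
    rank_decomposition ([ffun=> ord0] : gridT b st j) net 4 (fun c => al (4 * i + c)%N).
  by exists (f, l).
pose f i := (F i).1; pose l i := (F i).2.
have hl i k : (k < 4)%N -> \sum_t `|l i k t| <= 2 ^+ k by have [h _ _] := hF i; exact: h.
have hf i k x : (k < 4)%N -> blk_le x j 1 -> `|dot (coords j) (f i k) x| <= 2.
  by have [_ h _] := hF i; exact: h.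
have hd i c x : (c < 4)%N -> dot (coords j) (al (4 * i + c)%N) x =
    \sum_(k < 4) dot (coords j) (f i k) x *
      dot (coords j) (al (4 * i + c)%N) (comb z (l i k)).
  move=> c4; have [_ _ h] := hF i; have [T [T0 hT _]] := exists_blk_norm L_big x j.
  have T1 : 0 < T + 1 by rewrite ltr_wpDl.
  have Tx : blk_le (fun n => (T + 1)^-1 * x n) j 1.
    apply: blk_leW (blk_leZ (T + 1)^-1 hT).
    by rewrite gtr0_norm ?invr_gt0 // mulrC ler_pdivrMr // mul1r lerDl.
  have := h c _ c4 Tx; rewrite dotZ.
  under eq_bigr do rewrite dotZ -mulrA.
  by rewrite -mulr_sumr => /mulfI; apply; rewrite invr_neq0 // gt_eqF.
pose w i k n := \sum_(c < 4) dot (coords j) (al (4 * i + c)%N) (comb z (l i k)) *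
   be n (4 * i + c)%N.
pose Gs := index_iota (st j.+1) (st J).
have E : \sum_(n <- coords j) \sum_(4 * st j.+1 <= m < 4 * st J) be n m * al m n =
    \sum_(k < 4) \sum_(i <- Gs) dot (coords j) (f i k) (w i k).
  rewrite exchange_big /= sum_quad; last exact: st_mono.
  rewrite [RHS]exchange_big; apply: eq_bigr => i _.
  have wE k : dot (coords j) (f i k) (w i k) =
      \sum_(c < 4) dot (coords j) (f i k) (fun n => be n (4 * i + c)%N) *
         dot (coords j) (al (4 * i + c)%N) (comb z (l i k)).
    rewrite /w {1}/dot.
    under eq_bigr do rewrite mulr_sumr.
    rewrite exchange_big; apply: eq_bigr => c _.
    by rewrite [RHS]mulrC -dotZ /dot; apply: eq_bigr => n _; ring.
  under [RHS]eq_bigr do rewrite wE.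
  rewrite [RHS]exchange_big; apply: eq_bigr => c _.
  rewrite -hd //.
  by rewrite /dot; apply: eq_bigr => n _; rewrite mulrC.
have /choice[S hS] : forall ik : nat * nat, exists S, [/\ 0 <= S, blk_le (w ik.1 ik.2) j S &
    0 < S -> ~ blk_le (w ik.1 ik.2) j (S / 2)].
  by move=> ik; exact: exists_blk_norm.
(* [96 * C ^+ 2] is [C] times [6 * 8 * (C * 2)]: 6 comes from [blk_le_tsup], 8 bounds the
   coefficient sums [2 ^+ k] with [k < 4], and 2 bounds the norm of grid vectors. *)
have main (k : 'I_4) : \sum_(i <- Gs) S (i, val k) <= 64 * (96 * C ^+ 2) * X.
  apply: (one_summing L_big b0 (w := fun i => w i k)); first last.
  - by move=> i s0; have [_ _ h] := hS (i, val k); exact: h.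
  - by move=> i; have [_ h _] := hS (i, val k).
  - by move=> i; have [h _ _] := hS (i, val k).
  - by rewrite mulr_ge0 // exprn_ge0.
  move=> th th1.
  pose u n := if (n %/ 4)%N \in Gs then
    th (n %/ 4)%N * dot (coords j) (al n) (comb z (l (n %/ 4)%N k)) else 0.
  have hu q : (q < J)%N -> blk_le u q (6 * 8 * (C * 2)).
    move=> qJ; have [qj|jq] := leqP q j.
      have z0 : blk_le (fun=> 0 : R) q (6 * 8 * (C * 2)).
        by apply: blk_le0 => //; rewrite !mulr_ge0.
      apply: eq_blk_le z0 => i c iq c4.
        rewrite /u divq //; case: ifP => //; rewrite mem_index_iota.
        have /andP[_ i2] := iq.
        have := leq_trans i2 (st_mono (_ : q.+1 <= j.+1)%N).
        by move=> /(_ qj); lia.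
    have z2 t : blk_le (opA (z t)) q (C * 2).
      by apply: hA => //; exact: blk_le_grid.
    apply: (blk_le_tsup L_big ([ffun=> ord0] : gridT b st j) (L_net jq) _ _ z2
        (l := fun i t => if i \in Gs then th i * l i k t else 0)) => //.
    - by rewrite mulr_ge0.
    - move=> i c iq c4; rewrite /u divq //; case: ifP => _; last first.
        by rewrite big1 // => t _; rewrite mul0r.
      rewrite dot_comb mulr_sumr; apply: eq_bigr => t _.
      by rewrite mulrA.
    - move=> i _; apply: (@le_trans _ _ (\sum_t `|l i k t|)).
        apply: ler_sum => t _; case: ifP => _; last by rewrite normr0.
        by rewrite normrM ler_piMl.
      apply: (le_trans (hl i k (ltn_ord k))).
      rewrite (_ : 8 = 2 ^+ 3 :> R); last by rewrite -natrX.
      by apply: ler_weXn2l; [rewrite ler1n|have := ltn_ord k; lia].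
  have := hB _ hu.
  have -> : C * (6 * 8 * (C * 2)) = 96 * C ^+ 2 by ring.
  have h0 : 0 <= 6 * 8 * (C * 2) by rewrite !mulr_ge0.
  move=> /(_ h0); apply: eq_blk_le => i' c' _ _.
  set n := (4 * i' + c')%N.
  have stJ : (st j.+1 <= st J)%N by exact: st_mono.
  rewrite /opB (@big_cat_nat _ _ _ (4 * st j.+1)) /=; [|lia|lia].
  rewrite big_nat big1 ?add0r => [|m /andP[_ m1]]; last first.
    rewrite /u mem_index_iota ltn_divLR // mulnC leq_divRL // mulnC.
    by rewrite leqNgt m1 /= mulr0.
  rewrite sum_quad // big_seq [RHS]big_seq; apply: eq_bigr => i iG.
  rewrite /w mulr_sumr; apply: eq_bigr => c _.
  by rewrite /u divq // iG; ring.
rewrite E; apply: (le_trans (ler_norm_sum _ _ _)).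
(* Each of the four functionals [f i k] has norm at most 2, and [4 * 2 * 64 * 96] is below
   [2 ^ 16]. *)
apply: (@le_trans _ _ (\sum_(k < 4) 2 * (64 * (96 * C ^+ 2) * X))).
  apply: ler_sum => k _; apply: (le_trans (ler_norm_sum _ _ _)).
  apply: le_trans (ler_wpM2l _ (main k)); last by [].
  rewrite mulr_sumr; apply: ler_sum => i _.
  have [s0 s1 _] := hS (i, val k).
  by apply: (dot_le _ s0 s1) => x; apply: hf.
have X0 : 0 <= X by rewrite /X addr_ge0 // divr_ge0 ?exprn_ge0 // mulr_ge0.
have CX : 0 <= C ^+ 2 * X by rewrite mulr_ge0 // exprn_ge0.
rewrite sumr_const card_ord -[_ *+ 4]mulr_natl.
have -> : 2 ^+ 16 = 2 ^+ 8 * 2 ^+ 8 :> R by rewrite -exprD.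
have -> : 2 ^+ 8 = 256 :> R by rewrite -natrX.
by lra.
Qed.

End Upper.

(** * The trace of an antilinear block *)

Section Combinatorics.

Lemma size_fibers (T T' : eqType) (k : T -> T') (d : nat) (E : seq T) :
  (forall y, (size [seq x <- E | k x == y] <= d)%N) ->
  (size E <= d * size (undup (map k E)))%N.
Proof.
move=> h.
have -> : size E = (\sum_(y <- undup (map k E)) size [seq x <- E | k x == y])%N.
  under eq_bigr do rewrite size_filter -sum1_count.
  rewrite (exchange_big_dep xpredT) //= -sum1_size big_seq [RHS]big_seq.
  apply: eq_bigr => x xE.
  rewrite (eq_bigl (fun y => y == k x)) => [|y]; last by rewrite eq_sym.
  rewrite -big_filter filter_pred1_uniq ?big_seq1 ?undup_uniq //.
  by rewrite mem_undup map_f.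
elim: (undup _) => [|y s IH]; first by rewrite big_nil.
by rewrite big_cons /= mulnS leq_add.
Qed.

(** Greedy choice: each element kept discards at most [d] elements, those in conflict with it,
    itself included. *)
Lemma independent_subset (T : eqType) (conf : rel T) (d : nat) (E : seq T) :
  symmetric conf -> uniq E -> (forall x, x \in E -> conf x x) ->
  (forall x, x \in E -> (size [seq y <- E | conf x y] <= d)%N) ->
  exists Q, [/\ uniq Q, {subset Q <= E}, (size E <= d * size Q)%N &
    forall x y, x \in Q -> y \in Q -> conf x y -> x = y].
Proof.
move=> cs; have [n] := ubnP (size E); elim: n E => // n IH [|x E] sE uE hr hd.
  by exists [::].
pose E' := [seq y <- x :: E | ~~ conf x y].
have cxx : conf x x by apply: hr; rewrite mem_head.
have E'x : {subset E' <= x :: E} by move=> y; rewrite mem_filter => /andP[].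
have s1 : (size E' < n)%N.
  rewrite ltnS in sE; apply: leq_trans sE; rewrite ltnS.
  by rewrite /E' /= cxx /= size_filter count_size.
have h2 y : y \in E' -> (size [seq z <- E' | conf y z] <= d)%N.
  move=> /E'x /hd; apply: leq_trans.
  rewrite !size_filter /E' count_filter; apply: sub_count => z /=.
  by case/andP.
have [Q [uQ QE hQ iQ]] :=
  IH E' s1 (filter_uniq _ uE) (fun y yE => hr y (E'x y yE)) h2.
have Qx y : y \in Q -> conf x y = false.
  by move=> /QE; rewrite mem_filter => /andP[/negbTE].
exists (x :: Q); split.
- rewrite /= uQ andbT; apply/negP => /Qx.
  by rewrite cxx.
- by move=> y; rewrite inE => /orP[/eqP ->|/QE /E'x //]; rewrite mem_head.
- rewrite [size (_ :: Q)]/= mulnS -(count_predC (conf x) (x :: E)) -!size_filter.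
  by apply: leq_add => //; apply: hd; rewrite mem_head.
move=> y z; rewrite !inE => /orP[/eqP ->|yQ] /orP[/eqP ->|zQ] //.
- by rewrite Qx.
- by rewrite cs Qx.
- exact: iQ.
Qed.

End Combinatorics.

Section Block.
Variables (R : realType) (b L st : nat -> nat).
Hypothesis L_big : forall j, (2 ^ (100 * (b j).+1) * (st j).+1 <= L j)%N.
Variable j : nat.
Hypothesis st_j : st j.+1 = (st j + L j ^ (16 * b j + 3))%N.

Local Notation blk_le := (blk_le b L st).
Local Notation inb := (inb st).
Local Notation top := (toprung b L).
Local Notation coords := (coords st).
Local Notation dotj := (dot (coords j)).

Definition place (v : nat -> R) (i n : nat) : R :=
  if (n %/ 4 == i)%N then v (n %% 4)%N else 0.

Lemma placeE v i k c : (c < 4)%N -> place v i (4 * k + c)%N = if k == i then v c else 0.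
Proof. by move=> c4; rewrite /place divq // mulnC modnMDl modn_small. Qed.

Definition idx := index_iota (st j) (st j.+1).

Lemma mem_idx i : (i \in idx) = inb j i.
Proof. by rewrite mem_index_iota. Qed.

Lemma st_le : (st j <= st j.+1)%N.
Proof. by rewrite st_j leq_addr. Qed.

Lemma sum_coords (V : nmodType) (F : nat -> V) :
  \sum_(n <- coords j) F n = \sum_(i <- idx) \sum_(c < 4) F (4 * i + c)%N.
Proof. by rewrite sum_quad // st_le. Qed.

Lemma dot_place g v i : inb j i -> dotj g (place v i) = \sum_(c < 4) g (4 * i + c)%N * v c.
Proof.
move=> ij; rewrite /dot sum_coords (bigD1_seq i) ?mem_idx ?iota_uniq //=.
rewrite [X in _ + X]big1 ?addr0 => [|k /negbTE ki].
  by apply: eq_bigr => c _; rewrite placeE // eqxx.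
by rewrite big1 // => c _; rewrite placeE // ki mulr0.
Qed.

Section Operator.
Variables (M : nat -> nat -> R) (C : R).
Hypothesis C0 : 0 <= C.
Hypothesis hM : forall x t, 0 <= t -> blk_le x j t ->
  blk_le (fun m => dotj (M m) x) j (C * t).

Lemma entry_le k i c c' : inb j k -> inb j i -> (c < 4)%N -> (c' < 4)%N ->
  `|M (4 * k + c)%N (4 * i + c')%N| <= C.
Proof.
move=> kj ij c4 c'4.
pose v n : R := (n == c')%:R.
have h : blk_le (place v i) j 1.
  apply: (@blk_le_small _ _ _ _ L_big _ _ _ [:: i]) => //.
  - move=> l d _ d4; rewrite placeE //; case: ifP => _; last by rewrite normr0.
    by rewrite /v; case: (d == c'); rewrite ?normr1 ?normr0.
  - by move=> l d _ /negP; rewrite inE => /negP/negbTE li d4; rewrite placeE // li.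
  - by rewrite muln1; apply: (L_ge L_big); lia.
have [] := hM ler01 h => /(_ k c kj c4).
rewrite dot_place // (bigD1 (Ordinal c'4)) //= /v eqxx mulr1 big1 ?addr0 ?mulr1 //.
move=> d dc; suff -> : (nat_of_ord d == c') = false by rewrite mulr0.
by apply: negbTE; apply: contraNneq dc => e; apply/eqP/val_inj.
Qed.

(** The row is tested on the vector of its own signs, whose block norm is at most
    [2 ^ (4 b + 1)]. *)
Lemma row_sum_le k c : inb j k -> (c < 4)%N ->
  \sum_(n <- coords j) `|M (4 * k + c)%N n| <= C * 2 ^+ (4 * b j).+1.
Proof.
move=> kj c4; pose m := (4 * k + c)%N.
have h : blk_le (fun n => Num.sg (M m n)) j (2 ^+ (4 * b j).+1 * 1).
  apply: blk_le_sup => // i d _ _; rewrite normr_sg.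
  by case: (_ != 0).
have := hM _ h; rewrite mulr1 exprn_ge0 // => /(_ isT)[/(_ k c kj c4) h' _].
apply: le_trans h'; apply: le_trans (ler_norm _).
rewrite le_eqVlt; apply/orP; left; apply/eqP; apply: eq_bigr => n _.
by rewrite normrEsg mulrC.
Qed.

(** Chosen so that products with a factor below [eta] contribute at most a quarter of the number of
    indices to the trace. Then [deg] is the number of indices with an entry above [eta] that
    [row_sum_le] allows when [C <= 2 ^ b]. *)
Definition eta : R := (2 ^+ (5 * b j + 6))^-1.
Definition deg := (2 ^ (10 * b j + 9))%N.

Definition big_entry k i :=
  [exists c : 'I_4, exists c' : 'I_4, eta <= `|M (4 * k + c)%N (4 * i + c')%N|].

Lemma big_degree k : C <= 2 ^+ b j -> inb j k ->
  (size [seq i <- idx | big_entry k i] <= deg)%N.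
Proof.
move=> Cb kj; have e0 : 0 < eta by rewrite invr_gt0 exprn_gt0.
rewrite -(ler_nat R) -(ler_pM2r e0).
pose F i := \sum_(c < 4) \sum_(c' < 4) `|M (4 * k + c)%N (4 * i + c')%N|.
apply: (@le_trans _ _ (\sum_(i <- [seq i <- idx | big_entry k i]) F i)).
  apply: sum_seq_ge => i; rewrite mem_filter => /andP[/existsP[c /existsP[c' h]] _].
  rewrite /F (bigD1 c) //= (bigD1 c') //= -addrA; apply: (le_trans h).
  by rewrite lerDl addr_ge0 // sumr_ge0 // => d _; rewrite sumr_ge0.
apply: (@le_trans _ _ (\sum_(i <- idx) F i)).
  rewrite big_filter big_mkcond /=; apply: ler_sum => i _; case: ifP => // _.
  by rewrite sumr_ge0 // => c _; rewrite sumr_ge0.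
rewrite /F exchange_big /=.
apply: (@le_trans _ _ (\sum_(c < 4) 2 ^+ b j * 2 ^+ (4 * b j).+1)).
  apply: ler_sum => c _; have := row_sum_le kj (ltn_ord c); rewrite sum_coords.
  by move/le_trans; apply; rewrite ler_wpM2r // exprn_ge0.
rewrite sumr_const card_ord -[_ *+ 4]mulr_natl /eta ler_pdivlMr ?exprn_gt0 //.
rewrite /deg natrX (_ : 4 = 2 ^+ 2 :> R) -?natrX // !natrX -!exprD.
by rewrite ler_weXn2l ?ler1n //; lia.
Qed.

End Operator.

(* For each [r], two vectors spanning over R the kernel of the complex
   functional [psi r]. *)
Definition kv (r : nat) (d : bool) (c : nat) : R :=
  match r with
  | 0 => (c == 2 + d)%N%:R
  | 1 => (c == d)%:R
  | 2 => (c == d)%:R + (c == 2 + d)%N%:R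
  | _ => if d then (c == 1%N)%:R - (c == 2%N)%:R else (c == 0%N)%:R + (c == 3%N)%:R
  end.

Lemma kv_le r d c : `|kv r d c| <= 1.
Proof.
case: r d c => [|[|[|r]]] [] [|[|[|[|c]]]] /=;
  by rewrite ?subr0 ?addr0 ?add0r ?sub0r ?normrN ?normr1 ?normr0.
Qed.

Lemma psi_kv r d e i k : (r < 4)%N -> psi r e (place (kv r d) i) k = 0.
Proof.
case: r => [|[|[|[|//]]]] _; case: d; case: e => [|e] /=; rewrite !placeE //=;
  case: (k == i) => /=; ring.
Qed.

Section Antilinear.
Variables (al be : nat -> nat -> R) (C : R).
Hypothesis b0 : (0 < b j)%N.
Hypothesis C0 : 0 <= C.
Hypothesis Cb : C <= 2 ^+ b j.
Hypothesis hal : forall x t, 0 <= t -> blk_le x j t ->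
  blk_le (fun m => dotj (al m) x) j (C * t).
Hypothesis hbe : forall x t, 0 <= t -> blk_le x j t ->
  blk_le (fun m => dotj (be m) x) j (C * t).
Hypothesis anti1 : forall p q, inb j (p %/ 2) -> inb j (q %/ 2) ->
  al (2 * p)%N (2 * q).+1 = al (2 * p).+1 (2 * q)%N.
Hypothesis anti2 : forall p q, inb j (p %/ 2) -> inb j (q %/ 2) ->
  al (2 * p).+1 (2 * q).+1 = - al (2 * p)%N (2 * q)%N.

(** Asking that both factors be large bounds the degree on both sides: the rows of [be] bound the
    number of [k] for a given [i], the rows of [al] the number of [i] for a given [k]. *)
Definition heavy i k := big_entry al k i && big_entry be i k.

(** [C] times the ratio of [2 ^ (r b + 1)], the norm of a flat sum of kernel vectors of [psi r], to
    [2 ^ ((r + 1) b)], the top weight of level [r]. *)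
Definition delta : R := 2 * C / 2 ^+ b j.

Definition exc (r : 'I_4) (d e : bool) i := has (fun k => heavy i k &&
  (delta < `|psi r e (fun m => dotj (al m) (place (kv r d) i)) k|)) idx.

Lemma delta_ge0 : 0 <= delta.
Proof. by rewrite divr_ge0 ?exprn_ge0 // mulr_ge0. Qed.

Lemma top3 r : (r < 4)%N -> (top j r <= top j 3)%N.
Proof.
move=> r4; rewrite /top /kap; apply: leq_pexp2l; first exact: (L_gt0 L_big).
nia.
Qed.

Lemma psi_opsum (M : nat -> nat -> R) r e k (Q : seq nat) (h : nat -> R)
    (X : nat -> nat -> R) :
  psi r e (fun m => dotj (M m) (fun n => \sum_(l <- Q) h l * X l n)) k =
  \sum_(l <- Q) h l * psi r e (fun m => dotj (M m) (X l)) k.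
Proof.
rewrite -psi_sum; apply: eq_psi => c _; rewrite /dot.
under [RHS]eq_bigr do rewrite mulr_sumr.
rewrite [RHS]exchange_big; apply: eq_bigr => n _ /=.
by rewrite mulr_sumr; apply: eq_bigr => l _; ring.
Qed.

(* Tests [al] on a signed sum of [top j r] copies of the kernel vector [kv r d]. *)
Lemma exc_bound r d e : (size [seq i <- idx | exc r d e i] <= deg * top j 3)%N.
Proof.
set E := [seq i <- _ | _].
have memE i : i \in E = exc r d e i && (i \in idx) by rewrite mem_filter.
have uE : uniq E by rewrite filter_uniq ?iota_uniq.
clearbody E.
pose P i k := heavy i k &&
  (delta < `|psi r e (fun m => dotj (al m) (place (kv r d) i)) k|).
pose kf i := nth 0%N idx (find (P i) idx).
have hk i : i \in E -> kf i \in idx /\ P i (kf i).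
  rewrite memE => /andP[h _]; split; last exact: nth_find.
  by rewrite mem_nth // -has_find.
have Ej i : i \in E -> inb j i by rewrite memE mem_idx => /andP[].
(* Few exceptional [i] share a heavy target, so too many of them would give more than [top j r]
   distinct targets. The test vector has one source [io k] for each target [k]. *)
pose Q0 := undup (map kf E).
have Q0j k : k \in Q0 -> inb j k.
  by rewrite mem_undup => /mapP[i /hk[h _] ->]; rewrite -mem_idx.
have fib y : (size [seq i <- E | kf i == y] <= deg)%N.
  case: (boolP (inb j y)) => yj; last first.
    rewrite (@eq_in_filter _ _ pred0) ?filter_pred0 // => i iE; apply: negbTE.
    by apply: contraNneq yj => <-; rewrite -mem_idx; have [] := hk i iE.
  apply: leq_trans (big_degree C0 hal Cb yj).
  apply: uniq_leq_size; first by rewrite filter_uniq.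
  move=> i; rewrite !mem_filter => /andP[/eqP ky iE].
  have [_ /andP[/andP[h _] _]] := hk i iE; rewrite -ky h /=.
  by move: iE; rewrite memE => /andP[].
apply: (leq_trans (size_fibers fib)); rewrite leq_mul2l; apply/orP; right.
apply: leq_trans (top3 (ltn_ord r)); rewrite -/Q0 leqNgt; apply/negP => big.
pose Q := take (top j r) Q0.
have sQ : size Q = top j r by rewrite size_takel // ltnW.
have uQ : uniq Q by rewrite take_uniq // undup_uniq.
have QE k : k \in Q -> k \in map kf E.
  by move=> /mem_take; rewrite mem_undup.
have aQ : all (inb j) Q by apply/allP => k /mem_take /Q0j.
pose io k := nth 0%N E (index k (map kf E)).
have ioE k : k \in Q -> io k \in E /\ kf (io k) = k.
  move=> /QE kE; have lt : (index k (map kf E) < size E)%N.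
    by rewrite -(size_map kf) index_mem.
  split; first exact: mem_nth.
  by rewrite -(nth_map 0%N 0%N kf) // nth_index.
pose X l := place (kv r d) (io l).
pose M k l := psi r e (fun m => dotj (al m) (X l)) k.
have [h [h1 h2]] := sign_diag M uQ.
pose x n := \sum_(l <- Q) h l * X l n.
have hx : blk_le x j (2 ^+ (r * b j).+1 * 1 + 2 ^+ (r.+1 * b j) * 0).
  apply: (blk_le_supp L_big (P := map io Q) (ltn_ord r)) => //.
  - move=> i c ij c4; rewrite /x.
    have [iQ|iQ] := boolP (kf i \in Q); last first.
      rewrite big_seq big1 ?normr0 // => l lQ; rewrite /X placeE //.
      case: eqP => [il|_]; last by rewrite mulr0.
      by move: iQ; rewrite il (ioE l lQ).2 lQ.
    rewrite (bigD1_seq (kf i)) //= big_seq_cond big1 ?addr0.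
      rewrite normrM (sign_norm (h1 _)) mul1r /X placeE //.
      by case: ifP => _; rewrite ?normr0 // kv_le.
    move=> l /andP[lQ lk]; rewrite /X placeE //; case: eqP => [il|_]; last by rewrite mulr0.
    by move: lk; rewrite il (ioE l lQ).2 eqxx.
  - move=> i e' _; rewrite psi_sum big1 ?normr0 // => l _.
    by rewrite /X psi_kv // mulr0.
  - move=> i c _ iP c4; rewrite /x big_seq big1 // => l lQ; rewrite /X placeE //.
    case: eqP => [il|_]; last by rewrite mulr0.
    by move: iP; rewrite il map_f.
  - rewrite size_map sQ leq_mul2r; apply/orP; right; apply: (L_ge L_big); lia.
have p0 n : 0 <= 2 ^+ n :> R by rewrite exprn_ge0.
rewrite mulr0 addr0 mulr1 in hx.
have := blk_le_top e (ltn_ord r) b0 uQ aQ _ (hal (p0 _) hx).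
rewrite sQ => /(_ (leqnn _)) h3.
have h4 : (top j r)%:R * delta < \sum_(k <- Q) `|M k k|.
  rewrite -sQ -sumr_const_seq big_seq [ltRHS]big_seq.
  have [q qQ] : exists q, q \in Q.
    have : (0 < size Q)%N by rewrite sQ (kap_gt0 L_big).
    by case: (Q) => // q ? _; exists q; rewrite mem_head.
  apply: ltr_sum => [|k kQ]; first by apply/hasP; exists q; rewrite // qQ.
  have [iE ik] := ioE k kQ; have [_ /andP[_]] := hk _ iE.
  by rewrite ik.
have h5 : \sum_(k <- Q) `|M k k| <= \sum_(k <- Q) `|psi r e (fun m => dotj (al m) x) k|.
  by apply: (le_trans h2); apply: ler_sum => k _; rewrite psi_opsum.
have h6 := lt_le_trans h4 h5.
have P0 n : 0 < 2 ^+ n :> R by rewrite exprn_gt0.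
have := ltr_pM2l (P0 (r.+1 * b j)%N) ((top j r)%:R * delta)
  (\sum_(k <- Q) `|psi r e (fun m => dotj (al m) x) k|).
rewrite h6 => /lt_le_trans/(_ h3).
rewrite /delta mulSn exprD exprS.
have -> : 2 ^+ b j * 2 ^+ (r * b j) * ((top j r)%:R * (2 * C / 2 ^+ b j)) =
  C * (2 * 2 ^+ (r * b j)) * (top j r)%:R by field; rewrite gt_eqF.
by rewrite ltxx.
Qed.

Definition excb i := [exists r : 'I_4, exists d : bool, exists e : bool, exc r d e i].

Lemma excb_bound : (size [seq i <- idx | excb i] <= 16 * (deg * top j 3))%N.
Proof.
apply: (@leq_trans (\sum_(t : 'I_4 * bool * bool)
    size [seq i <- idx | exc t.1.1 t.1.2 t.2 i])).
  elim: idx => [|i s IH]; first by rewrite big1.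
  rewrite /=; under eq_bigr do rewrite fun_if /=.
  case: ifP => [/existsP[r /existsP[d /existsP[e h]]]|_]; last first.
    apply: (leq_trans IH); apply: leq_sum => t _; case: ifP => _ //.
  rewrite (bigD1 (r, d, e)) //= h /= addSn ltnS; apply: (leq_trans IH).
  rewrite (bigD1 (r, d, e)) //= leq_add2l; apply: leq_sum => t _.
  by case: ifP.
apply: (@leq_trans (\sum_(t : 'I_4 * bool * bool) deg * top j 3)).
  by apply: leq_sum => t _; exact: exc_bound.
by rewrite sum_nat_const !card_prod card_ord card_bool.
Qed.

(** The tests with [r = 0] and [r = 1] bound the off-diagonal complex entries by [delta]. Up to
    these, [r = 2] bounds the difference of the two diagonal entries and [r = 3], by antilinearity,
    their sum; for a complex linear block it would be the difference again. *)
Lemma heavy_small i k : inb j i -> inb j k -> heavy i k -> ~~ excb i ->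
  forall c c', (c < 4)%N -> (c' < 4)%N ->
  `|al (4 * k + c)%N (4 * i + c')%N| <= 3 * delta.
Proof.
move=> ij kj hik /existsPn ne.
have test r d e : `|psi (r : 'I_4) (e : bool)
    (fun m => dotj (al m) (place (kv r d) i)) k| <= delta.
  have := ne r; move=> /existsPn/(_ d)/existsPn/(_ e)/hasPn/(_ k).
  by rewrite mem_idx hik /= -leNgt; exact.
have d0 := delta_ge0.
have k2 c : (c < 2)%N -> ((2 * k + c) %/ 2 = k)%N by lia.
have i2 c : (c < 2)%N -> ((2 * i + c) %/ 2 = i)%N by lia.
pose a c c' := al (4 * k + c)%N (4 * i + c')%N.
have A1 c d : (c < 2)%N -> (d < 2)%N -> a (2 * c)%N (2 * d).+1 = a (2 * c).+1 (2 * d)%N.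
  move=> c2 d2; rewrite /a !addnS.
  have -> : (4 * k + 2 * c = 2 * (2 * k + c))%N by lia.
  have -> : (4 * i + 2 * d = 2 * (2 * i + d))%N by lia.
  by rewrite anti1 ?k2 ?i2.
have A2 c d : (c < 2)%N -> (d < 2)%N -> a (2 * c).+1 (2 * d).+1 = - a (2 * c)%N (2 * d)%N.
  move=> c2 d2; rewrite /a !addnS.
  have -> : (4 * k + 2 * c = 2 * (2 * k + c))%N by lia.
  have -> : (4 * i + 2 * d = 2 * (2 * i + d))%N by lia.
  by rewrite anti2 ?k2 ?i2.
have e01 := A1 0%N 0%N isT isT; have e03 := A1 0%N 1%N isT isT.
have e21 := A1 1%N 0%N isT isT; have e23 := A1 1%N 1%N isT isT.
have e11 := A2 0%N 0%N isT isT; have e13 := A2 0%N 1%N isT isT.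
have e31 := A2 1%N 0%N isT isT; have e33 := A2 1%N 1%N isT isT.
rewrite !(muln0, muln1) in e01 e03 e21 e23 e11 e13 e31 e33.
have dE c v : dotj (al (4 * k + c)%N) (place v i) =
    a c 0%N * v 0%N + a c 1%N * v 1%N + a c 2 * v 2 + a c 3 * v 3.
  by rewrite dot_place // !big_ord_recr big_ord0 /= add0r.
have := test (@Ordinal 4 0 isT) false false; have := test (@Ordinal 4 0 isT) false true.
have := test (@Ordinal 4 0 isT) true false; have := test (@Ordinal 4 0 isT) true true.
have := test (@Ordinal 4 1 isT) false false; have := test (@Ordinal 4 1 isT) false true.
have := test (@Ordinal 4 1 isT) true false; have := test (@Ordinal 4 1 isT) true true.
have := test (@Ordinal 4 2 isT) false false; have := test (@Ordinal 4 2 isT) false true.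
have := test (@Ordinal 4 3 isT) false false; have := test (@Ordinal 4 3 isT) false true.
rewrite /= !dE /= !(mulr0, mulr1, add0r, addr0).
rewrite !ler_norml.
rewrite e23 e13 e33 => /andP[p1 p2] /andP[p3 p4] /andP[p5 p6] /andP[p7 p8].
move=> /andP[q1 q2] /andP[q3 q4] /andP[q5 q6] /andP[q7 q8].
move=> /andP[r1 r2] /andP[r3 r4] /andP[r5 r6] /andP[r7 r8].
by case=> [|[|[|[|//]]]] [|[|[|[|//]]]] _ _;
  rewrite -/(a _ _) ler_norml ?e01 ?e03 ?e21 ?e23 ?e11 ?e13 ?e31 ?e33; lra.
Qed.

Lemma heavyl i : inb j i -> (size [seq k <- idx | heavy i k] <= deg)%N.
Proof.
move=> ij; apply: leq_trans (big_degree C0 hbe Cb ij).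
by rewrite !size_filter; apply: sub_count => k /andP[].
Qed.

Lemma heavyr k : inb j k -> (size [seq i <- idx | heavy i k] <= deg)%N.
Proof.
move=> kj; apply: leq_trans (big_degree C0 hal Cb kj).
by rewrite !size_filter; apply: sub_count => i /andP[].
Qed.

Lemma size_flatten_le (T : Type) (s : seq (seq T)) d :
  all (fun t => (size t <= d)%N) s -> (size (flatten s) <= size s * d)%N.
Proof.
by elim: s => //= t s IH /andP[h /IH hs]; rewrite size_cat mulSn leq_add.
Qed.

Definition route i c := \sum_(k <- idx | heavy i k)
  \sum_(c' < 4) be (4 * i + c)%N (4 * k + c')%N * al (4 * k + c')%N (4 * i + c)%N.

Definition badc c := [seq i <- idx | ~~ excb i & 9 * C * delta < `|route i c|].

(** Bad indices with pairwise disjoint sets of heavy partners are selected first. The signed sum of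
    their images under [al], each restricted to its heavy partners, then has coordinates at most
    [3 * delta] by [heavy_small], and [be] is tested on it. Coordinate [c] is the functional
    [psi c./2 (odd c)], so the top rung of level [c./2] gives the bound. *)
Lemma bad_bound c : (c < 4)%N -> (size (badc c) <= deg.*2 ^ 2 * top j 3)%N.
Proof.
move=> c4; set B := badc c.
have memB i : i \in B = (~~ excb i && (9 * C * delta < `|route i c|)) && (i \in idx).
  by rewrite mem_filter.
have uB : uniq B by rewrite filter_uniq ?iota_uniq.
clearbody B.
have Bj i : i \in B -> inb j i by rewrite memB mem_idx => /andP[].
pose conf i l := (i == l) || has (fun k => heavy i k && heavy l k) idx.
have confs : symmetric conf.
  move=> i l; rewrite /conf eq_sym; congr (_ || _); apply: eq_has => k.
  by rewrite andbC.
have confd i : i \in B -> (size [seq l <- B | conf i l] <= deg.*2 ^ 2)%N.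
  move=> iB; pose F k := [seq l <- idx | heavy l k].
  pose K := [seq k <- idx | heavy i k].
  apply: (@leq_trans (size (i :: flatten (map F K)))).
    apply: uniq_leq_size; first by rewrite filter_uniq.
    move=> l; rewrite mem_filter inE => /andP[/orP[/eqP ->|]]; first by rewrite eqxx.
    move=> /hasP[k kj /andP[hi hl]] lB; apply/orP; right; apply/flatten_mapP.
    exists k; first by rewrite mem_filter hi.
    by rewrite mem_filter hl mem_idx Bj.
  have /size_flatten_le : all (fun t => (size t <= deg)%N) (map F K).
    apply/allP => t /mapP[k]; rewrite mem_filter mem_idx => /andP[_ kj] ->.
    exact: heavyr.
  rewrite size_map /= => h; apply: (@leq_ltn_trans (deg * deg)%N).
    by apply: (leq_trans h); rewrite leq_mul2r heavyl ?orbT // Bj.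
  have : (0 < deg)%N by rewrite expn_gt0.
  by rewrite expnS expn1; nia.
have [Q0 [uQ0 Q0B hQ0 iQ0]] := independent_subset confs uB
  (fun i _ => (introT orP (or_introl (eqxx i)) : conf i i)) confd.
apply: (leq_trans hQ0); rewrite leq_mul2l; apply/orP; right.
pose r := c./2; have r4 : (r < 4)%N by rewrite /r; lia.
apply: leq_trans (top3 r4); rewrite leqNgt; apply/negP => big.
pose Q := take (top j r) Q0.
have sQ : size Q = top j r by rewrite size_takel // ltnW.
have uQ : uniq Q by rewrite take_uniq.
have QB i : i \in Q -> i \in B by move=> /mem_take /Q0B.
have aQ : all (inb j) Q by apply/allP => i /QB /Bj.
have indQ i l k : i \in Q -> l \in Q -> inb j k -> heavy i k -> heavy l k -> i = l.
  move=> /mem_take iQ /mem_take lQ kj hi hl; apply: iQ0 => //.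
  by apply/orP; right; apply/hasP; exists k; rewrite ?mem_idx // hi.
pose X l n := if heavy l (n %/ 4)%N && inb j (n %/ 4) then al n (4 * l + c)%N else 0.
have XE l k c' : (c' < 4)%N -> X l (4 * k + c')%N =
   if heavy l k && inb j k then al (4 * k + c')%N (4 * l + c)%N else 0.
  by move=> c'4; rewrite /X divq.
pose M i l := dotj (be (4 * i + c)%N) (X l).
have ME i : i \in Q -> M i i = route i c.
  move=> iQ; rewrite /M /dot sum_coords /route [RHS]big_mkcond big_seq [RHS]big_seq.
  apply: eq_bigr => k; rewrite mem_idx => kj.
  under eq_bigr do rewrite XE // kj andbT.
  by case: ifP => // _; rewrite big1 // => c' _; rewrite mulr0.
have [h [h1 h2]] := sign_diag M uQ.
pose x n := \sum_(l <- Q) h l * X l n.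
have d0 := delta_ge0; have d3 : 0 <= 3 * delta by exact: mulr_ge0.
have xle i c' : inb j i -> (c' < 4)%N -> `|x (4 * i + c')%N| <= 3 * delta.
  move=> ij c'4; rewrite /x.
  have [/hasP[l lQ hl]|/hasPn hn] := boolP (has (fun l => heavy l i) Q).
    rewrite (bigD1_seq l) //= big_seq_cond big1 ?addr0.
      rewrite normrM (sign_norm (h1 _)) mul1r XE // hl ij /=.
      have := QB _ lQ; rewrite memB mem_idx => /andP[/andP[nl _] lj].
      exact: (heavy_small lj ij).
    move=> l' /andP[l'Q l'l]; rewrite XE //; case: ifP => [/andP[hl' _]|_].
      by move: l'l; rewrite (indQ _ _ _ l'Q lQ ij hl' hl) eqxx.
    by rewrite mulr0.
  rewrite big_seq big1 ?normr0 // => l lQ; rewrite XE //.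
  by rewrite (negbTE (hn l lQ)) mulr0.
have hx : blk_le x j (2 ^+ (r * b j).+1 * (3 * delta) + 2 ^+ (r.+1 * b j) * (2 * (3 * delta))).
  apply: (blk_le_supp L_big (P := flatten [seq [seq k <- idx | heavy l k] | l <- Q]) r4) => //.
  - exact: mulr_ge0.
  - by move=> i e ij; apply: psi_bound => c' c'4; exact: xle.
  - move=> i c' ij iP c'4; rewrite /x big_seq big1 // => l lQ; rewrite XE //.
    case: ifP => [/andP[hl _]|_]; last by rewrite mulr0.
    case/negP: iP; apply/flatten_mapP; exists l => //.
    by rewrite mem_filter hl mem_idx.
  - apply: (@leq_trans (2 ^ (4 * b j).+1 * (top j r * deg))).
      rewrite leq_mul2l; apply/orP; right.
      have : all (fun t => (size t <= deg)%N) [seq [seq k <- idx | heavy l k] | l <- Q].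
        apply/allP => t /mapP[l lQ ->]; apply: heavyl.
        by apply/Bj/QB.
      by move/size_flatten_le; rewrite size_map sQ.
    rewrite mulnCA mulnC leq_mul2r; apply/orP; right.
    by rewrite /deg -expnD; apply: (L_ge L_big); lia.
have p0 n : 0 < 2 ^+ n :> R by rewrite exprn_gt0.
have {}hx : blk_le x j (2 ^+ (r.+1 * b j) * (9 * delta)).
  apply: blk_leW hx.
  have : 2 ^+ (r * b j).+1 <= 2 ^+ (r.+1 * b j) :> R.
    by rewrite ler_weXn2l ?ler1n //; lia.
  by move=> /(ler_wpM2r d0); lra.
have e0 : 0 <= 2 ^+ (r.+1 * b j) * (9 * delta) by do ?[apply: mulr_ge0 => //]; exact: ltW.
have := blk_le_top (odd c) r4 b0 uQ aQ _ (hbe e0 hx).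
rewrite sQ => /(_ (leqnn _)).
have -> : C * (2 ^+ (r.+1 * b j) * (9 * delta)) * (top j r)%:R =
  2 ^+ (r.+1 * b j) * ((top j r)%:R * (9 * C * delta)) by ring.
rewrite ler_pM2l // leNgt => /negP; apply.
apply: (@lt_le_trans _ _ (\sum_(i <- Q) `|M i i|)).
  rewrite -sQ -sumr_const_seq big_seq [ltRHS]big_seq.
  have [q qQ] : exists q, q \in Q.
    have : (0 < size Q)%N by rewrite sQ (kap_gt0 L_big).
    by case: (Q) => // q ? _; exists q; rewrite mem_head.
  apply: ltr_sum => [|i iQ]; first by apply/hasP; exists q; rewrite // qQ.
  by rewrite ME //; have := QB _ iQ; rewrite memB => /andP[/andP[]].
apply: (le_trans h2); rewrite le_eqVlt; apply/orP; left; apply/eqP.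
apply: eq_bigr => i _; congr `|_|.
rewrite -psi_coord // /x /M /dot; under eq_bigr do rewrite mulr_sumr.
rewrite exchange_big; apply: eq_bigr => n _ /=.
by rewrite mulr_sumr; apply: eq_bigr => l _; ring.
Qed.

Lemma route_le i c : inb j i -> (c < 4)%N -> `|route i c| <= deg%:R * (4 * C ^+ 2).
Proof.
move=> ij c4; rewrite /route -big_filter; apply: (le_trans (ler_norm_sum _ _ _)).
apply: (@le_trans _ _ ((size [seq k <- idx | heavy i k])%:R * (4 * C ^+ 2))).
  apply: sum_seq_le => k; rewrite mem_filter mem_idx => /andP[_ kj].
  apply: (le_trans (ler_norm_sum _ _ _)).
  apply: (@le_trans _ _ (\sum_(c' < 4) C ^+ 2)).
    apply: ler_sum => c' _; rewrite normrM expr2.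
    by apply: ler_pM => //; [apply: (entry_le C0 hbe)|apply: (entry_le C0 hal)].
  by rewrite sumr_const card_ord -[_ *+ 4]mulr_natl.
by rewrite ler_wpM2r ?ler_nat ?heavyl // mulr_ge0 // exprn_ge0.
Qed.

Let N : R := (st j.+1 - st j)%:R.

Lemma size_idx : (size idx)%:R = N.
Proof. by rewrite size_iota. Qed.

Lemma row_total (M : nat -> nat -> R) :
  (forall x t, 0 <= t -> blk_le x j t -> blk_le (fun m => dotj (M m) x) j (C * t)) ->
  \sum_(n <- coords j) \sum_(m <- coords j) `|M n m| <=
    N * (4 * (C * 2 ^+ (4 * b j).+1)).
Proof.
move=> hM; rewrite sum_coords -size_idx; apply: sum_seq_le => i; rewrite mem_idx => ij.
apply: (@le_trans _ _ (\sum_(c < 4) C * 2 ^+ (4 * b j).+1)).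
  by apply: ler_sum => c _; exact: (row_sum_le hM ij (ltn_ord c)).
by rewrite sumr_const card_ord -[_ *+ 4]mulr_natl.
Qed.

Lemma light_entry n m : n \in coords j -> m \in coords j ->
  ~~ heavy (n %/ 4) (m %/ 4) -> `|be n m * al m n| <= eta * (`|be n m| + `|al m n|).
Proof.
have e0 : 0 < eta by rewrite invr_gt0 exprn_gt0.
rewrite !mem_coords => nj mj; rewrite /heavy negb_and normrM.
have ordn k : (k %% 4 < 4)%N by rewrite ltn_mod.
have eqn k : (4 * (k %/ 4) + k %% 4 = k)%N by lia.
move=> /orP[] /existsPn/(_ (Ordinal (ordn _)))/existsPn/(_ (Ordinal (ordn _))) h.
  have := h m n; rewrite /= !eqn -ltNge => /ltW /(ler_wpM2l (normr_ge0 (be n m))).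
  by have := mulr_ge0 (ltW e0) (normr_ge0 (al m n)); lra.
have := h n m; rewrite /= !eqn -ltNge => /ltW /(ler_wpM2r (normr_ge0 (al m n))).
by have := mulr_ge0 (ltW e0) (normr_ge0 (be n m)); lra.
Qed.

Lemma light_sum : `|\sum_(n <- coords j) \sum_(m <- coords j | ~~ heavy (n %/ 4) (m %/ 4))
    be n m * al m n| <= N / 4.
Proof.
have e0 : 0 < eta by rewrite invr_gt0 exprn_gt0.
apply: (@le_trans _ _ (eta * (N * (4 * (C * 2 ^+ (4 * b j).+1)) +
    N * (4 * (C * 2 ^+ (4 * b j).+1))))); last first.
  have N0 : 0 <= N by rewrite /N.
  have h : C * 2 ^+ (4 * b j).+1 <= 2 ^+ (b j + (4 * b j).+1)%N.
    by rewrite exprD ler_wpM2r // exprn_ge0.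
  rewrite /eta mulrC ler_pdivrMr ?exprn_gt0 //.
  have -> : (5 * b j + 6 = (b j + (4 * b j).+1) + 5)%N by lia.
  rewrite [in leRHS]exprD (_ : 2 ^+ 5 = 32 :> R); last by rewrite -natrX.
  by have := ler_wpM2l N0 h; lra.
have T1 := row_total hbe; have := row_total hal; rewrite exchange_big /= => T2.
apply: le_trans (ler_wpM2l (ltW e0) (lerD T1 T2)).
rewrite -big_split /= mulr_sumr; apply: (le_trans (ler_norm_sum _ _ _)).
rewrite big_seq [leRHS]big_seq; apply: ler_sum => n nj.
rewrite -big_split /= mulr_sumr; apply: (le_trans (ler_norm_sum _ _ _)).
rewrite big_mkcond big_seq [leRHS]big_seq; apply: ler_sum => m mj.
case: ifP => [h|_]; first exact: light_entry.
by rewrite (mulr_ge0 (ltW e0)) // addr_ge0.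
Qed.

Lemma heavy_sum : \sum_(n <- coords j) \sum_(m <- coords j | heavy (n %/ 4) (m %/ 4))
    be n m * al m n = \sum_(c < 4) \sum_(i <- idx) route i c.
Proof.
rewrite sum_coords [RHS]exchange_big; apply: eq_bigr => i _; apply: eq_bigr => c _.
rewrite big_mkcond sum_coords /route [RHS]big_mkcond; apply: eq_bigr => k _.
rewrite divq //; under eq_bigr do rewrite divq //.
by case: ifP => // _; rewrite big1.
Qed.

(** The terms account for the light pairs, for the routes of size at most [9 * C * delta] in four
    coordinates, and for the exceptional or bad indices, which are few and for which [route_le]
    suffices. *)
Lemma block_trace :
  `|\sum_(n <- coords j) \sum_(m <- coords j) be n m * al m n| <=
  N / 4 + 36 * N * C * delta + (2 ^ 11 * deg ^ 3 * top j 3)%N%:R * C ^+ 2.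
Proof.
have -> : \sum_(n <- coords j) \sum_(m <- coords j) be n m * al m n =
    \sum_(n <- coords j) \sum_(m <- coords j | ~~ heavy (n %/ 4) (m %/ 4)) be n m * al m n
    + \sum_(c < 4) \sum_(i <- idx) route i c.
  rewrite -heavy_sum -big_split /=; apply: eq_bigr => n _.
  by rewrite (bigID (fun m => heavy (n %/ 4) (m %/ 4))) /= addrC.
rewrite (le_trans (ler_normD _ _)) // -addrA lerD ?light_sum //.
have d0 := delta_ge0; have Cd : 0 <= 9 * C * delta by rewrite mulr_ge0 // mulr_ge0.
have C2 : 0 <= C ^+ 2 by rewrite exprn_ge0.
pose T : R := (16 * (deg * top j 3) + deg.*2 ^ 2 * top j 3)%N%:R * (deg%:R * (4 * C ^+ 2)).
apply: (@le_trans _ _ (\sum_(c < 4) (T + N * (9 * C * delta)))); last first.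
  rewrite sumr_const card_ord -[_ *+ 4]mulr_natl /T.
  have h : (4 * ((16 * (deg * top j 3) + deg.*2 ^ 2 * top j 3) * (deg * 4)) <=
     2 ^ 11 * deg ^ 3 * top j 3)%N.
    have : (0 < deg)%N by rewrite expn_gt0.
    set d := deg; set t := top j 3 => dp.
    rewrite -muln2 (_ : 2 ^ 11 = 2048)%N // !expnS !expn0 !muln1.
    by have : (d * t * d <= d * t * (d * d))%N; nia.
  move: h; rewrite -(ler_nat R) => /(ler_wpM2r C2); rewrite !natrM; lra.
apply: (le_trans (ler_norm_sum _ _ _)); apply: ler_sum => c _.
apply: (le_trans (ler_norm_sum _ _ _)).
pose B1 := [seq i <- idx | excb i].
have hr i : i \in idx -> `|route i c| <= (excb i)%:R * (deg%:R * (4 * C ^+ 2)) +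
   (~~ excb i && (9 * C * delta < `|route i c|))%:R * (deg%:R * (4 * C ^+ 2)) +
   9 * C * delta.
  rewrite mem_idx => ij; have h := route_le ij (ltn_ord c).
  have h0 : 0 <= deg%:R * (4 * C ^+ 2) by apply: le_trans h.
  case: (excb i) => /=; first by rewrite mul1r mul0r; lra.
  case: ltP => h1 /=; first by rewrite mul1r mul0r; lra.
  by rewrite !mul0r !add0r.
apply: (@le_trans _ _ (\sum_(i <- idx) ((excb i)%:R * (deg%:R * (4 * C ^+ 2)) +
   (~~ excb i && (9 * C * delta < `|route i c|))%:R * (deg%:R * (4 * C ^+ 2)) +
   9 * C * delta))).
  by rewrite big_seq [leRHS]big_seq; apply: ler_sum.
rewrite !big_split /= sumr_const_seq size_idx lerD2r -!mulr_suml -mulrDl.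
rewrite /T ler_wpM2r ?mulr_ge0 // natrD lerD //.
  rewrite -natr_sum ler_nat -big_mkcond sum1_count -size_filter.
  exact: excb_bound.
rewrite -natr_sum ler_nat -big_mkcond sum1_count -size_filter.
exact: bad_bound.
Qed.

End Antilinear.
End Block.

(** * Rigidity of antilinear blocks *)

Section Numerics.

Lemma lower_numerics b s :
  (4 * s * 2 ^ (b + (4 * b).+1) * 8 <= 2 ^ (100 * b.+1) * s.+1)%N.
Proof.
apply: (@leq_trans (2 ^ (b + (4 * b).+1) * 2 ^ 5 * s.+1)).
  rewrite [leqRHS]mulnS.
  have -> : (4 * s * 2 ^ (b + (4 * b).+1) * 8 = 2 ^ (b + (4 * b).+1) * 2 ^ 5 * s)%N.
    by rewrite (_ : 2 ^ 5 = 4 * 8)%N //; ring.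
  exact: leq_addl.
by rewrite -expnD leq_mul2r leq_exp2l //; apply/orP; right; lia.
Qed.

Lemma middle_numerics b :
  ((2 ^ 11 * (2 ^ (10 * b + 9)) ^ 3 + 2 ^ 16) * 2 ^ b * 2 ^ 3 <= 2 ^ (31 * b + 42))%N.
Proof.
rewrite -expnM -expnD.
apply: (@leq_trans (2 ^ (11 + (10 * b + 9) * 3).+1 * 2 ^ b * 2 ^ 3)).
  rewrite leq_mul2r leq_mul2r; apply/orP; right; apply/orP; right.
  by rewrite [in leqRHS]expnS mul2n -addnn leq_add2l leq_exp2l //; lia.
by rewrite -!expnD leq_exp2l //; lia.
Qed.

End Numerics.

Section Rigidity.
Variables (R : realType) (b L st : nat -> nat).
Hypothesis L_big : forall j, (2 ^ (100 * (b j).+1) * (st j).+1 <= L j)%N.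
Hypothesis st0 : st 0 = 0%N.
Hypothesis st_rec : forall j, st j.+1 = (st j + L j ^ (16 * b j + 3))%N.
Hypothesis L_net : forall i j, (i < j)%N -> (#|gridT b st i| <= L j)%N.

Local Notation blk_le := (blk_le b L st).
Local Notation inb := (inb st).
Local Notation top := (toprung b L).
Local Notation coords := (coords st).

Lemma st_mono : {homo st : i j / (i <= j)%N}.
Proof.
by apply: homo_leq => [//|j i k|j]; [exact: leq_trans|rewrite st_rec leq_addr].
Qed.

Lemma inb_uniq i k l : inb k i -> inb l i -> k = l.
Proof.
clear st0; move=> /andP[k1 k2] /andP[l1 l2]; case: (ltngtP k l) => // h.
  by have := st_mono h; lia.
by have := st_mono h; lia.
Qed.

Lemma inb_ex i J : (i < st J)%N -> exists2 k, (k < J)%N & inb k i.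
Proof.
elim: J => [|J IH]; first by rewrite st0.
case: (ltnP i (st J)) => [/IH[k kJ ki] _|h1 h2]; first by exists k => //; exact: leqW.
by exists J => //; rewrite /inb h1.
Qed.

Variables (j J : nat) (al be : nat -> nat -> R) (C : R).
Hypothesis C0 : 0 <= C.
Hypothesis jJ : (j < J)%N.
Hypothesis hA : forall x t, 0 <= t -> blk_le x j t ->
  forall k, (k < J)%N -> blk_le (opA st j al x) k (C * t).
Hypothesis hB : forall y t, 0 <= t -> (forall k, (k < J)%N -> blk_le y k t) ->
  blk_le (opB st J be y) j (C * t).
Hypothesis anti1 : forall p q, inb j (p %/ 2) -> inb j (q %/ 2) ->
  al (2 * p)%N (2 * q).+1 = al (2 * p).+1 (2 * q)%N.
Hypothesis anti2 : forall p q, inb j (p %/ 2) -> inb j (q %/ 2) ->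
  al (2 * p).+1 (2 * q).+1 = - al (2 * p)%N (2 * q)%N.

Let N : R := (st j.+1 - st j)%:R.

Lemma hal x t : 0 <= t -> blk_le x j t ->
  blk_le (fun m => dot (coords j) (al m) x) j (C * t).
Proof. by move=> t0 /(hA t0)/(_ j jJ). Qed.

Lemma hbe x t : 0 <= t -> blk_le x j t ->
  blk_le (fun n => dot (coords j) (be n) x) j (C * t).
Proof.
move=> t0 hx; pose y m := if inb j (m %/ 4) then x m else 0.
have hy k : (k < J)%N -> blk_le y k t.
  move=> kJ; have [->|kj] := eqVneq k j.
    by apply: eq_blk_le hx => i c ij c4; rewrite /y divq // ij.
  have z0 : blk_le (fun=> 0 : R) k t by exact: blk_le0.
  apply: eq_blk_le z0 => i c ik c4; rewrite /y divq //; case: ifP => // ij.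
  by rewrite (inb_uniq ik ij) eqxx in kj.
apply: eq_blk_le (hB t0 hy) => i c ij c4; rewrite /opB.
have s1 : (st j <= st j.+1)%N by exact: st_mono.
have s2 : (st j.+1 <= st J)%N by exact: st_mono.
rewrite (@big_cat_nat _ _ _ (4 * st j)) /=; [|lia|lia].
rewrite (@big_cat_nat _ _ _ (4 * st j.+1) (4 * st j)) /=; [|lia|lia].
rewrite big_nat big1 ?add0r => [|m /andP[_ m1]]; last first.
  by rewrite /y ifF ?mulr0 //; apply/negbTE; rewrite /inb; lia.
rewrite addrC big_nat big1 ?add0r => [|m /andP[m1 _]]; last first.
  by rewrite /y ifF ?mulr0 //; apply/negbTE; rewrite /inb; lia.
apply: eq_big_seq => m; rewrite -/(coords j) mem_coords => mj.
by rewrite /y mj.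
Qed.

Lemma be_entry n m : inb j (n %/ 4) -> (m < 4 * st J)%N -> `|be n m| <= C.
Proof.
move=> nj mJ; pose y l : R := (l == m)%:R.
have hy k : (k < J)%N -> blk_le y k 1.
  move=> kJ; apply: (@blk_le_small _ _ _ _ L_big _ _ _ [:: (m %/ 4)%N]) => //.
  - by move=> i c _ _; rewrite /y; case: eqP; rewrite ?normr1 ?normr0.
  - move=> i c _ iP c4; rewrite /y; case: eqP => // e.
    by move: iP; rewrite -e divq // mem_head.
  - by rewrite muln1; apply: (L_ge L_big); lia.
have [h _] := hB ler01 hy.
have := h _ (n %% 4)%N nj; rewrite ltn_mod => /(_ isT).
have -> : (4 * (n %/ 4) + n %% 4 = n)%N by lia.
rewrite mulr1 /opB (bigD1_seq m) ?mem_index_iota ?iota_uniq //=.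
rewrite {1}/y eqxx mulr1 big1 ?addr0 // => l /negbTE lm.
by rewrite /y lm mulr0.
Qed.

Lemma al_row m : (m < 4 * st J)%N ->
  \sum_(n <- coords j) `|al m n| <= C * 2 ^+ (4 * b j).+1.
Proof.
move=> mJ; have [k kJ km] : exists2 k, (k < J)%N & inb k (m %/ 4).
  by apply: inb_ex; lia.
have h : blk_le (fun n => Num.sg (al m n)) j (2 ^+ (4 * b j).+1 * 1).
  apply: blk_le_sup => // i d _ _; rewrite normr_sg.
  by case: (_ != 0).
have t0 : 0 <= 2 ^+ (4 * b j).+1 * 1 :> R by rewrite mulr1 exprn_ge0.
have [/(_ _ (m %% 4)%N km) h' _] := hA t0 h kJ.
move: h'; rewrite ltn_mod => /(_ isT).
have -> : (4 * (m %/ 4) + m %% 4 = m)%N by lia.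
rewrite mulr1 => h'; apply: le_trans h'; apply: le_trans (ler_norm _).
rewrite le_eqVlt; apply/orP; left; apply/eqP; apply: eq_bigr => n _.
by rewrite normrEsg mulrC.
Qed.

Lemma lower_trace :
  `|\sum_(n <- coords j) \sum_(0 <= m < 4 * st j) be n m * al m n| <=
  (4 * st j)%:R * (C * (C * 2 ^+ (4 * b j).+1)).
Proof.
have sJ : (st j <= st J)%N by apply: st_mono; exact: ltnW.
rewrite exchange_big /=; apply: (le_trans (ler_norm_sum _ _ _)).
rewrite -[X in X%:R * _](subn0 (4 * st j)) -(size_iota 0 (4 * st j - 0)) -/(index_iota _ _).
apply: sum_seq_le => m; rewrite mem_index_iota => /andP[_ mj].
have mJ : (m < 4 * st J)%N by lia.
apply: (le_trans (ler_norm_sum _ _ _)).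
apply: (@le_trans _ _ (\sum_(n <- coords j) C * `|al m n|)).
  rewrite big_seq [leRHS]big_seq; apply: ler_sum => n; rewrite mem_coords => nj.
  by rewrite normrM ler_wpM2r // be_entry.
by rewrite -mulr_sumr ler_wpM2l // al_row.
Qed.

(* The trace of [be * al] on block [j] splits into the contributions of the lower
   blocks, which have too small a dimension, of block [j], which is small by
   antilinearity, and of the later blocks, bounded by [upper_trace]. *)
Lemma antilinear_block : 2 ^+ 20 * C ^+ 2 <= 2 ^+ b j ->
  (forall n, n \in coords j -> 1 / 2 <= \sum_(0 <= m < 4 * st J) be n m * al m n) ->
  1 <= C -> False.
Proof.
move=> Cb htr C1.
have p0 n : 0 < 2 ^+ n :> R by rewrite exprn_gt0.
have C2 : 1 <= C ^+ 2 by rewrite exprn_ege1.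
have C2b : C ^+ 2 <= 2 ^+ b j.
  by apply: le_trans Cb; rewrite ler_peMl ?exprn_ege1 ?ler1n // exprn_ge0.
have b0 : (0 < b j)%N.
  rewrite lt0n; apply/eqP => e; move: Cb; rewrite e expr0.
  have : 2 <= 2 ^+ 20 :> R by rewrite -[X in X <= _]expr1 ler_weXn2l ?ler1n.
  by move=> /(ler_wpM2r (le_trans ler01 C2)); lra.
have Cb' : C <= 2 ^+ b j by apply: le_trans C2b; rewrite expr2 ler_peMl.
have s1 : (st j <= st j.+1)%N by exact: st_mono.
have s2 : (st j.+1 <= st J)%N by exact: st_mono.
have N0 : 0 < N by rewrite /N st_rec addKn ltr0n expn_gt0 (L_gt0 L_big).
have h2 : 2 * N <= \sum_(n <- coords j) \sum_(0 <= m < 4 * st J) be n m * al m n.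
  have := sum_seq_ge htr; rewrite size_iota -mulnBr natrM -/N.
  by lra.
have E : \sum_(n <- coords j) \sum_(0 <= m < 4 * st J) be n m * al m n =
   \sum_(n <- coords j) \sum_(0 <= m < 4 * st j) be n m * al m n +
   (\sum_(n <- coords j) \sum_(m <- coords j) be n m * al m n +
   \sum_(n <- coords j) \sum_(4 * st j.+1 <= m < 4 * st J) be n m * al m n).
  rewrite -!big_split /=; apply: eq_bigr => n _.
  rewrite (@big_cat_nat _ _ _ (4 * st j)) /=; [|by []|by rewrite leq_mul2l (leq_trans s1)].
  by rewrite (@big_cat_nat _ _ _ (4 * st j.+1) (4 * st j)) //= leq_mul2l.
have T1 := le_trans (ler_norm _) lower_trace.
have T2 := le_trans (ler_norm _) (block_trace L_big (st_rec j) b0 C0 Cb' hal hbe anti1 anti2).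
have T3 := le_trans (ler_norm _) (upper_trace L_big st_mono L_net b0 C0 jJ hA hB).
rewrite -/N in T2 T3.
rewrite E in h2.
(* The block has [L ^ 3] times as many indices as the largest set tested by its norm, so exceptional
   sets, of size [top j 3] times a power of 2 below [L], are negligible. *)
have NE : N = (L j ^ 3 * top j 3)%N%:R.
  by rewrite /N st_rec addKn /toprung /kap -expnD; congr (_ ^ _)%:R; clear; lia.
have L1 : (L j <= L j ^ 3)%N by rewrite -[X in (X <= _)%N]expn1 leq_pexp2l // (L_gt0 L_big).
have t1 : (0 < top j 3)%N by rewrite (kap_gt0 L_big).
(* The trace is at least [2 * N], from [4 * N] diagonal entries of at least [1 / 2]. Against it
   stand [N / 4] for the light pairs and, by [U1] to [U4], three times [N / 8] and once [N / 2], in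
   total [9 * N / 8]. *)
have U1 : (4 * st j)%:R * (C * (C * 2 ^+ (4 * b j).+1)) <= N / 8.
  rewrite [C * (C * _)]mulrA -expr2; apply: (@le_trans _ _ ((4 * st j)%:R * (2 ^+ b j * 2 ^+ (4 * b j).+1))).
    by rewrite ler_wpM2l // ler_wpM2r // ltW.
  rewrite ler_pdivlMr // NE -exprD -natrX -!natrM ler_nat.
  apply: (@leq_trans (L j)); last by rewrite (leq_trans L1) // leq_pmulr.
  apply: leq_trans (L_big j).
  exact: lower_numerics.
have U2 : (2 ^ 11 * deg b j ^ 3 * top j 3)%N%:R * C ^+ 2 + 2 ^+ 16 * C ^+ 2 * (top j 3)%:R <= N / 8.
  have -> : (2 ^ 11 * deg b j ^ 3 * top j 3)%N%:R * C ^+ 2 + 2 ^+ 16 * C ^+ 2 * (top j 3)%:R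
    = (2 ^ 11 * deg b j ^ 3 * top j 3 + 2 ^ 16 * top j 3)%N%:R * C ^+ 2.
    by rewrite natrD [X in _ = (_ + X) * _]natrM natrX; ring.
  apply: (@le_trans _ _ ((2 ^ 11 * deg b j ^ 3 * top j 3 + 2 ^ 16 * top j 3)%N%:R * 2 ^+ b j)).
    by rewrite ler_wpM2l.
  rewrite ler_pdivlMr // NE -natrX -!natrM ler_nat.
  rewrite -mulnDl [(_ * top j 3 * _)%N]mulnAC [(_ * top j 3 * 8)%N]mulnAC leq_mul2r.
  apply/orP; right.
  apply: (leq_trans (middle_numerics (b j))); apply: leq_trans L1.
  by apply: (L_ge L_big); clear; lia.
have U3 : 36 * N * C * delta b j C <= N / 8.
  have -> : 36 * N * C * delta b j C = 72 * N * (C ^+ 2 / 2 ^+ b j).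
    by rewrite /delta; field; rewrite gt_eqF.
  have h : C ^+ 2 / 2 ^+ b j <= (2 ^+ 10)^-1.
    rewrite ler_pdivrMr // ler_pdivlMl //; apply: le_trans Cb.
    by rewrite ler_wpM2r ?(le_trans ler01) // ler_weXn2l // ler1n.
  have := ler_wpM2l (ltW N0) h; rewrite (_ : 2 ^+ 10 = 1024 :> R); first lra.
  by rewrite -natrX.
have U4 : 2 ^+ 16 * C ^+ 2 * (8 * N / 2 ^+ b j) <= N / 2.
  have h : C ^+ 2 / 2 ^+ b j <= (2 ^+ 20)^-1.
    by rewrite ler_pdivrMr // ler_pdivlMl.
  have -> : 2 ^+ 16 * C ^+ 2 * (8 * N / 2 ^+ b j) = 2 ^+ 16 * 8 * (N * (C ^+ 2 / 2 ^+ b j)).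
    by field; rewrite gt_eqF.
  have := ler_wpM2l (ltW N0) h => h1.
  apply: (le_trans (ler_wpM2l _ h1)); first by rewrite mulr_ge0 // ltW.
  rewrite (_ : 2 ^+ 20 = 2 ^+ 16 * 16 :> R); last by rewrite -[16]/(16%:R) (_ : 16 = 2 ^ 4)%N // natrX -exprD.
  rewrite le_eqVlt; apply/orP; left; apply/eqP; by field.
rewrite mulrDr in T3.
lra.
Qed.

End Rigidity.

(** * The space *)

Section BlockSizes.

(* [bw] takes each value infinitely often, so that every coordinate of a real
   sequence can be coded by infinitely many blocks of the same distortion. *)
Definition bw (j : nat) := logn 2 j.+1.
(** The exponent contains [j] and not [bw j] because [bL j] must also exceed the nets of all earlier
    blocks [i], where [bw i] may be larger than [bw j] but is at most [i]. *)
Definition ladder (j s : nat) := (2 ^ (100 * j.+1 * s.+1))%N.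
Fixpoint bst (j : nat) : nat :=
  if j is k.+1 then (bst k + ladder k (bst k) ^ (16 * bw k + 3))%N else 0%N.
Definition bL j := ladder j (bst j).

Lemma bst_rec j : bst j.+1 = (bst j + bL j ^ (16 * bw j + 3))%N.
Proof. by []. Qed.

Lemma bw_le j : (bw j <= j)%N.
Proof.
rewrite -ltnS; apply: leq_trans (ltn_expl _ (isT : 1 < 2)%N) _.
by apply: dvdn_leq => //; exact: pfactor_dvdnn.
Qed.

Lemma bL_big j : (2 ^ (100 * (bw j).+1) * (bst j).+1 <= bL j)%N.
Proof.
rewrite /bL /ladder; move: (bst j) (bw_le j) => s; move: (bw j) => w wj.
apply: (@leq_trans (2 ^ (100 * w.+1) * 2 ^ s)).
  by rewrite leq_mul2l ltn_expl // orbT.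
by rewrite -expnD leq_exp2l //; nia.
Qed.

Lemma bL_net i j : (i < j)%N -> (#|gridT bw bst i| <= bL j)%N.
Proof.
move=> ij; have : (bst i.+1 <= bst j)%N.
  apply: (homo_leq (f := bst) (r := leq)) ij => [//|k l m|k]; first exact: leq_trans.
  by rewrite bst_rec leq_addr.
rewrite card_ffun !card_ord /gridn /bL /ladder; set N := (bst i.+1 - bst i)%N.
move=> h; have {h} : (N <= bst j)%N by apply: leq_trans h; exact: leq_subr.
move: N (bst j) (bw_le i) => N s; move: (bw i) => w wi Ns.
apply: (@leq_trans ((2 ^ (4 * w + 6)) ^ (4 * N).+1)).
  rewrite leq_exp2r // (_ : 4 * w + 6 = (4 * w).+3 + 3)%N; last by lia.
  by rewrite expnD; have := expn_gt0 2 (4 * w).+3; lia.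
by rewrite -expnM leq_exp2l //; nia.
Qed.

End BlockSizes.

Local Open Scope classical_set_scope.
Local Open Scope ring_scope.

Section Space.
Variable R : realType.

Local Notation ble := (@blk_le R bw bL bst).

Definition vanishing (x : nat -> R^o) : Prop :=
  forall e : R, 0 < e -> exists J, forall j, (J <= j)%N -> ble x j e.

Definition c0pred : {pred nat -> R^o} := [pred x | `[< vanishing x >]].

Lemma c0predP x : reflect (vanishing x) (x \in c0pred).
Proof. exact: asboolP. Qed.

Lemma c0_submod : submod_closed c0pred.
Proof.
split=> [|a x y /c0predP hx /c0predP hy].
  apply/c0predP => e e0; exists 0%N => j _.
  apply: (@eq_blk_le _ _ _ _ (fun=> 0)) => //.
  by apply: (blk_le0 bL_big); exact: ltW.
apply/c0predP => e e0.
have a0 : 0 < `|a| + 1 by rewrite ltr_wpDl.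
have e2 : 0 < e / 2 by rewrite divr_gt0.
have [J1 h1] := hx (e / 2 / (`|a| + 1)) (divr_gt0 e2 a0).
have [J2 h2] := hy (e / 2) e2.
exists (maxn J1 J2) => j; rewrite geq_max => /andP[/h1 k1 /h2 k2].
rewrite (splitr e); apply: (blk_leD _ k2); apply: blk_leW (blk_leZ a k1).
rewrite mulrA ler_pdivrMr // mulrC ler_wpM2l ?lerDl //.
by rewrite ltW // divr_gt0.
Qed.

HB.instance Definition _ := GRing.isSubmodClosed.Build R _ c0pred c0_submod.

Record c0sum := C0sum { c0seq :> nat -> R^o; _ : c0seq \in c0pred }.

HB.instance Definition _ := [isSub for c0seq].
HB.instance Definition _ := [Choice of c0sum by <:].
HB.instance Definition _ := [SubChoice_isSubLmodule of c0sum by <:].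

Implicit Types (x y : c0sum).

Lemma bst_ge j : (j <= bst j)%N.
Proof.
elim: j => // j IH; rewrite bst_rec -addn1 leq_add // expn_gt0.
by rewrite (L_gt0 bL_big).
Qed.

Lemma inb_all i : exists j, inb bst j i.
Proof.
have [j _ ij] := @inb_ex bst erefl i i.+1 (bst_ge i.+1).
by exists j.
Qed.

Lemma c0_vanishing x : vanishing x.
Proof. by apply/c0predP; case: x. Qed.

Definition c0bounds x := [set M : R | 0 <= M /\ forall j, ble x j M].

Definition c0norm x : R := inf (c0bounds x).

Lemma c0bounds_inf x : has_inf (c0bounds x).
Proof.
split; last by exists 0 => M [].
have [J hJ] := c0_vanishing x ltr01.
have /choice[S hS] := exists_blk_norm bL_big x.
exists (1 + \sum_(j < J) S j); split.
  by rewrite addr_ge0 // sumr_ge0 // => j _; have [] := hS j.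
move=> j; case: (leqP J j) => jJ.
  apply: blk_leW (hJ j jJ); rewrite lerDl sumr_ge0 // => k _; by have [] := hS k.
have [_ h _] := hS j; apply: blk_leW h.
rewrite (bigD1 (Ordinal jJ)) //= addrCA lerDl addr_ge0 //.
by rewrite sumr_ge0 // => k _; have [] := hS k.
Qed.

Lemma c0norm_ge0 x : 0 <= c0norm x.
Proof. by apply: lb_le_inf => [|M []//]; have [] := c0bounds_inf x. Qed.

Lemma c0norm_ble x j : ble x j (c0norm x).
Proof.
apply: (blk_le_closed bL_big) => e e0.
have [M [_ hM] lt] := inf_adherent e0 (c0bounds_inf x).
by apply: blk_leW (hM j); exact: ltW.
Qed.

Lemma c0norm_le x M : 0 <= M -> (forall j, ble x j M) -> c0norm x <= M.
Proof. by move=> M0 hM; apply: ge_inf; [have [] := c0bounds_inf x|]. Qed.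

Lemma c0norm_coord x n : `|x n| <= c0norm x.
Proof.
have [j ij] := inb_all (n %/ 4); have [h _] := c0norm_ble x j.
have := h _ (n %% 4)%N ij; rewrite ltn_mod => /(_ isT).
by have -> : (4 * (n %/ 4) + n %% 4 = n)%N by lia.
Qed.

Lemma c0normD x y : c0norm (x + y) <= c0norm x + c0norm y.
Proof.
apply: c0norm_le => [|j]; first by rewrite addr_ge0 // c0norm_ge0.
exact: blk_leD (c0norm_ble x j) (c0norm_ble y j).
Qed.

Lemma c0normZ_le a x : c0norm (a *: x) <= `|a| * c0norm x.
Proof.
apply: c0norm_le => [|j]; first by rewrite mulr_ge0 // c0norm_ge0.
exact: blk_leZ (c0norm_ble x j).
Qed.

Lemma c0norm_eq0 x : c0norm x = 0 -> x = 0.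
Proof.
move=> x0; apply: val_inj; apply/funext => n; apply/eqP.
by rewrite -normr_le0 -x0 c0norm_coord.
Qed.

Lemma c0normZ a x : c0norm (a *: x) = `|a| * c0norm x.
Proof.
apply/eqP; rewrite eq_le c0normZ_le /=.
have [->|a0] := eqVneq a 0; first by rewrite normr0 mul0r c0norm_ge0.
have := c0normZ_le a^-1 (a *: x); rewrite scalerA mulVf // scale1r normfV.
by rewrite ler_pdivlMl ?normr_gt0.
Qed.

HB.instance Definition _ :=
  @Lmodule_isNormed.Build R c0sum c0norm c0normD c0normZ c0norm_eq0.

Lemma norm_ble x j : ble x j `|x|.
Proof. exact: c0norm_ble. Qed.

Lemma norm_le_ble x M : 0 <= M -> (forall j, ble x j M) -> `|x| <= M.
Proof. exact: c0norm_le. Qed.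

Lemma norm_coord x n : `|x n| <= `|x|.
Proof. exact: c0norm_coord. Qed.

Lemma c0sumB x y n : (x - y) n = x n - y n.
Proof. by []. Qed.

Section Limit.
Variables (F : set_system c0sum) (FF : ProperFilter F) (l : nat -> R^o).
Hypothesis Fl : forall n (e : R), 0 < e -> \forall y \near F, `|(y : c0sum) n - l n| < e.

Lemma near_block N (e : R) : 0 < e ->
  \forall y \near F, forall n, (n < N)%N -> `|(y : c0sum) n - l n| < e.
Proof.
move=> e0; elim: N => [|N IH]; first by apply: nearW => y n.
apply: filterS2 IH (Fl N e0) => y h1 h2 n; rewrite ltnS leq_eqVlt.
by case/orP => [/eqP ->//|]; exact: h1.
Qed.

(** On one block finitely many coordinates determine the norm up to a constant, so a member of the
    ball that is close to [l] in these coordinates may stand for [l]. *)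
Lemma ble_limit x (e : R) : F (ball x e) -> forall j, ble (fun n => x n - l n) j e.
Proof.
move=> Fx j; apply: (blk_le_closed bL_big) => d d0.
pose K : R := 2 ^+ (4 * bw j).+1.
have K0 : 0 < K by rewrite exprn_gt0.
have [y [xy hy]] := filter_ex (filterI Fx (near_block (4 * bst j.+1) (divr_gt0 d0 K0))).
have h1 : ble (fun n => x n - y n) j e.
  apply: blk_leW (norm_ble (x - y) j).
  by move: xy; rewrite -ball_normE /= => /ltW.
have h2 : ble (fun n => y n - l n) j d.
  have -> : d = K * (d / K) by rewrite mulrC divfK // gt_eqF.
  apply: blk_le_sup => [|i c /andP[_ i2] c4]; first by rewrite divr_ge0 // ltW.
  by apply/ltW/hy; lia.
by apply: eq_blk_le (blk_leD h1 h2) => i c _ _; ring.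
Qed.

End Limit.

Lemma c0_complete (F : set_system c0sum) : ProperFilter F -> cauchy F -> cvg F.
Proof.
move=> FF Fc.
have ex (e : R) : 0 < e -> exists x, F (ball x e).
  by move=> e0; have /cauchyP/(_ e e0) := Fc.
have cn n : cvg ((fun y : c0sum => y n) @ F).
  apply: cauchy_cvg; apply/cauchy_exP => e e0.
  have [x Fx] := ex e e0; exists (x n).
  have : F (fun y : c0sum => ball (x n) e (y n)); last by [].
  apply: filterS Fx => y; rewrite -!ball_normE /=; apply: le_lt_trans.
  exact: norm_coord (x - y) n.
pose l n : R^o := lim ((fun y : c0sum => y n) @ F).
have Fl n (e : R) : 0 < e -> \forall y \near F, `|(y : c0sum) n - l n| < e.
  move=> e0; have := cn n => /cvgrPdist_lt/(_ e e0).
  by apply: filterS => y; rewrite distrC.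
have lv : l \in c0pred.
  apply/c0predP => e e0; have e2 : 0 < e / 2 by rewrite divr_gt0.
  have [x Fx] := ex _ e2; have [J hJ] := c0_vanishing x e2.
  exists J => j /hJ h1; have h2 := blk_leZ (-1) (ble_limit FF Fl Fx j).
  rewrite normrN1 mul1r in h2; rewrite (splitr e).
  by apply: eq_blk_le (blk_leD h1 h2) => i c _ _; ring.
apply/cvg_ex; exists (C0sum lv); apply/cvgrPdist_lt => e e0.
have e2 : 0 < e / 2 by rewrite divr_gt0.
have [x Fx] := ex _ e2.
have h1 : `|x - C0sum lv| <= e / 2.
  by apply: norm_le_ble => [|j]; [exact: ltW|exact: (ble_limit FF Fl Fx)].
apply: filterS Fx => y; rewrite -ball_normE /= => h2.
rewrite -[C0sum lv](subrK x) -addrA (le_lt_trans (ler_normD _ _)) //.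
by rewrite (splitr e) ler_ltD // distrC.
Qed.

HB.instance Definition _ := Uniform_isComplete.Build c0sum c0_complete.

Lemma fin_vanishing (s : nat -> R^o) N : (forall n, (N <= n)%N -> s n = 0) ->
  s \in c0pred.
Proof.
move=> h; apply/c0predP => e e0; exists N => j Nj.
apply: (@eq_blk_le _ _ _ _ (fun=> 0)); last by apply: (blk_le0 bL_big); exact: ltW.
move=> i c /andP[i1 _] _; rewrite h //.
by have := bst_ge j; lia.
Qed.

Definition rat_c0 (s : seq rat) : c0sum :=
  C0sum (@fin_vanishing (fun n => ratr (nth 0 s n)) (size s)
    (fun n h => etrans (congr1 ratr (nth_default 0 h)) (raddf0 ratr))).

Lemma rat_c0E (s : seq rat) n : rat_c0 s n = ratr (nth 0 s n).
Proof. by []. Qed.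

Lemma c0_separable : exists D : set c0sum, countable D /\ dense D.
Proof.
exists (range rat_c0); split.
  apply: card_le_trans (card_image_le _ _) _; exact: countableP.
move=> O [x Ox] oO.
have /nbhs_ballP[e /= e0 xe] : nbhs x O by apply: open_nbhs_nbhs.
have e2 : 0 < e / 2 by rewrite divr_gt0.
have [J hJ] := c0_vanishing x e2.
(* Only blocks below [J] are approximated; there [bw j <= j < J], so [K] bounds the ratio of the
   block norm to the sup norm. *)
pose K : R := 2 ^+ (4 * J).+1.
have K0 : 0 < K by rewrite exprn_gt0.
have d0 : 0 < e / 2 / K by rewrite divr_gt0.
have /choice[q hq] : forall n, exists q : rat, `|x n - ratr q| <= e / 2 / K.
  move=> n; have lt : x n - e / 2 / K < x n + e / 2 / K by lra.
  have [q] := rat_in_itvoo lt; rewrite in_itv /= => /andP[q1 q2].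
  by exists q; rewrite ler_norml; lra.
pose s := mkseq q (4 * bst J).
exists (rat_c0 s); split; last by exists s.
apply: xe; rewrite -ball_normE /=.
apply: (@le_lt_trans _ _ (e / 2)); last by lra.
apply: norm_le_ble => [|j]; first exact: ltW.
case: (leqP J j) => jJ.
  apply: eq_blk_le (hJ j jJ) => i c /andP[i1 _] _.
  have := st_mono bst_rec jJ; rewrite c0sumB rat_c0E.
  move=> h; rewrite /s nth_default; last by rewrite size_mkseq; lia.
  by rewrite raddf0 subr0.
have h : ble (x - rat_c0 s) j (2 ^+ (4 * bw j).+1 * (e / 2 / K)).
  apply: blk_le_sup => [|i c /andP[_ i2] c4]; first exact: ltW.
  rewrite c0sumB rat_c0E /s nth_mkseq //.
  by have := st_mono bst_rec jJ; lia.
apply: blk_leW h; rewrite mulrCA ger_pMr // ler_pdivrMr // mul1r.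
by rewrite ler_weXn2l ?ler1n //; have := bw_le j; lia.
Qed.

End Space.

(** * The complex structures *)

Section Operators.
Variable R : realType.

Local Notation ble := (@blk_le R bw bL bst).
Local Notation X := (c0sum R).

Definition mk_op (T : X -> X) (Tl : linear T)
    (Tb : exists M : R, forall x, `|T x| <= M * `|x|) : bounded_op X :=
  SigSub (mem_set (conj Tl Tb) : (T : {ptws X -> X}) \in bounded_linear X).

Lemma op_linear (A : bounded_op X) : linear (A : X -> X).
Proof. by have [] := set_valP A. Qed.

Lemma op_bound (A : bounded_op X) : exists M : R, forall x, `|A x| <= M * `|x|.
Proof. by have [] := set_valP A. Qed.

Definition blk i := sval (cid (inb_all i)).

Lemma blkP i : inb bst (blk i) i.
Proof. by rewrite /blk; case: cid. Qed.

Lemma blkE j i : inb bst j i -> blk i = j.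
Proof. by move=> ij; exact: (inb_uniq bst_rec (blkP i) ij). Qed.

Section BlockOperator.
Variables (T : (nat -> R^o) -> (nat -> R^o)) (C : R).
Hypothesis C0 : 0 <= C.
Hypothesis Tl : forall a x y n, T (fun k => a * x k + y k) n = a * T x n + T y n.
Hypothesis Tb : forall x j M, 0 <= M -> ble x j M -> ble (T x) j (C * M).

Lemma blockop_vanishing (x : X) : T x \in @c0pred R.
Proof.
apply/c0predP => e e0; have C1 : 0 < C + 1 by rewrite ltr_wpDl.
have [J hJ] := c0_vanishing x (divr_gt0 e0 C1).
exists J => j /hJ h; apply: blk_leW (Tb _ h); last by rewrite ltW // divr_gt0.
by rewrite mulrA ler_pdivrMr // mulrC ler_wpM2l ?(ltW e0) // lerDl.
Qed.

Definition blockfun (x : X) : X := C0sum (blockop_vanishing x).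

Lemma blockfun_linear : linear blockfun.
Proof. by move=> a x y; apply: val_inj; apply/funext => n; exact: Tl. Qed.

Lemma blockfun_bounded : exists M : R, forall x, `|blockfun x| <= M * `|x|.
Proof.
exists C => x; apply: norm_le_ble => [|j]; first by rewrite mulr_ge0.
by apply: Tb => //; exact: norm_ble.
Qed.

Definition blockop := mk_op blockfun_linear blockfun_bounded.

End BlockOperator.

Definition sgnb (e : bool) : R := if e then 1 else -1.

Definition rot (eps : nat -> bool) (x : nat -> R^o) (n : nat) : R^o :=
  if odd n then sgnb (eps (blk (n %/ 4))) * x n.-1
  else - (sgnb (eps (blk (n %/ 4))) * x n.+1).

Lemma norm_sgnb e : `|sgnb e| = 1.
Proof. by case: e; rewrite /sgnb ?normrN normr1. Qed.

Lemma sgnb_sq e : sgnb e * sgnb e = 1.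
Proof. by case: e; rewrite /sgnb ?mulrNN mulr1. Qed.

Lemma rotE eps x i c : (c < 4)%N -> rot eps x (4 * i + c)%N =
  if odd c then sgnb (eps (blk i)) * x (4 * i + c).-1
  else - (sgnb (eps (blk i)) * x (4 * i + c).+1).
Proof. by move=> c4; rewrite /rot divq // oddD oddM. Qed.

(** Each [psi r] consists of the two parts of a complex linear functional, which multiplication by
    [i] or [-i] exchanges up to sign. This is why the block norm is compatible with every choice of
    signs. *)
Lemma psi_rot eps x r e i :
  `|psi r e (rot eps x) i| = `|psi r (e == 0%N) x i|.
Proof.
have E c : rot eps x (4 * i + c)%N = rot eps x (4 * i + c)%N by [].
set s := sgnb (eps (blk i)).
have -> : `|psi r (e == 0%N) x i| = `|s * psi r (e == 0%N) x i|.
  by rewrite normrM norm_sgnb mul1r.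
have e0 : rot eps x (4 * i + 0)%N = - (s * x (4 * i + 1)%N) by rewrite rotE //= addn0 addn1.
have e1 : rot eps x (4 * i + 1)%N = s * x (4 * i + 0)%N by rewrite rotE //= addn0 addn1.
have e2 : rot eps x (4 * i + 2)%N = - (s * x (4 * i + 3)%N).
  by rewrite rotE //= -addnS.
have e3 : rot eps x (4 * i + 3)%N = s * x (4 * i + 2)%N by rewrite rotE //= addnS.
case: r => [|[|[|r]]]; case: e => [|e] /=; rewrite ?e0 ?e1 ?e2 ?e3 ?normrN //.
- by rewrite -normrN; congr `|_|; ring.
- by congr `|_|; ring.
- by rewrite -normrN; congr `|_|; ring.
- by congr `|_|; ring.
Qed.

Lemma rot_lin eps a x y n :
  rot eps (fun k => a * x k + y k) n = a * rot eps x n + rot eps y n.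
Proof. by rewrite /rot; case: ifP => _; ring. Qed.

Lemma rot_ble eps x j M : 0 <= M -> ble x j M -> ble (rot eps x) j (1 * M).
Proof.
rewrite mul1r => M0 [h1 h2]; split=> [i c ij c4|r e s Q rs uQ aQ sQ].
  rewrite (psi_coord _ _ c4) psi_rot.
  have -> : psi c./2 (nat_of_bool (nat_of_bool (odd c) == 0%N)) x i =
    x (4 * i + (if odd c then c.-1 else c.+1))%N.
    by case: c c4 => [|[|[|[|]]]].
  by apply: h1 => //; case: c c4 => [|[|[|[|]]]].
under eq_bigr do rewrite psi_rot.
exact: h2.
Qed.

Definition Jop eps : bounded_op X :=
  blockop ler01 (rot_lin eps) (@rot_ble eps).

Lemma Jop_sq eps x : Jop eps (Jop eps x) = - x.
Proof.
apply: val_inj; apply/funext => n.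
change (rot eps (rot eps x) n = - x n); rewrite /rot.
have [odn|odn] := boolP (odd n).
  have en : n = (n.-1).+1 by case: n odn.
  have -> : odd n.-1 = false by move: odn; rewrite {1}en /= => /negbTE.
  have -> : (n.-1 %/ 4 = n %/ 4)%N by lia.
  by rewrite mulrN mulrA sgnb_sq mul1r -en.
rewrite /= odn /=.
have -> : (n.+1 %/ 4 = n %/ 4)%N by lia.
by rewrite mulrA sgnb_sq mul1r.
Qed.

Definition Jcs eps : complex_structure X :=
  SigSub (mem_set (Jop_sq eps : complex_structures (Jop eps))).

(** Complex conjugation on the blocks selected by [d]; the imaginary parts sit at the odd
    positions. *)
Definition flip (d : nat -> bool) (x : nat -> R^o) (n : nat) : R^o :=
  if d (blk (n %/ 4)) && odd n then - x n else x n.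

Lemma flip_lin d a x y n :
  flip d (fun k => a * x k + y k) n = a * flip d x n + flip d y n.
Proof. by rewrite /flip; case: ifP => _; ring. Qed.

Section Flip.
Variables (d : nat -> bool) (N : nat).
Hypothesis dN : forall j, d j -> (bw j <= N)%N.

(** Conjugation does not preserve the kernel of [psi 3], so the block norm is merely compared with
    the sup norm, at a cost that depends only on [bw j]. *)
Lemma flip_ble x j M : 0 <= M -> ble x j M ->
  ble (flip d x) j (2 ^+ (4 * N).+1 * M).
Proof.
move=> M0 hx; have p : 1 <= 2 ^+ (4 * N).+1 :> R by rewrite exprn_ege1 // ler1n.
have [dj|dj] := boolP (d j).
  apply: (@blk_leW _ _ _ _ _ _ (2 ^+ (4 * bw j).+1 * M)).
    by rewrite ler_wpM2r // ler_weXn2l ?ler1n // ltnS leq_mul2l dN.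
  apply: blk_le_sup => // i c ij c4; have [h _] := hx.
  by rewrite /flip; case: ifP => _; rewrite ?normrN h.
apply: (@blk_leW _ _ _ _ _ _ M); first by rewrite ler_peMl.
apply: eq_blk_le hx => i c ij c4.
by rewrite /flip divq // (blkE ij) (negbTE dj).
Qed.

Definition flipop : bounded_op X :=
  blockop (exprn_ge0 _ (ler0n R 2)) (flip_lin d) flip_ble.

Lemma flipopK : cancel flipop flipop.
Proof.
move=> x; apply: val_inj; apply/funext => n.
change (flip d (flip d x) n = x n).
by rewrite /flip; case: (_ && _) => //; exact: opprK.
Qed.

Lemma flip_iso e e' : (forall j, d j = (e j != e' j)) -> cs_iso X (Jcs e) (Jcs e').
Proof.
move=> de; exists flipop, flipop; split; [exact: flipopK|exact: flipopK|].
move=> x; apply: val_inj; apply/funext => n.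
change (flip d (rot e (flip d x)) n = rot e' x n); rewrite /flip /rot.
have [odn|odn] := boolP (odd n).
  have en : n = (n.-1).+1 by case: n odn.
  have -> : odd n.-1 = false by move: odn; rewrite {1}en /= => /negbTE.
  by rewrite andbF andbT de; case: (e _); case: (e' _) => //=; rewrite ?mulN1r ?mul1r ?opprK.
rewrite /= odn andbF andbT.
have -> : (n.+1 %/ 4 = n %/ 4)%N by lia.
by rewrite de; case: (e _); case: (e' _) => //=; rewrite ?mulN1r ?mul1r ?opprK.
Qed.

End Flip.
End Operators.

(** * Isomorphic structures agree on all blocks of large distortion *)

Section Rigid.
Variable R : realType.

Local Notation ble := (@blk_le R bw bL bst).
Local Notation X := (c0sum R).
Local Notation coords := (coords bst).

Lemma cut_vanishing (s : nat -> R^o) N :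
  (fun n => if (n < N)%N then s n else 0) \in @c0pred R.
Proof. by apply: (@fin_vanishing _ _ N) => n; rewrite ltnNge => ->. Qed.

Definition cut (s : nat -> R^o) N : X := C0sum (cut_vanishing s N).

Lemma cutE s N n : cut s N n = if (n < N)%N then s n else 0.
Proof. by []. Qed.

Definition basis m : X := cut (fun n => (n == m)%:R) m.+1.

Lemma basisE m n : basis m n = (n == m)%:R.
Proof. by rewrite cutE; case: (ltngtP n m.+1) => //; case: eqP => //; lia. Qed.

Lemma sum_seqE (I : Type) (r : seq I) (P : pred I) (F : I -> X) n :
  (\sum_(i <- r | P i) F i) n = \sum_(i <- r | P i) F i n.
Proof. by elim/big_rec2: _ => // i y1 y2 _ <-. Qed.

Lemma op0 (A : bounded_op X) : A 0 = 0.
Proof. by have := op_linear A (-1) 0 0; rewrite scaler0 addr0 scaleN1r addNr. Qed.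

Lemma op_sum (A : bounded_op X) (I : Type) (r : seq I) (a : I -> R) (F : I -> X) :
  A (\sum_(i <- r) a i *: F i) = \sum_(i <- r) a i *: A (F i).
Proof.
elim: r => [|i r IH].
  by rewrite !big_nil op0.
by rewrite !big_cons op_linear IH.
Qed.

Lemma opZ (A : bounded_op X) a x : A (a *: x) = a *: A x.
Proof.
by have := op_linear A a x 0; rewrite op0 !addr0.
Qed.

Lemma op_sub (A : bounded_op X) x y : A (x - y) = A x - A y.
Proof. by have := op_linear A (-1) y x; rewrite !scaleN1r ![- _ + _]addrC. Qed.

Lemma cut_sum (y : nat -> R^o) N : cut y N = \sum_(0 <= m < N) y m *: basis m.
Proof.
apply: val_inj; apply/funext => n; rewrite [RHS]sum_seqE [LHS]cutE.
case: ltnP => nJ.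
  rewrite (bigD1_seq n) ?mem_index_iota ?iota_uniq //= big1 ?addr0.
    by change (y n = y n * basis n n); rewrite basisE eqxx mulr1.
  move=> m /negbTE mn; change (y m * basis m n = 0).
  by rewrite basisE eq_sym mn mulr0.
rewrite big_nat big1 // => m /andP[_ mJ]; change (y m * basis m n = 0).
by rewrite basisE; case: eqP => [nm|_]; [lia|rewrite mulr0].
Qed.

Section Pair.
Variables (A A' : bounded_op X) (C : R) (e e' : nat -> bool).
Hypothesis A'A : cancel A A'.
Hypothesis AJ : forall x, A (Jcs R e x) = Jcs R e' (A x).
Hypothesis C1 : 1 <= C.
Hypothesis hA : forall x, `|A x| <= C * `|x|.
Hypothesis hA' : forall x, `|A' x| <= C * `|x|.

(** The columns of [A] from block [j] and the rows of [A'] into block [j] form the matrices [al] and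
    [be]. If the signs at [j] differ, the intertwining relation gives the diagonal block of [al] the
    antilinear pattern that [antilinear_block] excludes. *)
Lemma rigid_pair j : 2 ^+ 20 * C ^+ 2 <= 2 ^+ bw j -> e j = e' j.
Proof.
move=> Cj; apply: contrapT => /eqP ej.
have C0 : 0 <= C by apply: le_trans C1.
pose al m n := A (basis n) m.
pose be n m := A' (basis m) n.
(* Keeping only the blocks below [J] costs [1 / (2 C)], hence at most [1 / 2] after [A'] is applied,
   so the diagonal entries of the truncated product remain at least [1 / 2]. *)
have [J [jJ hJ]] : exists J, (j < J)%N /\ forall n, n \in coords j ->
    `|A (basis n) - cut (A (basis n)) (4 * bst J)| <= (2 * C)^-1.
  have C2 : 0 < (2 * C)^-1 by rewrite invr_gt0 mulr_gt0 // (lt_le_trans ltr01).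
  have tail n : exists J0, forall J, (J0 <= J)%N ->
     `|A (basis n) - cut (A (basis n)) (4 * bst J)| <= (2 * C)^-1.
    have [J0 h] := c0_vanishing (A (basis n)) C2; exists J0 => J JJ.
    apply: norm_le_ble => [|k]; first exact: ltW.
    have [Jk|kJ] := leqP J k.
      apply: eq_blk_le (h k (leq_trans JJ Jk)) => i c /andP[i1 _] c4.
      rewrite c0sumB cutE ifN ?subr0 //.
      by have := st_mono bst_rec Jk; lia.
    have z0 : ble (fun=> 0) k (2 * C)^-1 by apply: (blk_le0 bL_big); exact: ltW.
    apply: eq_blk_le z0 => i c /andP[_ i2] c4; rewrite c0sumB cutE ifT ?subrr //.
    by have := st_mono bst_rec kJ; lia.
  have [J hJ] : exists J, forall n, n \in coords j -> forall J', (J <= J')%N ->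
      `|A (basis n) - cut (A (basis n)) (4 * bst J')| <= (2 * C)^-1.
    elim: (coords j) => [|n s [J IH]]; first by exists 0%N.
    have [J0 h] := tail n; exists (maxn J J0) => m; rewrite inE => /orP[/eqP -> |ms] J'.
      by rewrite geq_max => /andP[_]; exact: h.
    by rewrite geq_max => /andP[h' _]; exact: IH.
  exists (maxn J j.+1); split; first by rewrite leq_max leqnn orbT.
  by move=> n /hJ; apply; rewrite leq_maxl.
have sg : sgnb R (e j) * sgnb R (e' j) = -1.
  by move: ej; case: (e j); case: (e' j) => //= _; rewrite /sgnb ?mul1r ?mulr1.
have Jb q : inb bst j (q %/ 2) ->
    Jcs R e (basis (2 * q)%N) = sgnb R (e j) *: basis (2 * q).+1.
  move=> qj; apply: val_inj; apply/funext => n.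
  change (rot e (basis (2 * q)%N) n = sgnb R (e j) * basis (2 * q).+1 n).
  rewrite /rot !basisE; have [odn|odn] := boolP (odd n).
    have en : n = n.-1.+1 by case: n odn.
    rewrite {3}en eqSS; case: eqP => [nq|_]; last by rewrite !mulr0.
    have -> : (n %/ 4 = q %/ 2)%N by lia.
    by rewrite (blkE qj).
  have -> : (n.+1 == (2 * q)%N) = false by apply/eqP; lia.
  have -> : (n == (2 * q).+1) = false by apply/eqP; lia.
  by rewrite !mulr0 oppr0.
have A_odd q : inb bst j (q %/ 2) ->
    A (basis (2 * q).+1) = sgnb R (e j) *: Jcs R e' (A (basis (2 * q)%N)).
  by move=> qj; rewrite -AJ (Jb q qj) opZ scalerA sgnb_sq scale1r.
(* As the two signs are opposite, the scaled structure is multiplication by [-i] on block [j], while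
   the column [2 q + 1] arises from the column [2 q] by multiplication by [i] in the source. *)
have rotS (x : X) p : inb bst j (p %/ 2) ->
   (sgnb R (e j) *: Jcs R e' x) (2 * p)%N = x (2 * p).+1 /\
   (sgnb R (e j) *: Jcs R e' x) (2 * p).+1 = - x (2 * p)%N.
  move=> pj; change (sgnb R (e j) * rot e' x (2 * p)%N = x (2 * p).+1 /\
    sgnb R (e j) * rot e' x (2 * p).+1 = - x (2 * p)%N).
  rewrite /rot /= oddM /=.
  have -> : ((2 * p) %/ 4 = p %/ 2)%N by lia.
  have -> : ((2 * p).+1 %/ 4 = p %/ 2)%N by lia.
  by rewrite (blkE pj) mulrN !mulrA sg !mulN1r opprK.
apply: (@antilinear_block R bw bL bst bL_big erefl bst_rec bL_net j J al be C) => //.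
- move=> x t t0 hx k kJ.
  pose Y : X := \sum_(n <- coords j) x n *: basis n.
  have YE n : Y n = if n \in coords j then x n else 0.
    rewrite /Y sum_seqE.
    have [nj|nj] := boolP (n \in coords j).
      rewrite (bigD1_seq n) ?iota_uniq //= big1 ?addr0.
        by change (x n * basis n n = x n); rewrite basisE eqxx mulr1.
      move=> m /negbTE mn; change (x m * basis m n = 0).
      by rewrite basisE eq_sym mn mulr0.
    rewrite big_seq big1 // => m mj; change (x m * basis m n = 0).
    rewrite basisE; case: eqP => [nm|_]; last by rewrite mulr0.
    by rewrite nm mj in nj.
  have Yt : `|Y| <= t.
    apply: norm_le_ble => // l; have [->|lj] := eqVneq l j.
      apply: eq_blk_le hx => i c ij c4.
      by rewrite YE mem_coords divq // ij.
    have z0 : ble (fun=> 0) l t by exact: (blk_le0 bL_big).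
    apply: eq_blk_le z0 => i c il c4; rewrite YE mem_coords divq //.
    case: ifP => // ij; by rewrite (inb_uniq bst_rec il ij) eqxx in lj.
  have : ble (A Y) k (C * t).
    apply: blk_leW (norm_ble (A Y) k); apply: (le_trans (hA Y)).
    by rewrite ler_wpM2l.
  apply: eq_blk_le => i c _ _; rewrite /opA /dot /Y op_sum sum_seqE.
  by apply: eq_bigr => n _; exact: mulrC.
- move=> y t t0 hy.
  pose Y : X := cut y (4 * bst J).
  have YS : Y = \sum_(0 <= m < 4 * bst J) y m *: basis m.
    exact: cut_sum.
  have Yt : `|Y| <= t.
    apply: norm_le_ble => // k; have [Jk|kJ] := leqP J k.
      have z0 : ble (fun=> 0) k t by exact: (blk_le0 bL_big).
      apply: eq_blk_le z0 => i c /andP[i1 _] c4; rewrite cutE ifN //.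
      by have := st_mono bst_rec Jk; lia.
    apply: eq_blk_le (hy k kJ) => i c /andP[_ i2] c4; rewrite cutE ifT //.
    by have := st_mono bst_rec kJ; lia.
  have : ble (A' Y) j (C * t).
    apply: blk_leW (norm_ble (A' Y) j); apply: (le_trans (hA' Y)).
    by rewrite ler_wpM2l.
  apply: eq_blk_le => i c _ _; rewrite YS op_sum sum_seqE.
  by apply: eq_bigr => n _; exact: mulrC.
- by move=> p q pj qj; rewrite /al (A_odd q qj); exact: (rotS _ _ pj).1.
- by move=> p q pj qj; rewrite /al (A_odd q qj); exact: (rotS _ _ pj).2.
- move=> n nj; have nb := hJ n nj.
  have E : \sum_(0 <= m < 4 * bst J) be n m * al m n =
      A' (cut (A (basis n)) (4 * bst J)) n.
    rewrite cut_sum op_sum sum_seqE; apply: eq_bigr => m _; exact: mulrC.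
  have := norm_coord (A' (A (basis n) - cut (A (basis n)) (4 * bst J))) n.
  move=> /le_trans/(_ (hA' _))/le_trans/(_ (ler_wpM2l C0 nb)).
  rewrite op_sub A'A c0sumB basisE eqxx -E invfM mulrCA mulfV ?mulr1; last first.
    by rewrite gt_eqF // (lt_le_trans ltr01).
  rewrite ler_norml => /andP[_]; rewrite mulr1n; lra.
Qed.

End Pair.

Lemma cs_iso_rigid (e e' : nat -> bool) : cs_iso X (Jcs R e) (Jcs R e') ->
  exists n, forall j, (n <= bw j)%N -> e j = e' j.
Proof.
move=> [A [A' [AK A'K AJ]]].
have [M1 h1] := op_bound A; have [M2 h2] := op_bound A'.
pose C := 1 + `|M1| + `|M2|.
have C1 : 1 <= C by rewrite /C -addrA lerDl addr_ge0.
have h1C x : `|A x| <= C * `|x|.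
  apply: (le_trans (h1 x)); rewrite ler_wpM2r // (le_trans (ler_norm _)) //.
  by rewrite /C addrAC lerDr addr_ge0.
have h2C x : `|A' x| <= C * `|x|.
  apply: (le_trans (h2 x)); rewrite ler_wpM2r // (le_trans (ler_norm _)) //.
  by rewrite /C lerDr addr_ge0.
have AJ' x : A (Jcs R e x) = Jcs R e' (A x) by rewrite -AJ AK.
have [n hn] : exists n, 2 ^+ 20 * C ^+ 2 <= 2 ^+ n.
  exists (Num.truncn (2 ^+ 20 * C ^+ 2)).+1.
  apply: ltW; apply: (lt_le_trans (truncnS_gt _)).
  by rewrite -[in leRHS]natrX ler_nat ltnW // ltn_expl.
exists n => j nj; apply: (rigid_pair AK AJ' C1 h1C h2C).
by apply: (le_trans hn); rewrite ler_weXn2l // ler1n.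
Qed.

End Rigid.

(** * Reduction of E_1 *)

Section BorelSets.
Variable T : topologicalType.

Lemma borel_open (U : set T) : open U -> borel T U.
Proof. exact: sub_sigma_algebra. Qed.

Lemma borelC (U : set T) : borel T U -> borel T (~` U).
Proof.
have [_ h _] := smallest_sigma_algebra setT (@open T) => /h.
by rewrite setTD.
Qed.

Lemma borel_bigcup (U : nat -> set T) : (forall i, borel T (U i)) ->
  borel T (\bigcup_i U i).
Proof. by have [_ _ h] := smallest_sigma_algebra setT (@open T) => /h. Qed.

Lemma borelI (U V : set T) : borel T U -> borel T V -> borel T (U `&` V).
Proof.
move=> bU bV; rewrite -[_ `&` _]setCK setCI -bigcup2E; apply: borelC; apply: borel_bigcup.
by move=> [|[|i]] /=; [exact: borelC|exact: borelC|apply: borel_open; exact: open0].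
Qed.

Lemma borel_preimage (S : topologicalType) (f : T -> S) :
  (forall U, open U -> borel T (f @^-1` U)) ->
  forall B, borel S B -> borel T (f @^-1` B).
Proof.
move=> h B; apply: (@smallest_sub _ _ _ [set B | borel T (f @^-1` B)]) B => //.
split=> /=.
- by rewrite preimage_set0; (apply: borel_open; exact: open0).
- by move=> A hA; rewrite setTD preimage_setC; exact: borelC.
- by move=> A hA; rewrite preimage_bigcup; exact: borel_bigcup.
Qed.

End BorelSets.

Section Reduction.
Variable R : realType.

Local Notation ble := (@blk_le R bw bL bst).
Local Notation X := (c0sum R).

Definition qnat k : rat := odflt 0 (unpickle k).

(** The power of 2 in [j.+1] names the coordinate and its odd part [2 k + 1] the rational number
    compared with it. *)
Definition code (x : {ptws nat -> R}) (j : nat) : bool :=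
  ratr (qnat ((j.+1 %/ 2 ^ bw j)./2)) < (x (bw j) : R).

Lemma code_index n q : exists j, bw j = n /\ qnat ((j.+1 %/ 2 ^ bw j)./2) = q.
Proof.
pose k := pickle q; exists (2 ^ n * (2 * k).+1).-1.
have p : (0 < 2 ^ n * (2 * k).+1)%N by rewrite muln_gt0 expn_gt0.
have -> : bw (2 ^ n * (2 * k).+1).-1 = n.
  rewrite /bw prednK // lognM ?expn_gt0 // pfactorK // lognE /= dvdn2 /= oddM /=.
  by rewrite addn0.
split=> //; rewrite prednK // mulKn ?expn_gt0 // /qnat.
have -> : ((2 * k).+1)./2 = k by lia.
by rewrite pickleK.
Qed.

Lemma code_inj x y n : (forall j, (n <= bw j)%N -> code x j = code y j) ->
  forall m, (n <= m)%N -> x m = y m.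
Proof.
have main (x' y' : {ptws nat -> R}) m : (forall j, (n <= bw j)%N -> code x' j = code y' j) ->
    (n <= m)%N -> ~ ((x' m : R) < (y' m : R)).
  move=> h nm lt; have [q] := rat_in_itvoo lt; rewrite in_itv /= => /andP[q1 q2].
  have [j [bj qj]] := code_index m q; rewrite bj in qj.
  have := h j; rewrite /code bj qj => /(_ nm); rewrite q2.
  by rewrite ltNge (ltW q1).
move=> h m nm; case: (ltgtP (x m : R) (y m : R)) => // lt; exfalso.
  exact: (main x y m h nm).
by apply: (main y x m _ nm lt) => j nj; rewrite h.
Qed.

Definition red (x : {ptws nat -> R}) : complex_structure X := Jcs R (code x).

Lemma red_E1 x y : E1 x y <-> cs_iso X (red x) (red y).
Proof.
split=> [[n h]|/cs_iso_rigid[n /code_inj h]]; last by exists n.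
apply: (@flip_iso R (fun j => code x j != code y j) n) => // j.
apply: contraR; rewrite -ltnNge => nj.
by rewrite /code h // ltnW.
Qed.

(** The structure depends continuously on the signs in the strong operator topology: the far blocks
    of a fixed [x] are small, and no [rot e] increases block norms, so only finitely many signs
    matter. *)
Lemma Jop_cvg (e : nat -> bool) (U : set (bounded_op X)) : open U -> U (Jop R e) ->
  exists N, forall e', (forall j, (j < N)%N -> e' j = e j) -> U (Jop R e').
Proof.
case=> V oV <- Ve; apply: contrapT => /forallNP hn.
have /choice[es hes] : forall N, exists e', (forall j, (j < N)%N -> e' j = e j) /\
    ~ (set_val @^-1` V) (Jop R e').
  move=> N; have := hn N => /existsNP[e' /not_implyP[h1 h2]].
  by exists e'.
pose u N : {ptws X -> X} := set_val (Jop R (es N)).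
have cu : u @ \oo --> (set_val (Jop R e) : {ptws X -> X}).
  apply/(@pointwise_cvgP X X) => x; apply/cvgrPdist_le => d d0.
  have d2 : 0 < d / 2 by rewrite divr_gt0.
  have [J hJ] := c0_vanishing x d2.
  exists J => // N /= JN.
  change (`|Jop R e x - Jop R (es N) x| <= d).
  apply: norm_le_ble => [|j]; first exact: ltW.
  have [jN|Nj] := ltnP j N.
    have z0 : ble (fun=> 0) j d by apply: (blk_le0 bL_big); exact: ltW.
    apply: eq_blk_le z0 => i c ij c4; rewrite c0sumB.
    change (0 = rot e x (4 * i + c)%N - rot (es N) x (4 * i + c)%N).
    by rewrite !rotE // (blkE ij) (hes N).1 // subrr.
  have h := hJ j (leq_trans JN Nj).
  have h1 := rot_ble e (ltW d2) h; have h2 := rot_ble (es N) (ltW d2) h.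
  rewrite !mul1r in h1 h2.
  have := blk_leB h1 h2; rewrite -splitr.
  by apply: eq_blk_le.
have /cu [N _ hN] : nbhs (set_val (Jop R e) : {ptws X -> X}) V by exact: open_nbhs_nbhs.
by have [_] := hes N; apply; apply: (hN N) => /=.
Qed.

Lemma borel_code (j : nat) (c : bool) : borel {ptws nat -> R} [set x | code x j = c].
Proof.
have op : borel {ptws nat -> R} [set x | code x j].
  apply: borel_open; rewrite /code; set q := ratr _.
  have := @open_comp _ _ (fun x : {ptws nat -> R} => x (bw j)) [set t : R | q < t].
  apply; last exact: open_gt.
  move=> x _; exact: (@proj_continuous nat (fun=> R) (bw j) x).
case: c => //.
have -> : [set x | code x j = false] = ~` [set x : {ptws nat -> R} | code x j].
  by apply/seteqP; split=> x /=; [move=> ->|move=> /negP/negbTE].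
exact: borelC.
Qed.

Lemma borel_word (w : seq bool) :
  borel {ptws nat -> R} [set x | forall j, (j < size w)%N -> code x j = nth false w j].
Proof.
suff h n : borel {ptws nat -> R} [set x | forall j, (j < n)%N -> code x j = nth false w j].
  exact: h.
elim: n => [|n IH].
  rewrite (_ : [set x | _] = setT); first (apply: borel_open; exact: openT).
  by apply/seteqP; split.
rewrite (_ : [set x | _] = [set x : {ptws nat -> R} | forall j, (j < n)%N ->
    code x j = nth false w j] `&` [set x | code x n = nth false w n]).
  by apply: borelI IH (borel_code _ _).
apply/seteqP; split=> x /= h.
  by split=> [j jn|]; apply: h => //; exact: ltnW.
move=> j; rewrite ltnS leq_eqVlt => /orP[/eqP ->|]; first by case: h.
by case: h => h _; exact: h.
Qed.

(** By [Jop_cvg], membership in an open set is witnessed by a finite initial word of the code. There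
    are countably many words, and each determines a Borel set of sequences. *)
Lemma red_borel B : borel_cs X B -> borel {ptws nat -> R} (red @^-1` B).
Proof.
case=> B0 bB0 <-.
apply: (@borel_preimage _ _ (fun x => op_of_cs (red x)) _ B0 bB0) => U oU.
pose P w := forall e, (forall j, (j < size w)%N -> e j = nth false w j) -> U (Jop R e).
pose W n := if unpickle n is Some w then
  (if `[< P w >] then
    [set x : {ptws nat -> R} | forall j, (j < size w)%N -> code x j = nth false w j]
   else set0) else set0.
rewrite (_ : _ @^-1` U = \bigcup_n W n).
  apply: borel_bigcup => n; rewrite /W; case: unpickle => [w|]; last (apply: borel_open; exact: open0).
  by case: ifP => _; [exact: borel_word|(apply: borel_open; exact: open0)].
apply/seteqP; split=> x /=.
  move=> Ux; have [N hN] := Jop_cvg oU (Ux : U (Jop R (code x))).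
  pose w := mkseq (code x) N; exists (pickle w) => //; rewrite /W pickleK.
  have -> : `[< P w >] = true.
    apply/asboolP => e he; apply: hN => j jN.
    by rewrite he ?size_mkseq // nth_mkseq.
  by move=> j; rewrite size_mkseq => jN; rewrite nth_mkseq.
case=> n _; rewrite /W; case: unpickle => // w; case: asboolP => // Pw h.
exact: Pw.
Qed.

Theorem E1_reducible : borel_reducible (borel {ptws nat -> R}) (borel_cs X)
  (@E1 R) (cs_iso X).
Proof. by exists red; split; [exact: red_borel|exact: red_E1]. Qed.

End Reduction.

(** * Category in the space of real sequences *)

Section Cylinders.
Variable R : realType.
Local Notation Q := (nat -> R).
Implicit Types (p q : Q) (O U S : set Q).

(* A countably based description of the product topology of [nat -> R]: the
   cylinders [cyl q m] form a decreasing neighbourhood base of [q]. *)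
Definition cyl q m : set Q := [set p | forall i, (i < m)%N -> `|p i - q i| < m.+1%:R^-1].
Definition ccyl q m : set Q := [set p | forall i, (i < m)%N -> `|p i - q i| <= m.+1%:R^-1].

Definition copen O := forall q, O q -> exists m, cyl q m `<=` O.

Lemma radius_gt0 m : 0 < m.+1%:R^-1 :> R.
Proof. by rewrite invr_gt0. Qed.

Lemma radius_le m n : (m <= n)%N -> n.+1%:R^-1 <= m.+1%:R^-1 :> R.
Proof. by move=> mn; rewrite lef_pV2 ?posrE // ler_nat. Qed.

Lemma radius_lt m n : (m < n)%N -> n.+1%:R^-1 < m.+1%:R^-1 :> R.
Proof. by move=> mn; rewrite ltf_pV2 ?posrE // ltr_nat. Qed.

Lemma exists_radius (e : R) : 0 < e -> exists m, m.+1%:R^-1 < e.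
Proof.
move=> e0; exists (Num.truncn e^-1); rewrite -[ltRHS]invrK ltf_pV2 ?posrE ?invr_gt0 //.
exact: truncnS_gt.
Qed.

Lemma cyl_refl q m : cyl q m q.
Proof. by move=> i _; rewrite subrr normr0 radius_gt0. Qed.

Lemma cyl_sub q m n : (m <= n)%N -> cyl q n `<=` cyl q m.
Proof.
move=> mn p h i im; apply: lt_le_trans (h i (leq_trans im mn)) _.
exact: radius_le.
Qed.

Lemma ccyl_cyl q m n : (m < n)%N -> ccyl q n `<=` cyl q m.
Proof.
move=> mn p h i im; apply: le_lt_trans (h i (ltn_trans im mn)) _.
exact: radius_lt.
Qed.

Lemma cyl_ccyl q m : cyl q m `<=` ccyl q m.
Proof. by move=> p h i im; apply/ltW/h. Qed.

Lemma copen_cyl q m : copen (cyl q m).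
Proof.
move=> p hp.
have [n hn] : exists n, forall i, (i < m)%N -> n.+1%:R^-1 <= m.+1%:R^-1 - `|p i - q i|.
  have : forall k, (k <= m)%N -> exists n, forall i, (i < k)%N ->
      n.+1%:R^-1 <= m.+1%:R^-1 - `|p i - q i|.
    elim=> [|k IH] km; first by exists 0%N.
    have [n hn] := IH (ltnW km).
    have h0 : 0 < m.+1%:R^-1 - `|p k - q k| by rewrite subr_gt0 hp.
    have [n' hn'] := exists_radius h0.
    exists (maxn n n') => i; rewrite ltnS leq_eqVlt => /orP[/eqP ->|ik].
      by apply: le_trans (ltW hn'); rewrite radius_le // leq_maxr.
    by apply: le_trans (hn i ik); rewrite radius_le // leq_maxl.
  by move=> /(_ m (leqnn m)).
exists (maxn n m) => x hx i im.
have h1 := hx i (leq_trans im (leq_maxr n m)).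
have h2 : (maxn n m).+1%:R^-1 <= m.+1%:R^-1 - `|p i - q i|.
  by apply: le_trans (hn i im); rewrite radius_le // leq_maxl.
have := ler_normD (x i - p i) (p i - q i); rewrite addrA subrK => h3.
by apply: (le_lt_trans h3); rewrite -ltrBrDr (lt_le_trans h1).
Qed.

Lemma copenT : copen setT.
Proof. by move=> q _; exists 0%N. Qed.

Lemma copenI O U : copen O -> copen U -> copen (O `&` U).
Proof.
move=> hO hU q [Oq Uq]; have [m hm] := hO q Oq; have [n hn] := hU q Uq.
exists (maxn m n) => p hp; split.
  by apply: hm; apply: cyl_sub hp; rewrite leq_maxl.
by apply: hn; apply: cyl_sub hp; rewrite leq_maxr.
Qed.

Lemma copen_bigcup (I : Type) (P : set I) (F : I -> set Q) :
  (forall i, P i -> copen (F i)) -> copen (\bigcup_(i in P) F i).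
Proof.
move=> hF q [i Pi Fq]; have [m hm] := hF i Pi q Fq.
by exists m => p /hm hp; exists i.
Qed.

Lemma copenU O U : copen O -> copen U -> copen (O `|` U).
Proof.
move=> hO hU q [/hO|/hU] [m hm]; exists m => p /hm; [by left|by right].
Qed.

Lemma copen_shrink O q N : copen O -> O q -> exists2 m, (N <= m)%N & ccyl q m `<=` O.
Proof.
move=> hO /hO[m hm]; exists (maxn N m.+1); first exact: leq_maxl.
move=> p hp; apply: hm; apply: ccyl_cyl hp.
by rewrite leq_max leqnn orbT.
Qed.

Lemma nested_limit (q : nat -> Q) (m : nat -> nat) :
  (forall n, (n <= m n)%N) -> (forall n, ccyl (q n.+1) (m n.+1) `<=` ccyl (q n) (m n)) ->
  exists z, forall n, ccyl (q n) (m n) z.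
Proof.
move=> hm hq.
have mono n k : ccyl (q (n + k)%N) (m (n + k)%N) `<=` ccyl (q n) (m n).
  elim: k => [|k IH]; first by rewrite addn0.
  by rewrite addnS; apply: subset_trans IH; exact: hq.
have near n k : (n <= k)%N -> ccyl (q n) (m n) (q k).
  move=> nk; have := mono n (k - n)%N; rewrite subnKC // => h; apply: h => i _.
  by rewrite subrr normr0 ltW // radius_gt0.
pose r n : R := (m n).+1%:R^-1.
pose A i := [set q n i - r n | n in [set n | (i < m n)%N]].
have ub i n : (i < m n)%N -> ubound (A i) (q n i + r n).
  move=> im _ [k /= ik <-].
  have h1 := near n (maxn n k) (leq_maxl _ _) i im.
  have h2 := near k (maxn n k) (leq_maxr _ _) i ik.
  move: h1 h2; rewrite !ler_norml -/(r n) -/(r k) => /andP[a1 a2] /andP[b1 b2].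
  by lra.
have hA i : has_sup (A i).
  split; last by exists (q i.+1 i + r i.+1); apply: ub; exact: hm.
  by exists (q i.+1 i - r i.+1), i.+1 => //=; exact: hm.
exists (fun i => sup (A i)) => n i im.
have h1 : sup (A i) <= q n i + r n by apply: ge_sup; [have [] := hA i|exact: ub].
have h2 : q n i - r n <= sup (A i).
  by apply: sup_ubound; [have [] := hA i|exists n].
by rewrite ler_norml -/(r n); lra.
Qed.

(* Relative category: [dns O U] says that [U] is dense in the open set [O], and
   [cmg O S] that [S] is comeagre in [O]. *)
Definition dns O U := forall O', copen O' -> O' `<=` O -> O' !=set0 -> O' `&` U !=set0.

Definition cmg O S := exists U : nat -> set Q,
  (forall i, copen (U i) /\ dns O (U i)) /\
  (forall q, O q -> (forall i, U i q) -> S q).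

Lemma baire O S : copen O -> O !=set0 -> cmg O S -> exists2 q, O q & S q.
Proof.
move=> hO [q0 Oq0] [U [hU hS]].
have [m0 _ hm0] := copen_shrink 0 hO Oq0.
have step (n : nat) (s : Q * nat) : exists s' : Q * nat, ccyl s.1 s.2 `<=` O ->
    [/\ (n < s'.2)%N, ccyl s'.1 s'.2 `<=` ccyl s.1 s.2 & ccyl s'.1 s'.2 `<=` U n].
  case: (pselect (ccyl s.1 s.2 `<=` O)) => [h|h]; last by exists s.
  have [_ dU] := hU n.
  have [|p [sp Up]] := dU _ (@copen_cyl s.1 s.2) (subset_trans (@cyl_ccyl _ _) h).
    by exists s.1; exact: cyl_refl.
  have [m nm hm] := copen_shrink n.+1 (copenI (@copen_cyl s.1 s.2) (hU n).1) (conj sp Up).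
  exists (p, m) => _; split=> //= x /hm[h1 h2] //; exact: cyl_ccyl.
have /choice[f hf] : forall ns : nat * (Q * nat), exists s' : Q * nat,
    ccyl ns.2.1 ns.2.2 `<=` O -> [/\ (ns.1 < s'.2)%N,
    ccyl s'.1 s'.2 `<=` ccyl ns.2.1 ns.2.2 & ccyl s'.1 s'.2 `<=` U ns.1].
  by move=> [n s]; exact: step.
pose s := fix s n := if n is k.+1 then f (k, s k) else (q0, m0).
have sO n : ccyl (s n).1 (s n).2 `<=` O.
  by elim: n => //= n IH; have [_ h _] := hf (n, s n) IH; exact: subset_trans h IH.
have hs n := hf (n, s n) (sO n).
have [z hz] : exists z, forall n, ccyl (s n).1 (s n).2 z.
  by apply: nested_limit => [[|n]|n] //; have [] := hs n.
exists z; first exact: sO (hz 0%N).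
apply: hS; first exact: sO (hz 0%N).
by move=> n; have [_ _ h] := hs n; apply: h; exact: hz n.+1.
Qed.

Lemma dnsT O : dns O setT.
Proof. by move=> O' _ _ [q Oq]; exists q. Qed.

Lemma dns_sub O O' U : O' `<=` O -> dns O U -> dns O' U.
Proof. by move=> OO h O1 o1 s1; apply: h => //; exact: subset_trans s1 OO. Qed.

Lemma cmgS O S S' : S `<=` S' -> cmg O S -> cmg O S'.
Proof. by move=> SS [U [h1 h2]]; exists U; split=> // q Oq Uq; apply/SS/h2. Qed.

Lemma cmg_sub O O' S : O' `<=` O -> cmg O S -> cmg O' S.
Proof.
move=> OO [U [h1 h2]]; exists U; split=> [i|q /OO Oq]; last exact: h2.
by have [h3 h4] := h1 i; split=> //; exact: dns_sub h4.
Qed.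

Lemma cmg_in O S : (forall q, O q -> S q) -> cmg O S.
Proof.
move=> h; exists (fun=> setT); split=> [i|q /h //].
by split; [exact: copenT|exact: dnsT].
Qed.

Lemma cmg_countable (I : countType) O (U : I -> set Q) S :
  (forall i, copen (U i) /\ dns O (U i)) ->
  (forall q, O q -> (forall i, U i q) -> S q) -> cmg O S.
Proof.
move=> hU hS; exists (fun n => if unpickle n is Some i then U i else setT).
split=> [n|q Oq h].
  by case: unpickle => [i|]; [exact: hU|split; [exact: copenT|exact: dnsT]].
by apply: hS => // i; have := h (pickle i); rewrite pickleK.
Qed.

Lemma cmg_bigcap O (S : nat -> set Q) : (forall n, cmg O (S n)) ->
  cmg O [set q | forall n, S n q].
Proof.
move=> /choice[U hU].
apply: (@cmg_countable (nat * nat)%type _ (fun ni => U ni.1 ni.2)).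
  by move=> [n i]; have [h _] := hU n; exact: h.
move=> q Oq h n; have [_ hS] := hU n; apply: hS => // i; exact: h (n, i).
Qed.

Lemma cmgI O S S' : cmg O S -> cmg O S' -> cmg O (S `&` S').
Proof.
move=> h h'; apply: (@cmgS _ [set q | forall n, (if n is 0%N then S else S') q]).
  by move=> q hq; split; [exact: hq 0%N|exact: hq 1%N].
by apply: cmg_bigcap => -[].
Qed.

Definition basis_cyl (k : nat) : set Q :=
  if unpickle k is Some (s, m) then cyl (fun i => ratr (nth (0 : rat) s i)) m else set0.

Lemma copen_basis k : copen (basis_cyl k).
Proof.
by rewrite /basis_cyl; case: unpickle => [[s m]|]; [exact: copen_cyl|].
Qed.

Lemma exists_basis O q : copen O -> O q -> exists2 k, basis_cyl k q & basis_cyl k `<=` O.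
Proof.
move=> hO /hO[m hm]; pose M := (2 * m).+2; pose e : R := M.+1%:R^-1.
have e0 : 0 < e by exact: radius_gt0.
have /choice[s hs] : forall i, exists t : rat, `|q i - ratr t| < e.
  move=> i; have lt : q i - e < q i + e by lra.
  have [t] := rat_in_itvoo lt; rewrite in_itv /= => /andP[t1 t2].
  by exists t; rewrite ltr_norml; lra.
exists (pickle (mkseq s M, M)); rewrite /basis_cyl pickleK.
  by move=> i iM; rewrite nth_mkseq // hs.
move=> p hp; apply: hm => i im; have iM : (i < M)%N by rewrite /M; lia.
have := hp i iM; rewrite nth_mkseq // => h1; have h2 := hs i.
have h3 : 2 * e <= m.+1%:R^-1.
  have -> : m.+1%:R^-1 = 2 / (2 * m.+1)%:R :> R by rewrite natrM; field.
  by rewrite ler_pM2l // lef_pV2 ?posrE // ler_nat /M; lia.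
rewrite distrC in h2; have h1' : `|p i - ratr (s i)| < e := h1.
apply: (le_lt_trans (ler_distD (ratr (s i)) (p i) (q i))).
apply: (lt_le_trans (ltrD h1' h2)); apply: le_trans h3.
by rewrite -mulr2n -[_ *+ 2]mulr_natl.
Qed.

Definition ext B : set Q := [set q | exists m, cyl q m `&` B = set0].

Lemma copen_ext B : copen (ext B).
Proof.
move=> q [m hm]; exists m => p hp; have [n hn] := copen_cyl hp.
exists n; apply/seteqP; split=> // x [xp Bx].
by rewrite -hm; split=> //; exact: hn.
Qed.

Lemma dns_ext O B U : copen O -> copen B -> dns (O `&` B) U -> dns O (U `|` ext B).
Proof.
move=> hO hB hU O' o' s' [q Oq].
have [[x [Ox Bx]]|/forallNP nh] := pselect (O' `&` B !=set0).
  have [||y [[Oy _] Uy]] := hU (O' `&` B) (copenI o' hB).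
  - by move=> y [/s' ? ?].
  - by exists x.
  by exists y; split=> //; left.
have [m hm] := o' q Oq; exists q; split=> //; right; exists m.
by apply/seteqP; split=> // x [/hm Ox Bx]; case: (nh x).
Qed.

(* [S] is nowhere meagre in [O]. *)
Definition star S O := forall O', copen O' -> O' `<=` O -> O' !=set0 -> ~ cmg O' (~` S).

(* The Banach category theorem. *)
Lemma star_exists O S : copen O -> ~ cmg O (~` S) ->
  exists O', [/\ copen O', O' `<=` O, O' !=set0 & star S O'].
Proof.
move=> hO nO; apply: contrapT => /forallNP hn; apply: nO.
have loc O' : copen O' -> O' `<=` O -> O' !=set0 ->
    exists O2, [/\ copen O2, O2 `<=` O', O2 !=set0 & cmg O2 (~` S)].
  move=> o' s' n'; apply: contrapT => /forallNP h; apply: (hn O'); split=> // O2 o2 s2 n2 c2.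
  by apply: (h O2).
pose good k := cmg (basis_cyl k) (~` S).
have /choice[U hU] : forall k, exists U : nat -> set Q, good k ->
    (forall i, copen (U i) /\ dns (basis_cyl k) (U i)) /\
    (forall q, basis_cyl k q -> (forall i, U i q) -> ~ S q).
  move=> k; case: (pselect (good k)) => [[U h]|h]; first by exists U.
  by exists (fun=> setT).
pose Om := \bigcup_(k in good) basis_cyl k.
pose W (c : option (nat * nat)) := if c is Some ki then
  (if `[< good ki.1 >] then U ki.1 ki.2 `|` ext (basis_cyl ki.1) else setT) else Om.
apply: (@cmg_countable (option (nat * nat)) _ W).
  case=> [[k i]|] /=; last first.
    split; first by apply: copen_bigcup => k _; exact: copen_basis.
    move=> V' o' s' n'; have [V2 [hO2 s2 [x V2x] c2]] := loc V' o' s' n'.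
    have [k kx ks] := exists_basis hO2 V2x.
    by exists x; split; [exact: s2|exists k => //; exact: cmg_sub c2].
  case: asboolP => [gk|_]; last by split; [exact: copenT|exact: dnsT].
  have [h1 _] := hU k gk; have [h2 h3] := h1 i.
  split; first by apply: copenU => //; exact: copen_ext.
  apply: dns_ext => //; first exact: copen_basis.
  by apply: dns_sub h3 => x [].
move=> q Oq hq; have [k gk kq] := hq None.
have [_ h] := hU k gk; apply: h => // i.
have := hq (Some (k, i)); rewrite /W /=; case: asboolP => // _ [//|[m hm]].
by exfalso; have : set0 q by rewrite -hm; split=> //; exact: cyl_refl.
Qed.

(** Otherwise, by [star_exists], every [T k] would be meagre in [O'], and so would [S], which they
    cover there. *)
Lemma star_split O S (T : nat -> set Q) : star S O ->
  (forall q, O q -> S q -> exists k, T k q) ->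
  forall O', copen O' -> O' `<=` O -> O' !=set0 ->
  exists k O2, [/\ copen O2, O2 `<=` O', O2 !=set0 & star (T k) O2].
Proof.
move=> hs hT O' o' s' n'; apply: contrapT => /forallNP hn.
apply: (hs O') => //.
have : cmg O' [set q | forall k, ~ T k q].
  apply: cmg_bigcap => k; apply: contrapT => /(star_exists o')[V2 h].
  by apply: (hn k); exists V2.
move=> /(cmgI (@cmg_in O' O' (fun q h => h))); apply: cmgS => q [Oq h] Sq.
have [k Tk] := hT q (s' _ Oq) Sq; exact: h k Tk.
Qed.

Definition cont (h : Q -> Q) := forall q m, exists n, forall p, cyl q n p -> cyl (h q) m (h p).

Lemma cont_open h O : cont h -> copen O -> copen (h @^-1` O).
Proof.
move=> ch hO q /hO[m hm]; have [n hn] := ch q m.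
by exists n => p /hn /hm.
Qed.

Lemma cmg_homeo h g O S : cont h -> cont g -> cancel h g -> cancel g h ->
  cmg O S -> cmg (h @^-1` O) (h @^-1` S).
Proof.
move=> ch cg hK gK [U [hU hS]]; exists (fun i => h @^-1` U i).
split=> [i|q Oq Uq]; last exact: hS.
have [u1 u2] := hU i; split; first exact: cont_open.
move=> O' o' s' [x Ox].
have [||y [Oy Uy]] := u2 (g @^-1` O') (cont_open cg o').
- by move=> y /= /s'; rewrite /= gK.
- by exists (h x); rewrite /= hK.
by exists (g y); split=> //; rewrite /= gK.
Qed.

(** * Comeagre sets and reindexing of coordinates *)

Section Coordinates.
Variable s : nat -> nat.
Hypothesis s_inj : injective s.
Hypothesis s_ge : forall i, (i <= s i)%N.

Definition proj (q : Q) : Q := q \o s.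

Lemma cont_proj : cont proj.
Proof.
move=> q m; exists (maxn m (\max_(i < m) (s i).+1)) => p hp i im.
have h : (s i < maxn m (\max_(i < m) (s i).+1))%N.
  by rewrite leq_max (leq_bigmax (Ordinal im)) orbT.
by apply: lt_le_trans (hp _ h) _; rewrite radius_le // leq_maxl.
Qed.

(** A point is changed only at positions in the range of [s]. Because [i <= s i], every changed
    position below [m] carries a coordinate that the cylinder of level [m] already controls. *)
Lemma proj_dense U : copen U -> dns setT U -> dns setT (proj @^-1` U).
Proof.
move=> oU dU O' o' _ [q /o'[m hm]].
have [|y [hy Uy]] := dU (cyl (proj q) m) (@copen_cyl _ _) (fun _ _ => I).
  by exists (proj q); exact: cyl_refl.
pose p k := if pselect (exists i, s i = k) is left h then y (sval (cid h)) else q k.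
have pE i : p (s i) = y i.
  rewrite /p; case: pselect => [h|[]]; last by exists i.
  by case: cid => l /= /s_inj ->.
exists p; split; last first.
  by rewrite /= (_ : proj p = y) //; apply/funext => i; exact: pE.
apply: hm => k km; have [[i ik]|nk] := pselect (exists i, s i = k).
  rewrite -ik pE; apply: hy; apply: leq_ltn_trans km; rewrite -ik; exact: s_ge.
rewrite /p; case: pselect => // _; rewrite subrr normr0; exact: radius_gt0.
Qed.

Lemma cmg_proj S : cmg setT S -> cmg setT (proj @^-1` S).
Proof.
move=> [U [hU hS]]; exists (fun i => proj @^-1` U i); split=> [i|q _ Uq].
  have [u1 u2] := hU i; split; [exact: cont_open cont_proj u1|exact: proj_dense].
exact: hS.
Qed.

End Coordinates.
End Cylinders.

(** * Continuity on a comeagre set *)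

Section Metric.
Variables (R : realType) (T : topologicalType) (d : T -> T -> R).
Hypothesis d_metric : is_metric d.
Hypothesis d_compat : compatible_metric d.

Definition dball x (e : R) : set T := [set y | d x y < e].

Lemma dxx x : d x x = 0.
Proof. by have [/(_ x x)[_ ->]] := d_metric. Qed.

Lemma dC x y : d x y = d y x.
Proof. by have [_ h _] := d_metric. Qed.

Lemma dtri y x z : d x z <= d x y + d y z.
Proof. by have [_ _ h] := d_metric. Qed.

Lemma d_ge0 x y : 0 <= d x y.
Proof. by have := dtri y x x; rewrite dxx (dC y x); lra. Qed.

Lemma d_small x y : (forall e, 0 < e -> d x y < e) -> x = y.
Proof.
move=> h; have [/(_ x y)[h0 _] _ _] := d_metric; apply: h0.
apply/le_anti; rewrite d_ge0 andbT leNgt; apply/negP => /h; by rewrite ltxx.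
Qed.

Lemma dball_open x e : open (dball x e).
Proof.
rewrite openE => y xy; apply/d_compat; exists (e - d x y); first by rewrite subr_gt0.
by move=> z yz; apply: le_lt_trans (dtri y x z) _; rewrite -ltrBrDl.
Qed.

Lemma open_dball x (U : set T) : open U -> U x -> exists2 e : R, 0 < e & dball x e `<=` U.
Proof. by move=> oU Ux; apply/d_compat/open_nbhs_nbhs. Qed.

Lemma cvg_dist (u : nat -> T) l : u @ \oo --> l ->
  forall e : R, 0 < e -> exists N, forall n, (N <= n)%N -> d l (u n) < e.
Proof.
move=> ul e e0; have /ul [N _ hN] : nbhs l (dball l e) by apply/d_compat; exists e.
by exists N.
Qed.

Lemma dense_sequence (x0 : T) : separable T ->
  exists s : nat -> T, forall x (e : R), 0 < e -> exists k, d (s k) x < e.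
Proof.
case=> D [/countable_injP[i ii] hD].
exists (fun k => xget x0 [set x | D x /\ i x = k]) => x e e0.
have [|y [xy Dy]] := hD (dball x e) _ (dball_open x e).
  by exists x; rewrite /dball /= dxx.
exists (i y); case: xgetP => [z _ [Dz e1]|/(_ y)]; last by case.
by rewrite (ii z y) ?inE // dC.
Qed.

Lemma ball_between (s : nat -> T) (U : set T) x N :
  (forall x (e : R), 0 < e -> exists k, d (s k) x < e) -> open U -> U x ->
  exists k l, [/\ (N <= l)%N, d (s k) x < l.+1%:R^-1 &
    [set y | d (s k) y <= l.+1%:R^-1] `<=` U].
Proof.
move=> hs oU /(open_dball oU)[e e0 eU].
have [l0 hl0] := exists_radius (divr_gt0 e0 (ltr0n R 2)).
pose l := maxn N l0; have [k hk] := hs x _ (radius_gt0 R l).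
exists k, l; split=> //; first exact: leq_maxl.
move=> y /= hy; apply: eU; rewrite /dball /=.
have hl : l.+1%:R^-1 < e / 2 by apply: le_lt_trans hl0; rewrite radius_le // leq_maxr.
have := dtri (s k) x y; rewrite (dC x (s k)); move: hk hy hl; rewrite -/l; set r := _^-1; lra.
Qed.

End Metric.

Section BaireProperty.
Variable R : realType.
Local Notation Q := (nat -> R).
Implicit Types (p q : Q) (O U S : set Q).

(* The Baire property. *)
Definition bp S := exists O, copen O /\ cmg setT [set q | S q <-> O q].

Lemma open_copen (U : set {ptws nat -> R}) : open U -> copen (U : set Q).
Proof.
move=> oU q Uq; apply: contrapT => /forallNP hn.
have /choice[p hp] : forall m, exists p, cyl q m p /\ ~ U p.
  by move=> m; have /existsNP[p /not_implyP h] := hn m; exists p.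
have cp : (p : nat -> {ptws nat -> R}) @ \oo --> (q : {ptws nat -> R}).
  apply/(@pointwise_cvgP nat R) => i; apply/cvgrPdist_lt => e e0.
  have [m hm] := exists_radius e0.
  exists (maxn i.+1 m) => // n /= hn'.
  have [/(_ i) h _] := hp n; rewrite distrC.
  apply: lt_trans hm; apply: lt_le_trans (h _) _.
    exact: leq_trans (leq_maxl _ _) hn'.
  by rewrite radius_le //; exact: leq_trans (leq_maxr _ _) hn'.
have /cp [N _ hN] : nbhs (q : {ptws nat -> R}) U by exact: open_nbhs_nbhs.
by have [_] := hp N; apply; apply: (hN N) => /=.
Qed.

Lemma bp_open O : copen O -> bp O.
Proof. by move=> hO; exists O; split=> //; apply: cmg_in. Qed.

Lemma ext_notin O q : ext O q -> ~ O q.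
Proof.
case=> m h Oq; have : set0 q by rewrite -h; split=> //; exact: cyl_refl.
by [].
Qed.

Lemma bpC S : bp S -> bp (~` S).
Proof.
case=> O [hO cS]; exists (ext O); split; first exact: copen_ext.
have c2 : cmg setT (O `|` ext O).
  exists (fun=> O `|` ext O); split=> [_|q _ /(_ 0%N)//]; split.
    exact: copenU hO (@copen_ext _ _).
  apply: dns_ext hO _ => //; first exact: copenT.
  by move=> O' _ s [x /[dup] O'x /s[_ ?]]; exists x.
apply: cmgS (cmgI cS c2) => q [/= [h1 h2] h3]; split; last by move=> /ext_notin h4 /h1.
by move=> nS; case: h3 => // /h2.
Qed.

Lemma bp_bigcup (S : nat -> set Q) : (forall n, bp (S n)) -> bp (\bigcup_n S n).
Proof.
move=> /choice[W hW]; exists (\bigcup_n W n); split.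
  by apply: copen_bigcup => n _; case: (hW n).
apply: cmgS (cmg_bigcap (fun n => (hW n).2)) => q /= h; split=> -[n _].
  by move=> /h; exists n.
by move=> /h; exists n.
Qed.

Lemma borel_bp S : borel {ptws nat -> R} S -> bp S.
Proof.
apply: (@smallest_sub _ _ _ [set S : set {ptws nat -> R} | bp S]).
  split=> /=.
  - by apply: bp_open => q.
  - by move=> A hA; rewrite setTD; exact: bpC.
  - by move=> A hA; exact: bp_bigcup.
by move=> U /= /open_copen; exact: bp_open.
Qed.

Section ContinuityOnComeager.
Variables (Z : topologicalType) (d : Z -> Z -> R).

Definition cont_on (C : set Q) (f : Q -> Z) := forall q, C q -> forall e : R, 0 < e ->
  exists m, forall p, C p -> cyl q m p -> d (f q) (f p) < e.

Lemma cont_on_proj C f s : cont_on C f ->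
  cont_on (proj s @^-1` C) (f \o proj s).
Proof.
move=> h q Cq e /(h _ Cq)[m hm].
have [n hn] := @cont_proj _ s q m.
by exists n => p Cp /hn; exact: hm.
Qed.

Lemma cont_on_sub C C' f : C' `<=` C -> cont_on C f -> cont_on C' f.
Proof.
move=> CC h q /CC Cq e /(h _ Cq)[m hm].
by exists m => p /CC; exact: hm.
Qed.

Hypothesis d_metric : is_metric d.
Hypothesis d_compat : compatible_metric d.

(** The preimages of countably many balls agree with open sets off meagre sets; on the points where
    all these agreements hold the map is continuous. *)
Lemma borel_cont_on (f : Q -> Z) : separable Z ->
  (forall B, borel Z B -> borel {ptws nat -> R} (f @^-1` B)) ->
  exists C, cmg setT C /\ cont_on C f.
Proof.
move=> sZ hf; have [s hs] := dense_sequence d_metric d_compat (f (fun=> 0)) sZ.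
have /choice[W hW] : forall kl : nat * nat, exists O, copen O /\
    cmg setT [set q | dball d (s kl.1) kl.2.+1%:R^-1 (f q) <-> O q].
  move=> [k l]; apply: borel_bp; apply: hf; apply: sub_sigma_algebra.
  exact: dball_open.
exists [set q | forall k l, dball d (s k) l.+1%:R^-1 (f q) <-> W (k, l) q]; split.
  have := cmg_bigcap (fun k => cmg_bigcap (fun l => (hW (k, l)).2)).
  by apply: cmgS.
move=> q Cq e e0; have [l hl] := exists_radius (divr_gt0 e0 (ltr0n R 2)).
have [k hk] := hs (f q) _ (radius_gt0 R l).
have [m hm] := (hW (k, l)).1 q ((Cq k l).1 hk).
exists m => p Cp /hm /(Cp k l).2 /=; rewrite /dball /= => h.
have := dtri d_metric (s k) (f q) (f p); rewrite (dC d_metric (f q) (s k)).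
by move: h hk hl; set r := _^-1; rewrite /=; lra.
Qed.

End ContinuityOnComeager.
End BaireProperty.

(** * Category and orbits *)

Section Orbits.
Variable R : realType.
Local Notation Q := (nat -> R).
Implicit Types (p q : Q) (O U S C : set Q).

Variables (G : topologicalGroupType) (dG : G -> G -> R) (gs : nat -> G).
Hypothesis dG_metric : is_metric dG.
Hypothesis dG_compat : compatible_metric dG.
Hypothesis dG_complete : complete_metric dG.
Hypothesis gs_dense : forall x (e : R), 0 < e -> exists k, dG (gs k) x < e.

Variables (Z : topologicalType) (dZ : Z -> Z -> R) (act : G -> Z -> Z).
Hypothesis dZ_metric : is_metric dZ.
Hypothesis dZ_compat : compatible_metric dZ.
Hypothesis act_continuous : continuous (fun p : G * Z => act p.1 p.2).

Implicit Types (g h : G) (V : set G) (F H : Q -> Z).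

Lemma act_dist g z (e : R) : 0 < e -> exists2 r : R, 0 < r &
  forall g' z', dG g g' < r -> dZ z z' < r -> dZ (act g z) (act g' z') < e.
Proof.
move=> e0; have : nbhs (g, z) [set p : G * Z | dZ (act g z) (act p.1 p.2) < e].
  have h : nbhs (act g z) [set y | dZ (act g z) y < e] by apply/dZ_compat; exists e.
  exact: (@act_continuous (g, z) _ h).
case=> -[A B] /= [/dG_compat[a a0 aA] /dZ_compat[b b0 bB]] hAB.
exists (Num.min a b); first by rewrite lt_min a0.
move=> g' z'; rewrite !lt_min => /andP[h1 _] /andP[_ h2].
by apply: (hAB (g', z')); split; [exact: aA|exact: bB].
Qed.

Lemma act_limit (g : nat -> G) (x y : nat -> Z) x0 y0 :
  (forall e : R, 0 < e -> exists N, forall m n,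
     (N <= m)%N -> (N <= n)%N -> dG (g m) (g n) < e) ->
  (forall e : R, 0 < e -> exists N, forall n, (N <= n)%N -> dZ x0 (x n) < e) ->
  (forall e : R, 0 < e -> exists N, forall n, (N <= n)%N -> dZ y0 (y n) < e) ->
  (forall n, y n = act (g n) (x n)) ->
  exists g0, y0 = act g0 x0 /\
    forall e : R, 0 < e -> exists N, forall n, (N <= n)%N -> dG g0 (g n) < e.
Proof.
move=> /dG_complete[g0 /(cvg_dist dG_compat) hg] hx hy hxy; exists g0; split=> //.
apply: (d_small dZ_metric) => e e0; have e2 : 0 < e / 2 by rewrite divr_gt0.
have [r r0 hr] := act_dist g0 x0 e2.
have [N1 h1] := hg r r0; have [N2 h2] := hx r r0; have [N3 h3] := hy _ e2.
pose n := maxn N1 (maxn N2 N3).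
have l1 : (N1 <= n)%N by rewrite /n; lia.
have l2 : (N2 <= n)%N by rewrite /n; lia.
have l3 : (N3 <= n)%N by rewrite /n; lia.
have := hr _ _ (h1 n l1) (h2 n l2); rewrite -hxy => a1; have a2 := h3 n l3.
have := dtri dZ_metric (y n) y0 (act g0 x0); rewrite (dC dZ_metric (y n)).
by move: a1 a2; lra.
Qed.

Definition rv F H V : set Q := [set q | exists2 g, V g & H q = act g (F q)].

Definition gball (c : nat * nat) : set G := dball dG (gs c.1) c.2.+1%:R^-1.
Definition gcball (c : nat * nat) : set G := [set g | dG (gs c.1) g <= c.2.+1%:R^-1].

Lemma exists_gball V g N : open V -> V g ->
  exists c, [/\ (N <= c.2)%N, gball c g & gcball c `<=` V].
Proof.
move=> oV Vg; have [k [l h]] := ball_between dG_metric dG_compat N gs_dense oV Vg.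
by exists (k, l).
Qed.

Lemma gball_open c : open (gball c).
Proof. exact: dball_open. Qed.

Lemma gball_dist c g h : gball c g -> gball c h -> dG g h < 2 / c.2.+1%:R.
Proof.
rewrite /gball /dball /= => h1 h2; have := dtri dG_metric (gs c.1) g h.
by rewrite (dC dG_metric g (gs c.1)); move: h1 h2; set r := _^-1; lra.
Qed.

Lemma star_meet S O C q n : copen O -> O q -> star S O -> cmg O C ->
  exists p, [/\ O p, cyl q n p, C p & S p].
Proof.
move=> hO Oq sS cC; apply: contrapT => hn.
apply: (sS (O `&` cyl q n)).
- exact: copenI hO (@copen_cyl _ _ _).
- by move=> x [].
- by exists q; split=> //; exact: cyl_refl.
have : cmg (O `&` cyl q n) C by apply: cmg_sub cC => x [].
move=> /(cmgI (@cmg_in _ (O `&` cyl q n) (O `&` cyl q n) (fun q Oq => Oq))).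
by apply: cmgS => p [[Op cp] Cp] Sp; apply: hn; exists p.
Qed.

Section Hull.
Variables (C : set Q) (F H : Q -> Z).
Hypothesis contF : cont_on dZ C F.
Hypothesis contH : cont_on dZ C H.

(* [rv F H V] is only analytic; that it is comeagre in some open set when it is
   not meagre is proved by running the Souslin scheme given by the balls of [G]. *)
Lemma hull O V : copen O -> cmg O C -> open V -> ~ cmg O (~` rv F H V) ->
  exists O', [/\ copen O', O' `<=` O, O' !=set0 & cmg O' (rv F H V)].
Proof.
move=> hO cC oV /(star_exists hO)[W1 [hO1 s1 n1 st1]]; exists W1; split=> //.
(* [None] stands for the root [V] of the scheme and [Some c] for a coded ball; the closed ball of a
   child lies in its parent. *)
pose node (c : option (nat * nat)) := if c is Some c' then gball c' else V.
have node_open c : open (node c) by case: c => [c|]; [exact: gball_open|].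
pose child c l (c' : nat * nat) := (l <= c'.2)%N /\ gcball c' `<=` node c.
(* The part of [W1] where the relation with elements of the node is nowhere meagre. By [star_split]
   almost every point of it lies in the corresponding part of some child, which is what membership
   in [N] expresses. *)
pose D c := \bigcup_(U in [set U | [/\ copen U, U `<=` W1 & star (rv F H (node c)) U]]) U.
have hD c : copen (D c) by apply: copen_bigcup => U [].
pose N (cl : option (nat * nat) * nat) :=
  (\bigcup_(c' in child cl.1 cl.2) D (Some c')) `|` ext (D cl.1).
have hN cl : copen (N cl) /\ dns W1 (N cl).
  split; first by apply: copenU (@copen_ext _ _); apply: copen_bigcup => c _.
  apply: dns_ext => // U hU sU [x Ux].
  have [x1 [W [hW sW stW] Wx]] := sU x Ux.
  pose T k := if unpickle k is Some c' then
    (if `[< child cl.1 cl.2 c' >] then rv F H (gball c') else set0) else set0.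
  have hT q : W q -> rv F H (node cl.1) q -> exists k, T k q.
    move=> _ [g Vg e]; have [c' [h1 h2 h3]] := exists_gball cl.2 (node_open _) Vg.
    exists (pickle c'); rewrite /T pickleK; have -> : `[< child cl.1 cl.2 c' >] by apply/asboolP.
    by exists g.
  have [k [U2 [hU2 sU2 [y U2y] stU2]]] := star_split stW hT (copenI hU hW)
    (fun x Ux => Ux.2) (ex_intro _ x (conj Ux Wx)).
  have no0 : ~ star set0 U2.
    by move=> /(_ U2 hU2 (fun _ Ux => Ux) (ex_intro _ y U2y)); apply; apply: cmg_in => ? _ [].
  exists y; split; first exact: (sU2 y U2y).1.
  move: stU2; rewrite /T; case: unpickle => [c'|//]; case: asboolP => // ch stU2.
  by exists c' => //; exists U2 => //; split=> // z /sU2[_ /sW].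
have : cmg W1 (C `&` [set q | forall cl, N cl q]).
  apply: cmgI; first exact: cmg_sub cC.
  by apply: (@cmg_countable _ (option (nat * nat) * nat)%type _ N).
move=> /(cmgI (@cmg_in _ W1 W1 (fun q Oq => Oq))); apply: cmgS => q [W1q [Cq Nq]].
have D0 : D None q by exists W1 => //; split.
have step (c : option (nat * nat)) l : exists c', D c q ->
    D (Some c') q /\ child c l c'.
  case: (pselect (D c q)) => h; last by exists (0, 0)%N.
  by case: (Nq (c, l)) => [[c' h1 h2]|/ext_notin //]; exists c'.
have /choice[f hf] : forall cl : option (nat * nat) * nat, exists c', D cl.1 q ->
    D (Some c') q /\ child cl.1 cl.2 c' by move=> [c l]; exact: step.
(* An infinite branch at the fixed generic [q]. Points [x n] close to [q] satisfy the relation with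
   group elements in the nodes of the branch; these form a Cauchy sequence, and [act_limit] carries
   the relation to [q]. *)
pose br := fix br n := if n is k.+1 then Some (f (br k, k)) else None.
have Dbr n : D (br n) q by elim: n => //= n IH; case: (hf (br n, n) IH).
have chbr n : child (br n) n (f (br n, n)) by case: (hf (br n, n) (Dbr n)).
have nodeS n : node (br n.+1) `<=` node (br n).
  by move=> g hg; apply: (chbr n).2; apply/ltW.
have nodem n k : node (br (n + k)%N) `<=` node (br n).
  elim: k => [|k IH]; first by rewrite addn0.
  by rewrite addnS; apply: subset_trans IH; exact: nodeS.
have /choice[x hx] : forall n, exists p, [/\ cyl q n p, C p & rv F H (node (br n)) p].
  move=> n; have [U [hU sU stU] Uq] := Dbr n.
  by have [p [_ h1 h2 h3]] := star_meet n hU Uq stU (cmg_sub (subset_trans sU s1) cC); exists p.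
have /choice[g hg] : forall n, exists g, node (br n) g /\ H (x n) = act g (F (x n)).
  by move=> n; have [_ _ [g]] := hx n; exists g.
have gn n k : node (br n) (g (n + k)%N) by apply: (@nodem n k); case: (hg (n + k)%N).
have lim (K : Q -> Z) : cont_on dZ C K ->
    forall e : R, 0 < e -> exists N, forall n, (N <= n)%N -> dZ (K q) (K (x n)) < e.
  move=> hK e /(hK q Cq)[m hm]; exists m => n mn.
  by have [h1 h2 _] := hx n; apply: hm => //; exact: cyl_sub mn _ h1.
have [|g0 [e0 hg0]] := act_limit _ (lim F contF) (lim H contH) (fun n => (hg n).2).
  move=> e e0; have [M hM] := exists_radius (divr_gt0 e0 (ltr0n R 2)).
  exists M.+1 => m n hm hn.
  have h1 := gn M.+1 (m - M.+1)%N; have h2 := gn M.+1 (n - M.+1)%N.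
  rewrite !subnKC // in h1 h2.
  apply: lt_trans (gball_dist h1 h2) _.
  have h3 := radius_le R (chbr M).1.
  by move: h3 hM; set M1 := M.+1%:R^-1; set r := _^-1; lra.
(* The limit is only known to lie in the closed ball of the first child, which suffices since that
   closed ball is contained in [V]. *)
exists g0 => //; apply: (chbr 0%N).2; rewrite /gcball /= leNgt; apply/negP => lt.
have lt0 : 0 < dG (gs (f (None, 0%N)).1) g0 - (f (None, 0%N)).2.+1%:R^-1 by rewrite subr_gt0.
have [n0 hn] := hg0 _ lt0.
have h1 := hn n0.+1 (leqnSn _); have h2 := gn 1%N n0; rewrite add1n in h2.
have h3 : dG (gs (f (None, 0%N)).1) (g n0.+1) < (f (None, 0%N)).2.+1%:R^-1 by exact: h2.
have := dtri dG_metric (g n0.+1) (gs (f (None, 0%N)).1) g0.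
rewrite (dC dG_metric (g n0.+1)) => h4; suff : 0 < 0 :> R by rewrite ltxx.
by move: h1 h3 h4; set r := _^-1; lra.
Qed.

End Hull.
End Orbits.

(** * Changing coordinates generically *)

Section CoordinateChanges.
Variable R : realType.
Local Notation Q := (nat -> R).
Implicit Types (p q : Q) (O U S C : set Q).

Definition shift (k : nat) (c : R) q : Q := fun i => if i == k then q i + c else q i.

Lemma cont_shift k c : cont (shift k c).
Proof.
move=> q m; exists m => p hp i im; have := hp i im; rewrite /shift.
by case: eqP => // _; rewrite opprD addrACA subrr addr0.
Qed.

Lemma shiftK k c : cancel (shift k c) (shift k (- c)).
Proof. by move=> q; apply/funext => i; rewrite /shift; case: eqP => // _; rewrite addrK. Qed.

Lemma shiftNK k c : cancel (shift k (- c)) (shift k c).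
Proof. by move=> q; apply/funext => i; rewrite /shift; case: eqP => // _; rewrite subrK. Qed.

Lemma proj_shift s k c q : (forall i, s i != k) -> proj s (shift k c q) = proj s q.
Proof.
by move=> h; apply/funext => i; rewrite /proj /shift /= (negbTE (h i)).
Qed.

Definition transp (a b i : nat) : nat := if i == a then b else if i == b then a else i.

Lemma transpK a b : involutive (transp a b).
Proof.
move=> i; rewrite /transp; have [->|ia] := eqVneq i a.
  by rewrite eqxx; case: eqP.
have [->|ib] := eqVneq i b; first by rewrite eqxx.
by rewrite (negbTE ia) (negbTE ib).
Qed.

Lemma proj_transpK a b : involutive (@proj R (transp a b)).
Proof. by move=> q; apply/funext => i; rewrite /proj /= transpK. Qed.

Lemma copen_neq a b : copen [set q : Q | q a <> q b].
Proof.
move=> q /= ab; have d0 : 0 < `|q a - q b| by rewrite normr_gt0 subr_eq0; apply/eqP.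
have [m0 hm0] := exists_radius (divr_gt0 d0 (ltr0n R 2)).
pose m := (maxn m0 (maxn a b).+1); exists m => p hp /= e.
have h1 := hp a; have h2 := hp b.
have {h1} h1 : `|p a - q a| < m.+1%:R^-1 by apply: h1; rewrite /m; lia.
have {h2} h2 : `|p b - q b| < m.+1%:R^-1 by apply: h2; rewrite /m; lia.
have h3 : m.+1%:R^-1 <= m0.+1%:R^-1 :> R by rewrite radius_le // leq_maxl.
rewrite distrC in h1; have := ler_distD (p a) (q a) (q b); rewrite leNgt => /negP; apply.
rewrite [in X in _ + X]e; move: h1 h2 h3 hm0; set r := _^-1; set r0 := m0.+1%:R^-1.
by lra.
Qed.

Lemma exists_neq a b O q : a != b -> copen O -> O q -> exists2 p, O p & p a <> p b.
Proof.
move=> ab hO Oq; have [e|ne] := eqVneq (q a) (q b); last by exists q => //; apply/eqP.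
have [m hm] := hO q Oq; have := radius_gt0 R m; set r := _^-1 => r0.
exists (shift a (r / 2) q).
  apply: hm => i im; rewrite /shift; case: eqP => _; last by rewrite subrr normr0.
  by rewrite addrAC subrr add0r -/r gtr0_norm; lra.
by rewrite /shift eqxx eq_sym (negbTE ab) e; lra.
Qed.

(* [v3 n] replaces the first [n] coordinates read by [u3] with fresh ones; [w3 n]
   agrees with [v3 n] and [v3 n.+1] except for the coordinate [n]. *)
Definition u3 (i : nat) : nat := (3 * i)%N.
Definition v3 n (i : nat) : nat := if (i < n)%N then (3 * i).+1 else (3 * i)%N.
Definition w3 n (i : nat) : nat :=
  if (i < n)%N then (3 * i).+1 else if i == n then (3 * i).+2 else (3 * i)%N.

Definition spread (s : nat -> nat) := injective s /\ forall i, (i <= s i)%N.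

Lemma spread_u3 : spread u3.
Proof. by split=> [i j|i]; rewrite /u3; lia. Qed.

Lemma spread_v3 n : spread (v3 n).
Proof. by split=> [i j|i]; rewrite /v3; do ?case: ifP; lia. Qed.

Lemma spread_w3 n : spread (w3 n).
Proof. by split=> [i j|i]; rewrite /w3; do ?case: ifP; lia. Qed.

End CoordinateChanges.

(** * Changing all coordinates in the limit *)

Section Orbits.
Variable R : realType.
Local Notation Q := (nat -> R).
Implicit Types (p q : Q) (O U S C : set Q).

Variables (G : topologicalGroupType) (dG : G -> G -> R) (gs : nat -> G).
Hypothesis dG_metric : is_metric dG.
Hypothesis dG_compat : compatible_metric dG.
Hypothesis dG_complete : complete_metric dG.
Hypothesis gs_dense : forall x (e : R), 0 < e -> exists k, dG (gs k) x < e.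

Variables (Z : topologicalType) (dZ : Z -> Z -> R) (act : G -> Z -> Z).
Hypothesis dZ_metric : is_metric dZ.
Hypothesis dZ_compat : compatible_metric dZ.
Hypothesis act_cont : continuous_action act.

Lemma act1 z : act 1%g z = z. Proof. by case: act_cont. Qed.
Lemma actM g h z : act (g * h)%g z = act g (act h z). Proof. by case: act_cont. Qed.

Let act_c : continuous (fun p : G * Z => act p.1 p.2). Proof. by case: act_cont. Qed.

Lemma actVK g z : act g^-1%g (act g z) = z.
Proof. by rewrite -actM mulVg act1. Qed.

Lemma mul_dist (g h : G) (e : R) : 0 < e -> exists2 r : R, 0 < r &
  forall g' h', dG g g' < r -> dG h h' < r -> dG (g * h)%g (g' * h')%g < e.
Proof.
move=> e0; have hb : nbhs (g * h)%g [set y | dG (g * h)%g y < e] by apply/dG_compat; exists e.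
have [[A B] /= [/dG_compat[a a0 aA] /dG_compat[b b0 bB]] hAB] := @mulg_continuous G (g, h) _ hb.
exists (Num.min a b); first by rewrite lt_min a0.
move=> g' h'; rewrite !lt_min => /andP[h1 _] /andP[_ h2].
by apply: (hAB (g', h')); split; [exact: aA|exact: bB].
Qed.

Lemma div_dist (g h : G) (e : R) : 0 < e -> exists2 r : R, 0 < r &
  forall g' h', dG g g' < r -> dG h h' < r -> dG (g * h^-1)%g (g' * h'^-1)%g < e.
Proof.
move=> /(mul_dist g h^-1%g)[r r0 hr].
have hb : nbhs h^-1%g [set y | dG h^-1%g y < r] by apply/dG_compat; exists r.
have /dG_compat[b b0 bB] := @invg_continuous G h _ hb.
exists (Num.min r b); first by rewrite lt_min r0.
by move=> g' h'; rewrite !lt_min => /andP[h1 _] /andP[_ /bB h2]; exact: hr.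
Qed.

Lemma open_translate (c : G) (e : R) : open [set g | dG 1%g (g * c^-1)%g < e].
Proof.
rewrite openE => g /= lt; apply/dG_compat.
have /(div_dist g c)[r r0 hr] : 0 < e - dG 1%g (g * c^-1)%g by rewrite subr_gt0.
exists r => // g' h1 /=; have := hr g' c h1; rewrite (dxx dG_metric) => /(_ r0) h2.
by apply: le_lt_trans (dtri dG_metric (g * c^-1)%g _ _) _; rewrite -ltrBrDl.
Qed.

Lemma translate_cover (e : R) g : 0 < e -> exists i, dG 1%g (g * (gs i)^-1)%g < e.
Proof.
move=> /(div_dist g g)[r r0 hr]; have [i hi] := gs_dense g r0; exists i.
have := hr g (gs i); rewrite mulgV (dxx dG_metric) (dC dG_metric g).
by apply.
Qed.

Variables (f : Q -> Z) (E : nat -> set Q).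
Hypothesis hE : forall i, copen (E i) /\ dns setT (E i).
Local Notation Cf := [set q | forall i, E i q].
Hypothesis cont_f : cont_on dZ Cf f.
Hypothesis f_E1 : forall x y : Q, (exists n, forall m, (n <= m)%N -> x m = y m) <->
  orbit_rel act (f x) (f y).

Lemma cmg_Cf : cmg setT Cf.
Proof. by exists E. Qed.

Definition rvc s t (V : set G) : set Q := rv act (f \o proj s) (f \o proj t) V.

(** If every piece were meagre in [O], [baire] would produce a point of the relation that belongs to
    no piece. A piece that is not meagre is comeagre in a smaller open set by [hull]. *)
Lemma rv_refine (I : countType) s t O V (P : I -> Prop) (W : I -> set G) :
  spread s -> spread t -> copen O -> O !=set0 -> cmg O (rvc s t V) ->
  (forall i, P i -> open (W i)) -> (forall g, V g -> exists i, P i /\ W i g) ->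
  exists i O', [/\ P i, copen O', O' `<=` O, O' !=set0 & cmg O' (rvc s t (W i))].
Proof.
move=> [s1 s2] [t1 t2] hO nO cV oW VW; apply: contrapT => hn.
pose Cst := proj s @^-1` Cf `&` proj t @^-1` Cf.
have cst : cmg O Cst.
  by apply: (@cmg_sub _ setT) => //; apply: cmgI; apply: cmg_proj => //; exact: cmg_Cf.
have c1 : cont_on dZ Cst (f \o proj s).
  by apply: cont_on_sub (cont_on_proj cont_f) => x [].
have c2 : cont_on dZ Cst (f \o proj t).
  by apply: cont_on_sub (cont_on_proj cont_f) => x [].
have hi i : P i -> cmg O (~` rvc s t (W i)).
  move=> Pi; apply: contrapT => h; apply: hn.
  have [W1 [h1 h2 h3 h4]] := hull dG_metric dG_compat dG_complete gs_dense
     dZ_metric dZ_compat act_c c1 c2 hO cst (oW i Pi) h.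
  by exists i, W1.
have hk k : cmg O [set q | forall i, unpickle k = Some i -> P i -> ~ rvc s t (W i) q].
  case ek : (unpickle k) => [i|]; last by apply: cmg_in.
  have [Pi|nP] := pselect (P i); last by apply: cmg_in => q _ j [<-].
  by apply: cmgS (hi i Pi) => q h j [<-].
have [q Oq [[g Vg e] h]] := baire hO nO (cmgI cV (cmg_bigcap hk)).
have [i [Pi Wg]] := VW g Vg; apply: (h (pickle i) i) => //; first exact: pickleK.
by exists g.
Qed.

Lemma rvc_total s t O : (forall q, exists n, forall m, (n <= m)%N -> proj s q m = proj t q m) ->
  cmg O (rvc s t setT).
Proof.
by move=> h; apply: cmg_in => q _; have /f_E1[g e] := h q; exists g.
Qed.

Lemma shift_rvc s t k c V O : (forall i, s i != k) -> (forall i, t i != k) ->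
  cmg O (rvc s t V) -> cmg (shift k c @^-1` O) (rvc s t V).
Proof.
move=> hs ht /(cmg_homeo (@cont_shift R k c) (@cont_shift R k (- c)) (@shiftK R k c)
  (@shiftNK R k c)); apply: cmgS => q [g Vg] /=; rewrite !proj_shift // => e.
by exists g.
Qed.

Lemma v3_step n q : proj (v3 n) (proj (transp (3 * n) (3 * n).+1) q) = proj (v3 n.+1) q.
Proof.
apply/funext => i; rewrite /proj /= /transp /v3; congr (q _).
by do ?case: ifP; lia.
Qed.

Lemma w3_transp n q : proj (w3 n) (proj (transp (3 * n) (3 * n).+1) q) = proj (w3 n) q.
Proof.
apply/funext => i; rewrite /proj /= /transp /w3; congr (q _).
by do ?case: ifP; lia.
Qed.

(* A fresh coordinate serves as a reference point: [q] and the point obtained by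
   exchanging its coordinates [3 n] and [3 n + 1] have the same image under
   [proj (w3 n)], so if both are in the set [Wi] of the proof, their images under
   [proj (v3 n)] differ by a group element close to 1. *)
Lemma step n O V : copen O -> O !=set0 -> open V -> cmg O (rvc u3 (v3 n) V) ->
  exists O1, [/\ copen O1, O1 !=set0, cmg O1 (rvc u3 (v3 n.+1) V) &
    forall q, O1 q -> [/\ q (3 * n)%N <> q (3 * n).+1,
      exists2 q', O q' & proj u3 q = proj u3 q' &
      exists2 q', O q' & proj (v3 n.+1) q = proj (v3 n) q']].
Proof.
move=> hO nO oV cV.
pose P (cm : nat * nat * nat) := forall g h, dG 1%g g < cm.2.+1%:R^-1 ->
  gball dG gs cm.1 h -> V (g * h)%g.
have cov g : V g -> exists cm, P cm /\ gball dG gs cm.1 g.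
  move=> Vg; have [e e0 eV] := open_dball dG_compat oV Vg.
  have [r r0 hr] := mul_dist 1%g g e0; rewrite mul1g in hr.
  have gr : dball dG g r g by rewrite /dball /= (dxx dG_metric).
  have [c [_ h1 h2]] := exists_gball dG_metric dG_compat gs_dense 0
    (@dball_open R G dG dG_metric dG_compat g r) gr.
  have [m hm] := exists_radius r0; exists (c, m); split=> //.
  move=> g' h' h3 h4; apply: eV; apply: hr; first exact: lt_trans h3 hm.
  by apply: h2; apply: ltW.
have [[c m] [W1 [Pcm hW1 s1 n1 c1]]] := rv_refine (spread_u3) (spread_v3 n) hO nO cV
  (fun cm _ => gball_open gs dG_metric dG_compat cm.1) cov.
have [r r0 hr] := div_dist 1%g 1%g (radius_gt0 R m); rewrite invg1 mulg1 in hr.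
have [||i [W2 [_ hW2 s2 n2 c2]]] := rv_refine (P := fun=> True)
  (W := fun i => [set g | dG 1%g (g * (gs i)^-1)%g < r])
  (spread_w3 n) (spread_v3 n) hW1 n1 (@rvc_total (w3 n) (v3 n) W1 _) (fun i _ => open_translate _ r).
- move=> q; exists n.+1 => k nk; rewrite /proj /= /w3 /v3; congr (q _).
  by do ?case: ifP; lia.
- by move=> g _; have [i hi] := translate_cover g r0; exists i.
set Wi := (X in rvc (w3 n) (v3 n) X) in c2.
pose a := (3 * n)%N; pose b := a.+1.
(* Coordinate [b] is read by none of the three projections, so it may be shifted. The shift by [d]
   makes the coordinates [a] and [b] of [p] equal; that point is fixed by the transposition [k] and
   shows that [W4] is nonempty. *)
have [p W2p] := n2; pose d := p a - p b.
have na s : (forall i, s i != b) -> forall q, proj s (shift b (- d) q) = proj s q.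
  by move=> hs q; rewrite proj_shift.
have ub j : u3 j != b by rewrite /u3 /b /a; lia.
have vb j : v3 n j != b by rewrite /v3 /b /a; case: ifP; lia.
have wb j : w3 n j != b by rewrite /w3 /b /a; do ?case: ifP; lia.
pose W3 := shift b (- d) @^-1` W2; pose k := @proj R (transp a b).
have hW3 : copen W3 by apply: cont_open hW2; exact: cont_shift.
have cu : cmg W3 (rvc u3 (v3 n) (gball dG gs c)).
  by apply: shift_rvc => //; apply: cmg_sub c1.
have cw : cmg W3 (rvc (w3 n) (v3 n) Wi) by exact: shift_rvc.
have ck : cont k by exact: cont_proj.
pose W4 := W3 `&` k @^-1` W3.
have hW4 : copen W4 by apply: copenI hW3 (cont_open ck hW3).
have [q0 W4q0 q0ab] : exists2 q, W4 q & q a <> q b.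
  apply: (exists_neq (q := shift b d p)) => //; first by rewrite /b; lia.
  have h : W3 (shift b d p) by rewrite /W3 /= shiftK.
  split=> //=; rewrite (_ : k _ = shift b d p) //; apply/funext => j.
  rewrite /k /proj /= /transp /shift /d.
  have [->|ja] := eqVneq j a.
    by rewrite eqxx (_ : (a == b) = false) ?subrKC //; rewrite /b; lia.
  have [->|jb] := eqVneq j b; last by rewrite ?(negbTE ja) ?(negbTE jb).
  by rewrite (_ : (a == b) = false) ?subrKC //; rewrite /b; lia.
exists (W4 `&` [set q | q a <> q b]); split.
- by apply: copenI hW4 (@copen_neq _ a b).
- by exists q0.
- have cu' : cmg (W4 `&` [set q | q a <> q b]) (rvc u3 (v3 n) (gball dG gs c)).
    by apply: cmg_sub cu => x [[]].
  have cw' : cmg (W4 `&` [set q | q a <> q b]) (rvc (w3 n) (v3 n) Wi).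
    by apply: cmg_sub cw => x [[]].
  have ck' : cmg (W4 `&` [set q | q a <> q b]) (k @^-1` rvc (w3 n) (v3 n) Wi).
    apply: (@cmg_sub _ (k @^-1` W3)); first by move=> x [[]].
    by apply: (cmg_homeo ck ck) cw; exact: proj_transpK.
  apply: cmgS (cmgI cu' (cmgI cw' ck')) => q [[g Vg e1] [[g1 h1 e2] [g2 h2 e3]]].
  (* [g1] and [g2] carry one common image to the images of [q] and of [k q] under [v3 n], the latter
     being that of [q] under [v3 n.+1]. Both lie in [Wi], so [g2 * g1^-1] is close to 1 and [P]
     applies. *)
  exists (g2 * g1^-1 * g)%g.
    by apply: Pcm => //=; have := hr _ _ h2 h1; rewrite invgF divgKA.
  move: e1 e2 e3; rewrite /= v3_step w3_transp => e1 e2 ->.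
  by rewrite !actM -e1 e2 actVK.
move=> q [[h1 h2] h3]; split=> //.
- exists (shift b (- d) q); last by rewrite na.
  exact/s1/s2.
- exists (shift b (- d) (k q)); last by rewrite na // -v3_step.
  exact/s1/s2.
Qed.

(* An open set of points, an open set of group elements, and two cylinders, each
   given by its center and its level. *)
Definition stage := (set Q * set G * (Q * nat) * (Q * nat))%type.

Definition invariant n (x : stage) := let: (U, V, A, B) := x in
  [/\ copen U, U !=set0, open V, cmg U (rvc u3 (v3 n) V) &
      forall q, U q -> cyl A.1 A.2 (proj u3 q) /\ cyl B.1 B.2 (proj (v3 n) q)].

Definition refines n (x y : stage) := let: (U, V, A, B) := x in let: (U', V', A', B') := y in
  [/\ exists c, (n <= c.2)%N /\ V' `<=` gball dG gs c `&` V,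
      (n < A'.2)%N /\ ccyl A'.1 A'.2 `<=` ccyl A.1 A.2 `&` E n,
      (n < B'.2)%N /\ ccyl B'.1 B'.2 `<=` ccyl B.1 B.2 `&` E n &
      forall z w, ccyl A'.1 A'.2 z -> ccyl B'.1 B'.2 w -> z n <> w n].

(** The two projections of a generic point [p] serve as centres of the new cylinders. Its
    coordinates [3 n] and [3 n + 1] differ, so small cylinders separate the coordinate [n] of the
    two future limits. *)
Lemma fusion_step n x : invariant n x -> exists y, invariant n.+1 y /\ refines n x y.
Proof.
case: x => [[[U V] [a ma]] [b mb]] /= [hU nU oV cV hAB].
have cov g : V g -> exists c, ((n <= c.2)%N /\ gcball dG gs c `<=` V) /\ gball dG gs c g.
  move=> Vg; have [c [h1 h2 h3]] := exists_gball dG_metric dG_compat gs_dense n oV Vg.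
  by exists c.
have [c [W1 [[cn cV'] hW1 s1 n1 c1]]] := rv_refine spread_u3 (spread_v3 n) hU nU cV
  (fun c _ => gball_open gs dG_metric dG_compat c) cov.
have [W2 [hW2 n2 c2 h2]] := step hW1 n1 (gball_open gs dG_metric dG_compat c) c1.
have cE : cmg W2 (proj u3 @^-1` Cf `&` proj (v3 n.+1) @^-1` Cf).
  apply: (@cmg_sub _ setT) => //; have [u1 u2] := spread_u3; have [v1 v2] := spread_v3 n.+1.
  by apply: cmgI; apply: cmg_proj => //; exact: cmg_Cf.
have [p W2p [Eu Ev]] := baire hW2 n2 cE.
have [pn [x1 Ux1 eq1] [x2 Ux2 eq2]] := h2 p W2p.
set p1 := proj u3 p in Eu eq1; set p2 := proj (v3 n.+1) p in Ev eq2.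
have d0 : 0 < `|p1 n - p2 n|.
  rewrite normr_gt0 subr_eq0; apply/eqP; rewrite /p1 /p2 /proj /= /u3 /v3 ltnSn; exact: pn.
have [M hM] := exists_radius (divr_gt0 d0 (ltr0n R 2)).
have [m1 Mm1 hm1] : exists2 m, (maxn n.+1 M <= m)%N & ccyl p1 m `<=` cyl a ma `&` E n.
  apply: copen_shrink; first exact: copenI (@copen_cyl _ _ _) (hE n).1.
  by split; [rewrite eq1; have [] := hAB x1 (s1 _ Ux1)|exact: Eu].
have [m2 Mm2 hm2] : exists2 m, (maxn n.+1 M <= m)%N & ccyl p2 m `<=` cyl b mb `&` E n.
  apply: copen_shrink; first exact: copenI (@copen_cyl _ _ _) (hE n).1.
  by split; [rewrite eq2; have [] := hAB x2 (s1 _ Ux2)|exact: Ev].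
rewrite !geq_max in Mm1 Mm2; have [/andP[nm1 Mm1'] /andP[nm2 Mm2']] := (Mm1, Mm2).
pose W3 := W2 `&` (proj u3 @^-1` cyl p1 m1 `&` proj (v3 n.+1) @^-1` cyl p2 m2).
exists (W3, gball dG gs c, (p1, m1), (p2, m2)); split.
  split=> /=.
  - by apply: copenI hW2 _; apply: copenI; apply: cont_open (@cont_proj _ _) (@copen_cyl _ _ _).
  - by exists p; split=> //; split; exact: cyl_refl.
  - exact: gball_open.
  - by apply: cmg_sub c2 => q [].
  - by move=> q [_ []].
split=> /=.
- by exists c; split=> // g cg; split=> //; apply: cV'; exact: ltW.
- by split=> // z /hm1[h1 h3]; split=> //; exact: cyl_ccyl.
- by split=> // z /hm2[h1 h3]; split=> //; exact: cyl_ccyl.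
move=> z w /(_ n nm1) hz /(_ n nm2) hw e.
have r1 := radius_le R Mm1'; have r2 := radius_le R Mm2'.
have := ler_distD (z n) (p1 n) (p2 n); rewrite leNgt => /negP; apply.
rewrite distrC [in X in _ + X]e; move: hz hw r1 r2 hM.
by set y1 := m1.+1%:R^-1; set y2 := m2.+1%:R^-1; set y3 := _^-1; lra.
Qed.

Lemma cyl_close (q : nat -> Q) (m : nat -> nat) (z : Q) (y : nat -> Q) k :
  (forall n, (n <= m n)%N) -> (forall n, ccyl (q n) (m n) z) ->
  (forall n, ccyl (q n) (m n) (y n)) ->
  exists N, forall n, (N <= n)%N -> cyl z k (y n).
Proof.
move=> hm hz hy; have [M hM] := exists_radius (divr_gt0 (radius_gt0 R k) (ltr0n R 2)).
exists (maxn k M) => n; rewrite geq_max => /andP[kn Mn] i ik.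
have im : (i < m n)%N by apply: leq_trans ik (leq_trans kn (hm n)).
have h1 := hz n i im; have h2 := hy n i im.
have h3 := radius_le R (leq_trans Mn (hm n)).
apply: (le_lt_trans (ler_distD (q n i) (y n i) (z i))); rewrite [X in _ + X]distrC.
by move: h1 h2 h3 hM; set x1 := (m n).+1%:R^-1; set x2 := M.+1%:R^-1; set x3 := _^-1; lra.
Qed.

(** The limits [z] and [w] are not images of one generic point; the orbit relation reaches them from
    generic points [q n] of the stages, by continuity of [f] on [Cf]. This is why the cylinders of a
    stage are also kept inside [E n]. *)
Lemma fusion_absurd : False.
Proof.
have /choice[nx hnx] : forall nx : nat * stage, exists y, invariant nx.1 nx.2 ->
    invariant nx.1.+1 y /\ refines nx.1 nx.2 y.
  move=> [n x]; case: (pselect (invariant n x)) => [/fusion_step[y hy]|h]; last by exists x.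
  by exists y.
(* At stage 0 the projections by [v3 0] and [u3] coincide, so the relation holds everywhere with the
   whole group as [V]. *)
pose st := fix st n : stage := if n is k.+1 then nx (k, st k)
  else (setT, setT, ((fun=> 0), 0%N), ((fun=> 0), 0%N)).
have inv n : invariant n (st n).
  elim: n => [|n IH] /=; last by have [] := hnx (n, st n) IH.
  split=> //; first exact: copenT.
  - by exists (fun=> 0).
  - exact: openT.
  - by apply: rvc_total => q; exists 0%N.
have ref n : refines n (st n) (st n.+1) by have [] := hnx (n, st n) (inv n).
pose U n := (st n).1.1.1; pose V n := (st n).1.1.2.
pose A n := (st n).1.2; pose B n := (st n).2.
have invE n : [/\ copen (U n), U n !=set0, open (V n), cmg (U n) (rvc u3 (v3 n) (V n)) &
      forall q, U n q -> cyl (A n).1 (A n).2 (proj u3 q) /\ cyl (B n).1 (B n).2 (proj (v3 n) q)].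
  by have := inv n; rewrite /U /V /A /B; case: (st n) => [[[? ?] ?] ?].
have refE n : [/\ exists c, (n <= c.2)%N /\ V n.+1 `<=` gball dG gs c `&` V n,
      (n < (A n.+1).2)%N /\ ccyl (A n.+1).1 (A n.+1).2 `<=` ccyl (A n).1 (A n).2 `&` E n,
      (n < (B n.+1).2)%N /\ ccyl (B n.+1).1 (B n.+1).2 `<=` ccyl (B n).1 (B n).2 `&` E n &
      forall z w, ccyl (A n.+1).1 (A n.+1).2 z -> ccyl (B n.+1).1 (B n.+1).2 w -> z n <> w n].
  have := ref n; rewrite /V /A /B; move: (st n) (st n.+1) => [[[? ?] ?] ?] [[[? ?] ?] ?]; exact.
have mA n : (n <= (A n).2)%N by case: n => // n; have [_ []] := refE n.
have mB n : (n <= (B n).2)%N by case: n => // n; have [_ _ []] := refE n.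
have [z hz] : exists z, forall n, ccyl (A n).1 (A n).2 z.
  apply: (@nested_limit R (fun n => (A n).1) (fun n => (A n).2)) => // n q hq.
  by have [_ [_ /(_ q hq)[]]] := refE n.
have [w hw] : exists w, forall n, ccyl (B n).1 (B n).2 w.
  apply: (@nested_limit R (fun n => (B n).1) (fun n => (B n).2)) => // n q hq.
  by have [_ _ [_ /(_ q hq)[]]] := refE n.
have Cz : Cf z by move=> n; have [_ [_ /(_ z (hz n.+1))[]]] := refE n.
have Cw : Cf w by move=> n; have [_ _ [_ /(_ w (hw n.+1))[]]] := refE n.
have /choice[q hq] : forall n, exists q, [/\ U n q, rvc u3 (v3 n) (V n) q,
    Cf (proj u3 q) & Cf (proj (v3 n) q)].
  move=> n; have [h1 h2 _ h3 _] := invE n.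
  have cE : cmg (U n) (proj u3 @^-1` Cf `&` proj (v3 n) @^-1` Cf).
    apply: (@cmg_sub _ setT) => //; have [u1 u2] := spread_u3; have [v1 v2] := spread_v3 n.
    by apply: cmgI; apply: cmg_proj => //; exact: cmg_Cf.
  by have [q Uq [h4 [h5 h6]]] := baire h1 h2 (cmgI h3 cE); exists q.
have /choice[g hg] : forall n, exists g, V n g /\ f (proj (v3 n) (q n)) = act g (f (proj u3 (q n))).
  by move=> n; have [_ [g]] := hq n; exists g.
have lim (K : nat -> Q * nat) x y : (forall n, (n <= (K n).2)%N) ->
    (forall n, ccyl (K n).1 (K n).2 x) -> Cf x -> (forall n, Cf (y n)) ->
    (forall n, ccyl (K n).1 (K n).2 (y n)) ->
    forall e : R, 0 < e -> exists N, forall n, (N <= n)%N -> dZ (f x) (f (y n)) < e.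
  move=> hK hx Cx Cy hy e /(cont_f Cx)[m hm].
  have [N hN] := cyl_close m hK hx hy.
  by exists N => n /hN; exact: hm.
have Vm n k : V (n + k)%N `<=` V n.
  elim: k => [|k IH]; first by rewrite addn0.
  rewrite addnS => h /=; have [[c [_ hc]] _ _ _] := refE (n + k)%N.
  by move=> /hc[_]; exact: IH.
have lu := lim A z (fun n => proj u3 (q n)) mA hz Cz.
have {lu} lu : forall e : R, 0 < e -> exists N, forall n, (N <= n)%N ->
    dZ (f z) (f (proj u3 (q n))) < e.
  apply: lu => n; first by have [] := hq n.
  have [_ _ _ _ h] := invE n; have [Uq _ _ _] := hq n; exact/cyl_ccyl/(h _ Uq).1.
have lv := lim B w (fun n => proj (v3 n) (q n)) mB hw Cw.
have {lv} lv : forall e : R, 0 < e -> exists N, forall n, (N <= n)%N ->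
    dZ (f w) (f (proj (v3 n) (q n))) < e.
  apply: lv => n; first by have [] := hq n.
  have [_ _ _ _ h] := invE n; have [Uq _ _ _] := hq n; exact/cyl_ccyl/(h _ Uq).2.
have [|g0 [e0 _]] := act_limit dG_compat dG_complete dZ_metric dZ_compat act_c _
    lu lv (fun n => (hg n).2).
  move=> e e0; have [M hM] := exists_radius (divr_gt0 e0 (ltr0n R 2)).
  have [[c [Mc hc]] _ _ _] := refE M.
  exists M.+1 => m n hm hn.
  have h1 : gball dG gs c (g m).
    have [Vg _] := hg m; have : V M.+1 (g m).
      by apply: (@Vm M.+1 (m - M.+1)%N); rewrite subnKC.
    by move=> /hc[].
  have h2 : gball dG gs c (g n).
    have [Vg _] := hg n; have : V M.+1 (g n).
      by apply: (@Vm M.+1 (n - M.+1)%N); rewrite subnKC.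
    by move=> /hc[].
  apply: lt_trans (gball_dist dG_metric h1 h2) _.
  by have := radius_le R Mc; move: hM; set x1 := M.+1%:R^-1; set x2 := c.2.+1%:R^-1; lra.
have [N hN] : exists n, forall m, (n <= m)%N -> z m = w m by apply/f_E1; exists g0.
have [_ _ _ h] := refE N; exact: (h z w (hz _) (hw _) (hN N (leqnn N))).
Qed.

End Orbits.

Theorem E1_not_orbit (R : realType) (G : topologicalGroupType) (Z : topologicalType)
    (act : G -> Z -> Z) : polish R G -> polish R Z -> continuous_action act ->
  ~ borel_reducible (borel {ptws nat -> R}) (borel Z) (@E1 R) (orbit_rel act).
Proof.
move=> [sG [dG [mG cG kG]]] [sZ [dZ [mZ cZ kZ]]] hact [f [fB fE]].
have [gs hgs] := dense_sequence mG cG 1%g sG.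
have [C [[E [hE EC]] fC]] := borel_cont_on mZ cZ sZ fB.
apply: (fusion_absurd mG cG kG hgs mZ cZ hact hE _ fE).
by apply: cont_on_sub fC => q Eq; exact: EC.
Qed.

Theorem theorem2p19 (R : realType) :
  exists X : completeNormedModType R,
    [/\ separable X,
        borel_reducible (borel {ptws nat -> R}) (borel_cs X)
          (@E1 R) (cs_iso X) &
        forall (G : topologicalGroupType) (Z : topologicalType)
          (act : G -> Z -> Z),
          polish R G -> polish R Z -> continuous_action act ->
          ~ borel_reducible (borel_cs X) (borel Z)
              (cs_iso X) (orbit_rel act)].
Proof.
exists (c0sum R); split; first exact: c0_separable.
  exact: E1_reducible.
move=> G Z act hG hZ hact [f [fB fE]]; have [r [rB rE]] := E1_reducible R.
apply: (E1_not_orbit hG hZ hact); exists (f \o r); split=> [B /fB /rB //|x y].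
by rewrite rE fE.
Qed.
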